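(* Let $h:\mathbb{R}^{2(p-1)}\to\mathbb{R}^r$ be a vector-valued function whose derivative matrix $H(\tilde{\boldsymbol{\theta}})=\frac{\partial}{\partial\tilde{\boldsymbol{\theta}}}h(\tilde{\boldsymbol{\theta}})^T$ (a $2(p-1)\times r$ matrix) is continuous in $\tilde{\boldsymbol{\theta}}$ and has rank $r$. Then the compound Wald statistic $$Q_w=\left[h(\hat{\tilde{\boldsymbol{\theta}}}^n)-h(\tilde{\boldsymbol{\theta}})\right]^T\left[H^T(\hat{\tilde{\boldsymbol{\theta}}}^n)\left(\tilde J^n(\hat{\boldsymbol{\theta}}^n)\right)^{-1}H(\hat{\tilde{\boldsymbol{\theta}}}^n)\right]^{-1}\left[h(\hat{\tilde{\boldsymbol{\theta}}}^n)-h(\tilde{\boldsymbol{\theta}})\right]$$ satisfies $Q_w\Rightarrow_u\mathbf z_r^T\mathbf z_r$ as $n\to\infty$, where $\mathbf z_r$ is a standard normal random vector on $\mathbb{R}^r$; i.e. $Q_w$ has an asymptotic $\chi^2_r$ distribution. Here $\Rightarrow_u$ means: for every $\boldsymbol{\theta}\in\mathbb{R}^{m+2(p-1)}$ and every sequence of parameters $\boldsymbol{\theta}^n\to\boldsymbol{\theta}$, the statistic $Q_w$, computed with $\tilde{\boldsymbol{\theta}}$ replaced by the bias components $\tilde{\boldsymbol{\theta}}^n$ of $\boldsymbol{\theta}^n$ and with the data distributed according to $\mathbb{P}_{\boldsymbol{\theta}^n}$, converges in distribution to $\mathbf z_r^T\mathbf z_r$.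
   Context: Model. Fix integers $p\ge2$ (laboratories; laboratory 1 is the reference) and $m\ge2$ (levels), and known positive constants $\sigma^2_{x_j}$ and $\sigma^2_{ij}$ ($i=1,\dots,p$, $j=1,\dots,m$). The parameter is $\boldsymbol{\theta}=(\mu_{x_1},\dots,\mu_{x_m},\alpha_2,\dots,\alpha_p,\beta_2,\dots,\beta_p)^T\in\mathbb{R}^{m+2(p-1)}$, with bias components $\tilde{\boldsymbol{\theta}}=(\alpha_2,\dots,\alpha_p,\beta_2,\dots,\beta_p)^T$; put $\alpha_1=0$, $\beta_1=1$. The unobserved variables $x_j\sim N(\mu_{x_j},\sigma^2_{x_j})$ and the errors $e_{ijk}\sim N(0,\sigma^2_{ij})$ are all mutually independent, and the observations are $Y_{ijk}=\alpha_i+\beta_i x_j+e_{ijk}$, $k=1,\dots,n_i$, $i=1,\dots,p$, $j=1,\dots,m$. Put $n=\sum_{i=1}^p n_i$, and let $\mathbf{Y}^n$ be the vector of all observations. The limit $n\to\infty$ means that $n_i\to\infty$ and $n_i/n\to w_i$ for every $i$, with $w_i>0$ constants. $\mathbb{P}_{\boldsymbol{\theta}}$ denotes the law of the observed data under parameter $\boldsymbol{\theta}$. $L^n(\boldsymbol{\theta})=\log f_{\mathbf{Y}^n}(\mathbf{Y}^n,\boldsymbol{\theta})$ is the log-likelihood of the observed data (the marginal normal density of $\mathbf{Y}^n$, with $x_1,\dots,x_m$ integrated out), $J^n(\boldsymbol{\theta})=-\frac{\partial^2L^n(\boldsymbol{\theta})}{\partial\boldsymbol{\theta}\,\partial\boldsymbol{\theta}^T}$,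 and $\tilde J^n(\boldsymbol{\theta})$ is the $2(p-1)\times2(p-1)$ submatrix of $J^n(\boldsymbol{\theta})$ obtained by deleting the rows and columns associated with $\mu_{x_1},\dots,\mu_{x_m}$. $\hat{\boldsymbol{\theta}}^n$ is the maximum likelihood estimator (a maximizer of $L^n$ over $\mathbb{R}^{m+2(p-1)}$) and $\hat{\tilde{\boldsymbol{\theta}}}^n$ is its bias part (its last $2(p-1)$ components). On the event where one of the inverses in the definition of $Q_w$ does not exist, $Q_w$ is assigned an arbitrary value (e.g. $0$). *)

(* Defs.v *)
From HB Require Import structures.
From mathcomp Require Import all_boot all_order all_algebra.
From mathcomp Require Import all_classical all_reals all_analysis.
Set Implicit Arguments.
Unset Strict Implicit.
Unset Printing Implicit Defensive.
Import Order.TTheory GRing.Theory Num.Theory.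
Import numFieldNormedType.Exports.
Local Open Scope classical_set_scope.
Local Open Scope ring_scope.

(* Conventions.
   - There are p = q.+1 laboratories, indexed by 'I_q.+1, and [ord0] is the
     reference laboratory; its bias components are the constants 0 and 1 and
     are not part of the parameter.
   - A parameter is a row vector of width m + (q + q) listing
     mu_1, .., mu_m, then alpha_2, .., alpha_p, then beta_2, .., beta_p.
   - [sx2 j] and [s2 i j] are variances, whereas the last argument of
     [normal_pdf] and [normal_prob] is a standard deviation. *)

Section parameter.
Context {R : realType} {m q : nat}.
Implicit Type t : 'rV[R]_(m + (q + q)).

Definition level_mean t (j : 'I_m) : R := lsubmx t ord0 j.

Definition bias t : 'rV[R]_(q + q) := rsubmx t.

Definition alpha t (i : 'I_q.+1) : R :=
  if unlift ord0 i is Some a then lsubmx (bias t) ord0 a else 0.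

Definition beta t (i : 'I_q.+1) : R :=
  if unlift ord0 i is Some a then rsubmx (bias t) ord0 a else 1.

End parameter.

(* [y i j k] is the k-th replicate of laboratory i at level j. *)
Definition data (R : realType) (m q : nat) (N : 'I_q.+1 -> nat) : Type :=
  forall i : 'I_q.+1, 'I_m -> 'I_(N i) -> R.

(* Iterated Lebesgue integral over R^m; it agrees with the integral against the
   m-fold product measure for nonnegative integrands, the only ones used. *)
Fixpoint integral_rV (R : realType) (m : nat) : ('rV[R]_m -> R) -> R :=
  match m with
  | 0 => fun g => g 0
  | m'.+1 => fun g => \int[@lebesgue_measure R]_x
      integral_rV (fun v : 'rV[R]_m' =>
        g (row_mx (const_mx (x : R) : 'rV[R]_1) v : 'rV[R]_(1 + m')))
  end.

Section likelihood.
Context {R : realType} {m q : nat}.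
Variables (sx2 : 'I_m -> R) (s2 : 'I_q.+1 -> 'I_m -> R) (N : 'I_q.+1 -> nat).
Implicit Types (t : 'rV[R]_(m + (q + q))) (y : data R m N).

Definition complete_density y t (x : 'rV[R]_m) : R :=
  (\prod_(j < m) normal_pdf (level_mean t j) (Num.sqrt (sx2 j)) (x ord0 j)) *
  \prod_(i < q.+1) \prod_(j < m) \prod_(k < N i)
     normal_pdf (alpha t i + beta t i * x ord0 j) (Num.sqrt (s2 i j)) (y i j k).

Definition marginal_density y t : R := integral_rV (complete_density y t).

Definition loglik y t : R := ln (marginal_density y t).

Definition is_mle y t : Prop := forall t', loglik y t' <= loglik y t.

Definition partial (d : nat) (a : 'I_d) (f : 'rV[R]_d -> R) (v : 'rV[R]_d) : R :=
  'D_(delta_mx ord0 a) f v.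

Definition info y t : 'M[R]_(m + (q + q)) :=
  \matrix_(a, b) - partial a (partial b (loglik y)) t.

Definition bias_info y t : 'M[R]_(q + q) := drsubmx (info y t).

(* [jacobian h v] acts on row vectors from the right, hence its (a, b) entry is
   the derivative of the b-th component of h in the a-th variable. *)
Definition wald (r : nat) (h : 'rV[R]_(q + q) -> 'rV[R]_r) y
    (that : 'rV[R]_(m + (q + q))) (b0 : 'rV[R]_(q + q)) : R :=
  let H := jacobian h (bias that) in
  let J := bias_info y that in
  let V := H^T *m invmx J *m H in
  let u := h (bias that) - h b0 in
  if (J \in unitmx) && (V \in unitmx)
  then (u *m invmx V *m u^T) ord0 ord0 else 0.

End likelihood.

Definition mutually_independent d (T : measurableType d) (R : realType)
    (P : probability T R) (I : finType) (X : I -> {RV P >-> R}) : Prop :=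
  forall (S : {set I}) (A : I -> set R), (forall i, measurable (A i)) ->
    P [set w | forall i, i \in S -> A i (X i w)] =
    (\prod_(i in S) P (X i @^-1` A i))%E.

Definition has_normal_law d (T : measurableType d) (R : realType)
    (P : probability T R) (X : {RV P >-> R}) (mean var : R) : Prop :=
  forall A : set R, measurable A ->
    distribution P X A = normal_prob mean (Num.sqrt var) A.

Section model.
Context {R : realType} {m q : nat}.
Variables (sx2 : 'I_m -> R) (s2 : 'I_q.+1 -> 'I_m -> R) (N : 'I_q.+1 -> nat).
Context d (T : measurableType d) (P : probability T R).
Variables (x : 'I_m -> {RV P >-> R})
          (e : forall i : 'I_q.+1, 'I_m -> 'I_(N i) -> {RV P >-> R}).

Definition latent (u : 'I_m + {i : 'I_q.+1 & ('I_m * 'I_(N i))%type}) :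
    {RV P >-> R} :=
  match u with
  | inl j => x j
  | inr s => e (tagged s).1 (tagged s).2
  end.

Definition latent_model (t : 'rV[R]_(m + (q + q))) : Prop :=
  [/\ forall j, has_normal_law (x j) (level_mean t j) (sx2 j),
      forall i j (k : 'I_(N i)), has_normal_law (e j k) 0 (s2 i j) &
      mutually_independent latent].

Definition observation (t : 'rV[R]_(m + (q + q))) (w : T) : data R m N :=
  fun i j k => alpha t i + beta t i * x j w + e j k w.

End model.

Definition standard_normal_vector d (T : measurableType d) (R : realType)
    (P : probability T R) (r : nat) (z : 'I_r -> {RV P >-> R}) : Prop :=
  (forall l, has_normal_law (z l) 0 1) /\ mutually_independent z.

(* Weak convergence of laws; the variables may live on different spaces. *)
Definition cvg_in_distribution (R : realType)
    (d : nat -> measure_display) (T : forall nu, measurableType (d nu))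
    (P : forall nu, probability (T nu) R) (X : forall nu, T nu -> R)
    d' (T' : measurableType d') (P' : probability T' R) (Z : T' -> R) : Prop :=
  [/\ forall nu, measurable_fun [set: T nu] (X nu),
      measurable_fun [set: T'] Z &
      forall f : R -> R, continuous f -> (exists M : R, forall s, `|f s| <= M) ->
        (\int[P nu]_w f (X nu w))%R @[nu --> \oo] --> (\int[P']_w f (Z w))%R].

(* Main.v *)
(* Completing the square in x_j gives the log-likelihood in closed form; it depends on the
   data through the cell means only.  Under P_(theta^n) the cell means are fixed functions of
   the standardized levels xi_j and of the normalized cell means g_ij of the errors, and the
   pair (xi, g) is a standard Gaussian vector whose law does not depend on n.  It is therefore
   enough to follow Q_w along sequences of outcomes for which (xi, g) converges, and to do so
   off the null set where the limiting levels x_0 and x_1 coincide.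

   Along such a sequence, comparing the maximum of the likelihood with its value at the true
   biases and at the realized levels bounds the residuals and makes the estimator consistent.
   The score equations are then an asymptotically linear regression: eliminating the estimated
   levels, sqrt n (estimated - true biases) tends to g S J^-1, where J = S^T S is the limit of
   the information matrix divided by n and the design matrix S depends on the levels x_j.  By
   the mean value theorem Q_w tends to the squared length of the projection of g on the range
   of S J^-1 H, which has dimension r.  This range is random, since the levels are not averaged
   out, but conditionally on xi the squared length has the chi-square law with r degrees of
   freedom, whatever xi is. *)

Require Import Defs.
From HB Require Import structures.
From mathcomp Require Import all_boot all_order all_algebra.
From mathcomp Require Import all_classical all_reals all_analysis.
From mathcomp Require Import measurable_realfun.
From mathcomp Require Import ring lra.
Import Order.TTheory GRing.Theory Num.Theory.
Import numFieldNormedType.Exports.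
Set Implicit Arguments.
Unset Strict Implicit.
Unset Printing Implicit Defensive.
Local Open Scope classical_set_scope.
Local Open Scope ring_scope.

(** * Gaussian measures on row vectors *)

(** Each level is drawn only once, so its mean cannot be estimated consistently: the fitted level
    means tend to the realized levels, and the information divided by n has a random limit. Both
    difficulties disappear when convergence is checked pointwise along outcomes taken one from each
    space, and transferred to laws only at the end. The reference laboratory, with intercept 0 and
    slope 1, pins down the realized levels, and two distinct levels separate intercepts from slopes;
    hence the exclusion of coinciding limiting levels. On the probabilistic side everything rests on
    the invariance of the standard Gaussian law under matrices with orthonormal columns. It is
    obtained from plane rotations, each a product of three shears, so that in the plane only Tonelli
    and translation invariance on the line are required. *)

Definition mx_display : measure_display. Proof. exact: default_measure_display. Qed.

Definition mx_box (R : realType) (a b : nat) (A : 'I_a -> 'I_b -> set R) : set 'M[R]_(a, b) :=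
  [set M | forall i j, A i j (M i j)].

Definition mx_boxes (R : realType) (a b : nat) : set (set 'M[R]_(a, b)) :=
  [set B | exists2 A, forall i j, measurable (A i j) & B = mx_box A].

Section mx_measurable.
Context {R : realType} {a b : nat}.

Let mx_set0 : <<s @mx_boxes R a b >> set0.
Proof. exact: sigma_algebra0. Qed.
Let mx_setC A : <<s @mx_boxes R a b >> A -> <<s @mx_boxes R a b >> (~` A).
Proof. exact: sigma_algebraC. Qed.
Let mx_bigcup (F : _^nat) : (forall i, <<s @mx_boxes R a b >> (F i)) ->
  <<s @mx_boxes R a b >> (\bigcup_i (F i)).
Proof. exact: sigma_algebra_bigcup. Qed.

HB.instance Definition _ := @isMeasurable.Build mx_display
  'M[R]_(a, b) <<s @mx_boxes R a b >> mx_set0 mx_setC mx_bigcup.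

Lemma measurable_box A : (forall i j, measurable (A i j)) -> measurable (@mx_box R a b A).
Proof. by move=> mA; apply: sub_sigma_algebra; exists A. Qed.

Lemma measurable_coord i j : measurable_fun setT (fun M : 'M[R]_(a, b) => M i j).
Proof.
move=> _ Y mY; rewrite setTI.
rewrite [X in measurable X](_ : _ = mx_box (fun i' j' => if (i' == i) && (j' == j) then Y else setT)).
  by apply: measurable_box => i' j'; case: ifP.
apply/seteqP; split=> [M /= MY i' j'|M /(_ i j)]; last by rewrite !eqxx.
by case: ifP => // /andP[/eqP-> /eqP->].
Qed.

Lemma measurable_mxP d (T : measurableType d) (f : T -> 'M[R]_(a, b)) :
  (forall i j, measurable_fun setT (fun w => f w i j)) -> measurable_fun setT f.
Proof.
move=> mf; apply: (@measurability _ _ _ _ setT f (@mx_boxes R a b)) => //.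
move=> _ [_ [A mA ->] <-]; rewrite setTI.
rewrite [X in measurable X](_ : _ = \bigcap_(p in [set: 'I_a * 'I_b])
    ((fun w => f w p.1 p.2) @^-1` (A p.1 p.2))).
  apply: fin_bigcap_measurable => [|p _]; first exact: finite_finset.
  by rewrite -[X in measurable X]setTI; exact: mf.
by apply/seteqP; split => [w fA p _|w fA i j]; [exact: fA|exact: (fA (i, j))].
Qed.

Lemma measurable_coordP d (T : measurableType d) (f : T -> 'M[R]_(a, b)) i j :
  measurable_fun setT f -> measurable_fun setT (fun w => f w i j).
Proof. by move=> mf; exact: (measurableT_comp (measurable_coord i j)). Qed.

Lemma mx_boxI : setI_closed (@mx_boxes R a b).
Proof.
move=> _ _ [A mA ->] [B mB ->]; exists (fun i j => A i j `&` B i j).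
  by move=> i j; exact: measurableI.
apply/seteqP; split => [M [MA MB] i j|M MAB]; first by split; [exact: MA|exact: MB].
by split=> i j; have [] := MAB i j.
Qed.

(** A pi-lambda argument: boxes generate the sigma-algebra and are stable under intersection. *)
Lemma mx_probability_unique (P Q : probability 'M[R]_(a, b) R) :
  (forall A, (forall i j, measurable (A i j)) -> P (mx_box A) = Q (mx_box A)) ->
  forall X, measurable X -> P X = Q X.
Proof.
move=> PQ; apply: (@measure_unique _ _ _ (@mx_boxes R a b) (fun=> setT)) => //.
- exact: mx_boxI.
- by move=> _; exists (fun _ _ => setT) => //; apply/seteqP; split.
- by rewrite bigcup_const//; exists 0%N.
- by move=> _ [A mA ->]; exact: PQ.
- by move=> _; apply: le_lt_trans (probability_le1 _ _) _ => //; rewrite ltry.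
Qed.

End mx_measurable.

(** * The standard Gaussian law, by recursion on the dimension *)

Section gauss.
Context {R : realType}.
Local Open Scope ereal_scope.
Local Notation mu := (@lebesgue_measure R).

(** The same splitting of a row as in [integral_rV], so that the coordinate lemmas below also serve
    to integrate the likelihood. *)
Definition rV_cons n (p : measurableTypeR R * 'rV[R]_n) : 'rV[R]_n.+1 :=
  row_mx (const_mx p.1 : 'rV[R]_1) p.2.

Lemma rV_cons0 n x (v : 'rV[R]_n) : rV_cons (x, v) ord0 ord0 = x.
Proof.
have -> : (ord0 : 'I_n.+1) = @lshift 1 n ord0 by exact: val_inj.
by transitivity ((const_mx x : 'M[R]_1) ord0 ord0); [exact: row_mxEl|rewrite mxE].
Qed.

Lemma rV_consS n x (v : 'rV[R]_n) i : rV_cons (x, v) ord0 (lift ord0 i) = v ord0 i.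
Proof.
have -> : (lift ord0 i : 'I_n.+1) = @rshift 1 n i by exact: val_inj.
exact: row_mxEr.
Qed.

Lemma measurable_rV_cons n : measurable_fun setT (@rV_cons n).
Proof.
apply: measurable_mxP => i j; rewrite (ord1 i).
have [k ->|->] := unliftP ord0 j.
  rewrite (_ : (fun _ => _) = (fun p : measurableTypeR R * 'rV[R]_n => p.2 ord0 k)).
    exact: (measurableT_comp (measurable_coord _ _)).
  by apply/funext => -[x v]; rewrite rV_consS.
rewrite (_ : (fun _ => _) = fst) //.
by apply/funext => -[x v]; rewrite rV_cons0.
Qed.

HB.instance Definition _ n := isMeasurableFun.Build _ _ _ _ (@rV_cons n) (@measurable_rV_cons n).

(** Built one coordinate at a time from a Dirac mass in dimension 0, so that Tonelli peels off the
    first coordinate. *)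
Fixpoint gauss n : probability 'rV[R]_n R :=
  if n is n'.+1 then distribution (normal_prob 0 1 \x gauss n') [the {mfun _ >-> _} of @rV_cons n']
  else \d_(0%R : 'rV[R]_0).

Lemma ge0_integral_gaussS n (F : 'rV[R]_n.+1 -> \bar R) :
  measurable_fun setT F -> (forall v, 0 <= F v) ->
  \int[gauss n.+1]_v F v =
  \int[normal_prob 0 1]_x \int[gauss n]_v F (rV_cons (x, v)).
Proof.
move=> mF F0; rewrite /= ge0_integral_distribution// fubini_tonelli1//; last by move=> ? /=.
by apply: measurableT_comp => //; exact: measurable_rV_cons.
Qed.

Lemma gauss_box n (A : 'I_1 -> 'I_n -> set R) : (forall i j, measurable (A i j)) ->
  gauss n (mx_box A) = \prod_(j < n) normal_prob 0 1 (A ord0 j).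
Proof.
elim: n A => [|n IH] A mA.
  by rewrite big_ord0 /= diracE mem_set// => i [].
rewrite big_ord_recl -(IH (fun i j => A i (lift ord0 j)))//.
rewrite /= /distribution /pushforward -product_measure1E//; [|exact: mA|exact: measurable_box].
congr (_ _); apply/seteqP; split=> [[x v] /= vA|[x v] [/= xA vA] i j].
  split=> [|i j] /=; first by have := vA ord0 ord0; rewrite rV_cons0.
  by have := vA i (lift ord0 j); rewrite (ord1 i) rV_consS.
by rewrite (ord1 i); have [k ->|->] := unliftP ord0 j; rewrite ?rV_cons0// rV_consS; exact: vA.
Qed.

(** The image of Lebesgue measure under a translation gives every half-open interval its length, and
    this characterizes Lebesgue measure. *)
Lemma lebesgue_shift (f : measurableTypeR R -> \bar R) (c : R) :
  measurable_fun setT f -> (forall x, 0 <= f x) ->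
  \int[mu]_x f (x + c)%R = \int[mu]_x f x.
Proof.
move=> mf f0; pose phi x := (x + c)%R.
have mphi : measurable_fun (T:=measurableTypeR R) (U:=measurableTypeR R) setT phi by exact: measurable_funD.
rewrite -[LHS](ge0_integral_pushforward mphi mu (D := setT))//.
apply: eq_measure_integral => //= A mA _.
apply/esym/lebesgue_measure_unique => //= _ [[a b]] _ <-.
rewrite /pushforward (_ : _ @^-1` _ = `](a - c)%R, (b - c)%R]%classic).
  by rewrite /= !lebesgue_measure_itv/= !lte_fin ltrD2r; case: ifP => // _; rewrite -!EFinB; congr EFin; ring.
by apply/seteqP; split=> x /=; rewrite !in_itv/= /phi ltrBlDr lerBrDr.
Qed.

End gauss.

(** * Plane rotations of Lebesgue measure and of the normal law *)

Section gauss2.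
Context {R : realType}.
Local Open Scope ereal_scope.
Local Notation mu := (@lebesgue_measure R).

Import HBNNSimple.

(** [normal_prob] is defined on sets by integrating its density; the formula passes to simple
    functions by linearity and to nonnegative functions by monotone convergence. *)
Lemma ge0_integral_normal (m s : R) (f : measurableTypeR R -> \bar R) :
  measurable_fun setT f -> (forall x, 0 <= f x) ->
  \int[normal_prob m s]_x f x = \int[mu]_x (f x * (normal_pdf m s x)%:E).
Proof.
move=> mf f0; pose h := nnsfun_approx measurableT mf.
have mpdf : measurable_fun (T:=measurableTypeR R) setT (fun x => (normal_pdf m s x)%:E).
  by apply/measurable_EFinP; exact: measurable_normal_pdf.
have pdf0 x : 0 <= (normal_pdf m s x)%:E by rewrite lee_fin normal_pdf_ge0.
transitivity (limn (fun n => \int[normal_prob m s]_x (h n x)%:E)).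
  rewrite -monotone_convergence//.
  - by apply: eq_integral => x _; apply/esym/cvg_lim => //; exact: cvg_nnsfun_approx.
  - by move=> n; exact/measurable_EFinP.
  - by move=> n x _; rewrite lee_fin.
  - by move=> x _ a b ab; rewrite lee_fin; exact/lefP/nd_nnsfun_approx.
transitivity (limn (fun n => \int[mu]_x ((h n x)%:E * (normal_pdf m s x)%:E))); last first.
  rewrite -monotone_convergence//.
  - apply: eq_integral => x _; apply/cvg_lim => //; apply: cvgeZr => //.
    exact: cvg_nnsfun_approx.
  - by move=> n; apply: emeasurable_funM => //; exact/measurable_EFinP.
  - by move=> n x _; apply: mule_ge0 => //; rewrite lee_fin.
  - by move=> x _ a b ab; rewrite lee_wpmul2r// lee_fin; exact/lefP/nd_nnsfun_approx.
apply/congr_lim/funext => n; rewrite integralT_nnsfun sintegralE.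
transitivity (\int[mu]_x (\sum_(y \in range (h n))
    (y * \1_(h n @^-1` [set y]) x)%:E * (normal_pdf m s x)%:E)).
  rewrite ge0_integral_fsum//; last 2 first.
  - move=> y; apply: emeasurable_funM => //; apply/measurable_EFinP.
    by apply: measurable_funM.
  - by move=> y x _; rewrite mule_ge0// nnfun_muleindic_ge0.
  apply: eq_fsbigr => y /set_mem [z _ hz].
  rewrite /normal_prob -integralZl//=; last first.
    by apply: (integrableS _ _ (subsetT _)) => //; exact: integrable_normal_pdf.
  rewrite integral_mkcond; apply: eq_integral => x _.
  by rewrite patchE indicE; case: ifPn => _; rewrite ?mulr1// mulr0 mul0e.
apply: eq_integral => x _; rewrite -ge0_mule_fsuml; last by move=> y; exact: nnfun_muleindic_ge0.
by rewrite fsumEFin// -(fimfunE (h n) x).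
Qed.

(** Tonelli puts the sheared variable innermost, where the shear is a translation by the constant
    [a * y]. *)
Lemma fst_shear (f : measurableTypeR R * measurableTypeR R -> \bar R) (a : R) :
  measurable_fun setT f -> (forall p, 0 <= f p) ->
  \int[mu]_x \int[mu]_y f ((x + a * y)%R, y) = \int[mu]_x \int[mu]_y f (x, y).
Proof.
move=> mf f0.
have mg : measurable_fun setT (fun p : measurableTypeR R * measurableTypeR R =>
    f ((p.1 + a * p.2)%R, p.2)).
  apply: measurableT_comp => //; apply: measurable_fun_pair => //.
  apply: (measurable_funD (f := fst)) => //; exact: measurable_funM.
rewrite (fubini_tonelli (fun p : measurableTypeR R * measurableTypeR R => f ((p.1 + a * p.2)%R, p.2)) mg)//.
rewrite (fubini_tonelli f mf)//; apply: eq_integral => y _.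
apply: (lebesgue_shift (f := fun x : measurableTypeR R => f (x, y)) (a * y)) => //.
exact: measurableT_comp.
Qed.

Lemma snd_shear (f : measurableTypeR R * measurableTypeR R -> \bar R) (a : R) :
  measurable_fun setT f -> (forall p, 0 <= f p) ->
  \int[mu]_x \int[mu]_y f (x, (y + a * x)%R) = \int[mu]_x \int[mu]_y f (x, y).
Proof.
move=> mf f0; apply: eq_integral => x _.
apply: (lebesgue_shift (f := fun y : measurableTypeR R => f (x, y)) (a * x)) => //.
exact: measurableT_comp.
Qed.

(** A rotation is a product of three shears. With the tangent of the half-angle [t = (1 - c) / s], x
    becomes x - t y, then y becomes y + s x, then x becomes x - t y again; hence the condition
    [s != 0]. *)
Lemma lebesgue_rotation (f : measurableTypeR R * measurableTypeR R -> \bar R) (c s : R) :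
  measurable_fun setT f -> (forall p, 0 <= f p) -> s != 0%R -> (c ^+ 2 + s ^+ 2 = 1)%R ->
  \int[mu]_x \int[mu]_y f ((c * x - s * y)%R, (s * x + c * y)%R) =
  \int[mu]_x \int[mu]_y f (x, y).
Proof.
move=> mf f0 s0 cs1; pose t : R := ((1 - c) / s)%R.
have ts : (t * s = 1 - c)%R by rewrite /t divfK.
have tc : (t * (1 + c) = s)%R.
  by apply: (mulIf s0); rewrite mulrAC ts -expr2 -[RHS](addrK (c ^+ 2)%R) [(s^+2 + _)%R]addrC cs1; ring.
have msh (g : measurableTypeR R * measurableTypeR R -> \bar R) b : measurable_fun setT g ->
  measurable_fun setT (fun p : measurableTypeR R * measurableTypeR R => g ((p.1 + b * p.2)%R, p.2)).
  move=> mg; apply: measurableT_comp => //; apply: measurable_fun_pair => //.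
  apply: (measurable_funD (f := fst)) => //; exact: measurable_funM.
have msh' (g : measurableTypeR R * measurableTypeR R -> \bar R) b : measurable_fun setT g ->
  measurable_fun setT (fun p : measurableTypeR R * measurableTypeR R => g (p.1, (p.2 + b * p.1)%R)).
  move=> mg; apply: measurableT_comp => //; apply: measurable_fun_pair => //.
  apply: (measurable_funD (f := snd)) => //; exact: measurable_funM.
pose g1 (p : measurableTypeR R * measurableTypeR R) := f ((p.1 - t * p.2)%R, p.2).
pose g2 (p : measurableTypeR R * measurableTypeR R) := g1 (p.1, (p.2 + s * p.1)%R).
have mg1 : measurable_fun setT g1.
  rewrite (_ : g1 = fun p => f ((p.1 + - t * p.2)%R, p.2)); first exact: msh.
  by apply/funext => p; rewrite /g1 mulNr.
transitivity (\int[mu]_x \int[mu]_y g2 ((x + - t * y)%R, y)).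
  apply: eq_integral => x _; apply: eq_integral => y _; rewrite /g2 /g1 /=.
  have cE : c = (1 - t * s)%R by rewrite ts; ring.
  congr (f (_, _)); last by rewrite cE; ring.
  transitivity (c * x - t * (1 + c) * y)%R; first by rewrite tc.
  by rewrite cE; ring.
rewrite (fst_shear (f := g2))//; [|exact: msh'|by move=> p; exact: f0].
rewrite (snd_shear (f := g1))//; last by move=> p; exact: f0.
rewrite -(fst_shear (- t)%R mf f0); apply: eq_integral => x _; apply: eq_integral => y _.
by rewrite /g1 /= mulNr.
Qed.

Lemma normal_pdf01 x : normal_pdf 0 1 x = (normal_peak 1 * expR (- x ^+ 2 / 2))%R :> R.
Proof.
by rewrite /normal_pdf oner_eq0 /normal_fun subr0 expr1n.
Qed.

Lemma normal_pdf_rotation (c s x y : R) : (c ^+ 2 + s ^+ 2 = 1)%R ->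
  (normal_pdf 0 1 x * normal_pdf 0 1 y =
   normal_pdf 0 1 (c * x - s * y) * normal_pdf 0 1 (s * x + c * y))%R.
Proof.
move=> cs1; rewrite !normal_pdf01; move: (normal_peak 1) => p.
have E a b : (p * expR a * (p * expR b) = p * p * expR (a + b))%R.
  by rewrite expRD; ring.
rewrite !E; congr (_ * expR _)%R.
transitivity (- ((c ^+ 2 + s ^+ 2) * (x ^+ 2 + y ^+ 2)) / 2)%R; first by rewrite cs1; field.
by field.
Qed.

Lemma normal2_integral (f : measurableTypeR R * measurableTypeR R -> \bar R) :
  measurable_fun setT f -> (forall p, 0 <= f p) ->
  \int[normal_prob 0 1]_x \int[normal_prob 0 1]_y f (x, y) =
  \int[mu]_x \int[mu]_y (f (x, y) * (normal_pdf 0 1 x * normal_pdf 0 1 y)%:E).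
Proof.
move=> mf f0; rewrite ge0_integral_normal//; last 2 first.
- exact: (measurable_fun_fubini_tonelli_F (m2 := normal_prob 0 1)).
- by move=> x; exact: integral_ge0.
apply: eq_integral => x _; rewrite -ge0_integralZr//; last 2 first.
- exact: measurableT_comp.
- by rewrite lee_fin normal_pdf_ge0.
rewrite ge0_integral_normal//; last 2 first.
- by apply: emeasurable_funM => //; exact: measurableT_comp.
- by move=> y; rewrite mule_ge0// lee_fin normal_pdf_ge0.
by apply: eq_integral => y _; rewrite EFinM muleA.
Qed.

Lemma normal_rotation (f : measurableTypeR R * measurableTypeR R -> \bar R) (c s : R) :
  measurable_fun setT f -> (forall p, 0 <= f p) -> s != 0%R -> (c ^+ 2 + s ^+ 2 = 1)%R ->
  \int[normal_prob 0 1]_x \int[normal_prob 0 1]_y f ((c * x - s * y)%R, (s * x + c * y)%R) =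
  \int[normal_prob 0 1]_x \int[normal_prob 0 1]_y f (x, y).
Proof.
move=> mf f0 s0 cs1.
have mrot : measurable_fun setT (fun p : measurableTypeR R * measurableTypeR R =>
    ((c * p.1 - s * p.2)%R : measurableTypeR R, (s * p.1 + c * p.2)%R : measurableTypeR R)).
  apply: measurable_fun_pair.
    by apply: measurable_funB; exact: measurable_funM.
  by apply: measurable_funD; exact: measurable_funM.
rewrite (normal2_integral (f := fun p => f ((c * p.1 - s * p.2)%R, (s * p.1 + c * p.2)%R)))//; last first.
  exact: (measurableT_comp mf mrot).
rewrite [RHS](normal2_integral mf f0).
pose g (p : measurableTypeR R * measurableTypeR R) := f p * (normal_pdf 0 1 p.1 * normal_pdf 0 1 p.2)%:E.
have mg : measurable_fun setT g.
  apply: emeasurable_funM => //; apply/measurable_EFinP; apply: measurable_funM.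
    by apply: measurableT_comp => //; exact: measurable_normal_pdf.
  by apply: measurableT_comp => //; exact: measurable_normal_pdf.
have g0 p : 0 <= g p by rewrite /g mule_ge0// lee_fin mulr_ge0 ?normal_pdf_ge0.
apply: etrans (lebesgue_rotation mg g0 s0 cs1).
apply: eq_integral => x _; apply: eq_integral => y _; rewrite /g /=; congr (_ * _%:E).
exact: normal_pdf_rotation.
Qed.

Lemma normal_sym (f : measurableTypeR R -> \bar R) :
  measurable_fun setT f -> (forall x, 0 <= f x) ->
  \int[normal_prob 0 1]_x f (- x)%R = \int[normal_prob 0 1]_x f x.
Proof.
move=> mf f0.
have mN : measurable_fun (T:=measurableTypeR R) (U:=measurableTypeR R) setT -%R by exact: oppr_measurable.
rewrite !ge0_integral_normal//; last exact: (measurableT_comp mf mN).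
pose g x := f x * (normal_pdf 0 1 x)%:E.
have mg : measurable_fun setT g.
  by apply: emeasurable_funM => //; apply/measurable_EFinP; exact: measurable_normal_pdf.
transitivity (\int[mu]_x g (- x)%R).
  by apply: eq_integral => x _; rewrite /g !normal_pdf01 sqrrN.
transitivity (\int[pushforward mu (-%R : _ -> measurableTypeR R)]_x g x); last first.
  by apply: eq_measure_integral => //= A mA _; exact: lebesgue_measureN.
rewrite (ge0_integral_pushforward mN)//.
by move=> x _; rewrite mule_ge0// lee_fin normal_pdf_ge0.
Qed.

End gauss2.

Section measurable_matrix_ops.
Context {R : realType} d (T : measurableType d).

Lemma measurable_mulmx a b c (f : T -> 'M[R]_(a, b)) (g : T -> 'M[R]_(b, c)) :
  measurable_fun setT f -> measurable_fun setT g ->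
  measurable_fun setT (fun w => f w *m g w).
Proof.
move=> mf mg; apply: measurable_mxP => i j.
rewrite (_ : (fun _ => _) = (fun w => \sum_k f w i k * g w k j)).
  by apply: measurable_sum => k; apply: measurable_funM; exact: measurable_coordP.
by apply/funext => w; rewrite mxE.
Qed.

Lemma measurable_trmx a b (f : T -> 'M[R]_(a, b)) :
  measurable_fun setT f -> measurable_fun setT (fun w => (f w)^T).
Proof.
move=> mf; apply: measurable_mxP => i j.
rewrite (_ : (fun _ => _) = (fun w => f w j i)); first exact: measurable_coordP.
by apply/funext => w; rewrite mxE.
Qed.

End measurable_matrix_ops.

(** * Orthogonal invariance of the Gaussian law *)

Section gauss3.
Context {R : realType}.
Local Open Scope ereal_scope.

Definition gauss_invariant n (O : 'M[R]_n) := forall F : 'rV[R]_n -> \bar R,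
  measurable_fun setT F -> (forall v, 0 <= F v) ->
  \int[gauss n]_v F (v *m O)%R = \int[gauss n]_v F v.

Lemma measurable_mulmxr a b c (A : 'M[R]_(b, c)) :
  measurable_fun setT (fun v : 'M[R]_(a, b) => v *m A)%R.
Proof. by apply: measurable_mulmx => //; exact: measurable_cst. Qed.

Lemma gauss_invariantM n (O1 O2 : 'M[R]_n) :
  gauss_invariant O1 -> gauss_invariant O2 -> gauss_invariant (O1 *m O2).
Proof.
move=> i1 i2 F mF F0; rewrite -(i2 F)// -(i1 (fun v => F (v *m O2)%R))//.
  by apply: eq_integral => v _; rewrite mulmxA.
exact: (measurableT_comp mF (@measurable_mulmxr _ _ _ O2)).
Qed.

Lemma measurable_rV_consr n (F : 'rV[R]_n.+1 -> \bar R) (x : R) :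
  measurable_fun setT F -> measurable_fun setT (fun v : 'rV[R]_n => F (rV_cons (x, v))).
Proof.
move=> mF; apply: (measurableT_comp mF).
exact: (measurableT_comp (@measurable_rV_cons R n) (pair1_measurable (x : measurableTypeR R))).
Qed.

Lemma measurable_int_rV_cons n (F : 'rV[R]_n.+1 -> \bar R) :
  measurable_fun setT F -> (forall v, 0 <= F v) ->
  measurable_fun setT (fun x : measurableTypeR R => \int[gauss n]_v F (rV_cons (x, v))).
Proof.
move=> mF F0.
apply: (measurable_fun_fubini_tonelli_F (m2 := gauss n)
  (fun p : measurableTypeR R * 'rV[R]_n => F (rV_cons p))) => //.
exact: (measurableT_comp mF (@measurable_rV_cons R n)).
Qed.

Lemma rV_cons_block n k (x c : R) (v : 'rV[R]_n) (O : 'M[R]_(n, k)) :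
  (rV_cons (x, v) *m (block_mx c%:M 0 0 O : 'M[R]_(1 + n, 1 + k)) =
   rV_cons (x * c, v *m O))%R.
Proof.
transitivity (row_mx ((const_mx x : 'M[R]_1) *m c%:M + v *m 0)
  ((const_mx x : 'M[R]_1) *m 0 + v *m O)); first exact: (@mul_row_block _ _ 1 n 1 k).
rewrite !mulmx0 addr0 add0r; congr row_mx.
by apply/matrixP => i j; rewrite mxE big_ord1 !mxE !ord1 eqxx mulr1n.
Qed.

Lemma gauss_invariant_block n (O : 'M[R]_n) (c : R) : (c == 1 \/ c == -1)%R ->
  gauss_invariant O -> gauss_invariant (block_mx c%:M 0 0 O : 'M[R]_(1 + n))%R.
Proof.
move=> c1 iO F mF F0.
have mG : measurable_fun setT (fun v => F (v *m (block_mx c%:M 0 0 O : 'M[R]_(1 + n)))%R).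
  exact: (measurableT_comp mF (@measurable_mulmxr _ _ _ _)).
rewrite !ge0_integral_gaussS//.
transitivity (\int[normal_prob 0 1]_x \int[gauss n]_v F (rV_cons ((x * c)%R, v))).
  apply: eq_integral => x _.
  rewrite -(iO (fun v => F (rV_cons ((x * c)%R, v))))//; last exact: measurable_rV_consr.
  by apply: eq_integral => v _; rewrite rV_cons_block.
case: c1 => /eqP ->; first by under eq_integral do rewrite mulr1.
apply: etrans (normal_sym (measurable_int_rV_cons mF F0) _).
  by apply: eq_integral => x _; rewrite mulrN1.
by move=> x; exact: integral_ge0.
Qed.

(** The rotation of the first two coordinates, the others being fixed; it acts on rows from the
    right. *)
Definition rot_mx n (c s : R) : 'M[R]_(1 + (1 + n)) :=
  block_mx c%:M (row_mx s%:M 0) (col_mx (- s)%:M 0) (block_mx c%:M 0 0 1%:M).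

Lemma rV_cons_rot n (x y c s : R) (v : 'rV[R]_n) :
  (rV_cons (x, rV_cons (y, v)) *m rot_mx n c s =
   rV_cons (c * x - s * y, rV_cons (s * x + c * y, v)))%R.
Proof.
transitivity (row_mx
    ((const_mx x : 'M[R]_1) *m c%:M + row_mx (const_mx y : 'M[R]_1) v *m col_mx (- s)%:M 0)
    ((const_mx x : 'M[R]_1) *m row_mx s%:M 0 +
     row_mx (const_mx y : 'M[R]_1) v *m block_mx c%:M 0 0 1%:M)).
  exact: (@mul_row_block _ _ 1 n.+1 1 n.+1).
rewrite mul_row_col mulmx0 addr0 mul_mx_row mulmx0 mul_row_block !mulmx0.
rewrite addr0 add0r mulmx1 add_row_mx add0r.
congr (row_mx _ (row_mx _ _)).
  by apply/matrixP => i j; rewrite !mxE !big_ord1 !mxE !ord1 eqxx !mulr1n /=; ring.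
by apply/matrixP => i j; rewrite !mxE !big_ord1 !mxE !ord1 eqxx !mulr1n /=; ring.
Qed.

Lemma gauss_invariant_rot n (c s : R) : s != 0%R -> (c ^+ 2 + s ^+ 2 = 1)%R ->
  gauss_invariant (rot_mx n c s).
Proof.
move=> s0 cs1 F mF F0.
pose f (p : measurableTypeR R * measurableTypeR R) :=
  \int[gauss n]_v F (rV_cons (p.1, rV_cons (p.2, v))).
have mf : measurable_fun setT f.
  apply: (measurable_fun_fubini_tonelli_F (m2 := gauss n)
    (fun p : measurableTypeR R * measurableTypeR R * 'rV[R]_n =>
      F (rV_cons (p.1.1, rV_cons (p.1.2, p.2))))) => //.
  apply: (measurableT_comp mF).
  apply: (measurableT_comp (@measurable_rV_cons R n.+1)).
  apply: measurable_fun_pair; first exact: (measurableT_comp measurable_fst measurable_fst).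
  apply: (measurableT_comp (@measurable_rV_cons R n)).
  apply: measurable_fun_pair; last exact: measurable_snd.
  exact: (measurableT_comp measurable_snd measurable_fst).
have f0 p : 0 <= f p by exact: integral_ge0.
have step (G : 'rV[R]_n.+2 -> \bar R) : measurable_fun setT G -> (forall v, 0 <= G v) ->
    \int[gauss n.+2]_v G v = \int[normal_prob 0 1]_x \int[normal_prob 0 1]_y
      \int[gauss n]_v G (rV_cons (x, rV_cons (y, v))).
  move=> mG G0; rewrite ge0_integral_gaussS//; apply: eq_integral => x _.
  by rewrite ge0_integral_gaussS//; exact: measurable_rV_consr.
rewrite step//; last exact: (measurableT_comp mF (@measurable_mulmxr _ _ _ _)).
apply: etrans (esym (step F mF F0)).
apply: etrans (normal_rotation mf f0 s0 cs1).
apply: eq_integral => x _; apply: eq_integral => y _; apply: eq_integral => v _.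
by rewrite rV_cons_rot.
Qed.

Lemma gauss_invariant1 n : gauss_invariant (1%:M : 'M[R]_n).
Proof. by move=> F mF F0; apply: eq_integral => v _; rewrite mulmx1. Qed.

(** Reduction by Givens rotations: inductively the tail of the column is turned onto its first axis,
    then a rotation of the first two coordinates clears what remains. *)
Lemma gauss_rotate_col n (a : 'cV[R]_(1 + n)) : exists O : 'M[R]_(1 + n),
  [/\ gauss_invariant O, (O^T *m O = 1%:M)%R &
      exists2 rho : R, (0 <= rho)%R & (O *m a = rho *: delta_mx ord0 ord0)%R].
Proof.
(* When the tail is already zero, only the sign of the head has to be corrected. This also replaces
   the rotation with zero sine, to which [gauss_invariant_rot] does not apply. *)
have flip k (b : 'cV[R]_(1 + k)) : dsubmx b = 0%R -> exists O : 'M[R]_(1 + k),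
  [/\ gauss_invariant O, (O^T *m O = 1%:M)%R &
      exists2 rho : R, (0 <= rho)%R & (O *m b = rho *: delta_mx ord0 ord0)%R].
  move=> b0; pose b1 : R := b ord0 ord0; pose c : R := (if 0 <= b1 then 1 else -1)%R.
  exists (block_mx c%:M 0 0 1%:M)%R; split.
  - apply: gauss_invariant_block; last exact: gauss_invariant1.
    by rewrite /c; case: ifP => _; [left|right].
  - rewrite tr_block_mx !trmx0 !tr_scalar_mx mulmx_block !mulmx0 !mul0mx !addr0 !add0r.
    rewrite mulmx1 -scalar_mxM (_ : c * c = 1)%R ?scalar_mx_block//.
    by rewrite /c; case: ifP => _; ring.
  - exists (`|b1|)%R => //; rewrite -[b]vsubmxK b0 mul_block_col !mulmx0 !mul0mx !addr0.
    apply/matrixP => i j; rewrite (ord1 j) [RHS]mxE [X in (_ * X)%R]mxE andbT.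
    have [k' ->|k' ->] := split_ordP i.
      rewrite (ord1 k') col_mxEu mxE big_ord1 !mxE eqxx mulr1n /=.
      rewrite (_ : lshift k 0 = ord0)%R ?eqxx ?mulr1; last exact: val_inj.
      have -> : b ord0 0%R = b1 by congr (b _ _); exact: val_inj.
      rewrite /c; have [b1s|b1s] := boolP (0 <= b1)%R; first by rewrite mul1r ger0_norm.
      by rewrite mulN1r ltr0_norm// ltNge.
    by rewrite col_mxEd mxE /= mulr0.
elim: n a => [|n IH] a; first by apply: flip; apply/matrixP => -[].
have [W [iW oW [r' r'0 Wr]]] := IH (dsubmx a).
pose B : 'M[R]_(1 + (1 + n)) := block_mx 1%:M 0 0 W.
have iB : gauss_invariant B by apply: gauss_invariant_block => //; left.
have oB : (B^T *m B = 1%:M)%R.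
  rewrite tr_block_mx !trmx0 trmx1 mulmx_block !mulmx0 !mul0mx !addr0 !add0r mulmx1 oW.
  by rewrite -scalar_mx_block.
have comp (O2 : 'M[R]_(1 + (1 + n))) : gauss_invariant O2 -> (O2^T *m O2 = 1%:M)%R ->
    (exists2 rho : R, (0 <= rho)%R & (O2 *m (B *m a) = rho *: delta_mx ord0 ord0)%R) ->
    exists O : 'M[R]_(1 + (1 + n)),
  [/\ gauss_invariant O, (O^T *m O = 1%:M)%R &
      exists2 rho : R, (0 <= rho)%R & (O *m a = rho *: delta_mx ord0 ord0)%R].
  move=> i2 o2 [rho rho0 e2]; exists (O2 *m B); split.
  - exact: gauss_invariantM.
  - by rewrite trmx_mul -mulmxA (mulmxA O2^T) o2 mul1mx.
  - by exists rho; rewrite // -mulmxA.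
have Ba : (B *m a = col_mx (usubmx a) (r' *: delta_mx ord0 ord0))%R.
  by rewrite -[a in LHS]vsubmxK mul_block_col !mul0mx mul1mx addr0 add0r Wr.
have [r'E|r'N] := eqVneq r' 0%R.
  have [|O2 [i2 o2 e2]] := flip _ (B *m a); last exact: comp i2 o2 e2.
  by rewrite Ba col_mxKd r'E scale0r.
(* The rotation is chosen to take the pair [(a0, r')] to [(rho, 0)]. *)
pose a0 : R := a ord0 ord0; pose rho := Num.sqrt (a0 ^+ 2 + r' ^+ 2)%R.
have rho2 : (rho ^+ 2 = a0 ^+ 2 + r' ^+ 2)%R by rewrite sqr_sqrtr// addr_ge0 ?sqr_ge0.
have rho0 : (0 < rho)%R by rewrite sqrtr_gt0 ltr_wpDl ?sqr_ge0// exprn_even_gt0.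
have rhoN : rho != 0%R by rewrite gt_eqF.
pose c := (a0 / rho)%R; pose s := (r' / rho)%R.
have cs1 : (c ^+ 2 + s ^+ 2 = 1)%R.
  by rewrite /c /s !expr_div_n -mulrDl -rho2 divff// sqrf_eq0.
have s0 : s != 0%R by rewrite mulf_neq0// invr_neq0.
apply: (comp (rot_mx n c s)).
- exact: gauss_invariant_rot.
- rewrite /rot_mx tr_block_mx tr_row_mx tr_col_mx tr_block_mx !trmx0 !tr_scalar_mx.
  rewrite mulmx_block mul_row_col mul_mx_row mul_col_mx !mulmx0 mul_row_block.
  rewrite mul_col_row mulmx_block !mulmx0 !mul0mx !addr0 !mulmx1 ?add0r.
  rewrite add_block_mx !addr0 ?add0r add_row_mx -!scalar_mxM ?addr0.
  rewrite mul_block_col ?mulmx0 ?mul0mx ?addr0 ?add0r -?scalar_mxM.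
  rewrite add_col_mx ?addr0 -!raddfD /=.
  rewrite (_ : c * c + - s * - s = 1)%R; last by rewrite -cs1; ring.
  rewrite (_ : s * s + c * c = 1)%R; last by rewrite -cs1; ring.
  rewrite (_ : c * s + - s * c = 0)%R; last by ring.
  rewrite (_ : s * c + c * - s = 0)%R; last by ring.
  rewrite !raddf0 col_mx0 row_mx0 -scalar_mx_block.
  by rewrite -scalar_mx_block.
- exists rho; first exact: ltW.
  rewrite Ba /rot_mx.
  rewrite (_ : (r' *: delta_mx ord0 ord0 : 'cV_(1 + n))%R = col_mx r'%:M 0); last first.
    apply/matrixP => i j; rewrite (ord1 j) !mxE andbT; case: split_ordP => k ->.
      by rewrite (ord1 k) mxE eqxx (_ : lshift n 0 = ord0)%R ?mulr1 ?eqxx//; exact: val_inj.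
    by rewrite mxE /= mulr0.
  rewrite mul_block_col mul_row_col mul_col_mx mul_block_col.
  rewrite !mulmx0 !mul0mx !addr0 ?add0r add_col_mx ?addr0.
  have -> : usubmx a = a0%:M.
    apply/matrixP => i j; rewrite !mxE !ord1 eqxx mulr1n.
    by congr (a _ _); exact: val_inj.
  rewrite -!scalar_mxM -!raddfD /=.
  rewrite (_ : c * a0 + s * r' = rho)%R; last first.
    by rewrite /c /s mulrAC [(r' / rho * r')%R]mulrAC -mulrDl -!expr2 -rho2 expr2 mulfK.
  rewrite (_ : - s * a0 + c * r' = 0)%R; last by rewrite /c /s; ring.
  rewrite raddf0 col_mx0; apply/matrixP => i j; rewrite (ord1 j) [RHS]mxE [X in (_ * X)%R]mxE andbT.
  have [k ->|k ->] := split_ordP i.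
    by rewrite (ord1 k) col_mxEu mxE eqxx (_ : lshift _ 0 = ord0)%R ?mulr1 ?eqxx//; exact: val_inj.
  by rewrite col_mxEd mxE /= mulr0.
Qed.

(** Induction on the number of columns. Rotating the first column onto the first axis leaves, by
    orthonormality, a block matrix made of 1 and a smaller matrix with orthonormal columns; the
    first coordinate then splits off by Tonelli. *)
Theorem gauss_orthonormal n k (A : 'M[R]_(n, k)) : (A^T *m A = 1%:M)%R ->
  forall F : 'rV[R]_k -> \bar R, measurable_fun setT F -> (forall v, 0 <= F v) ->
  \int[gauss n]_v F (v *m A)%R = \int[gauss k]_v F v.
Proof.
elim: k n A => [|k IH] n A oA F mF F0.
  transitivity (\int[gauss n]_v F 0%R).
    by apply: eq_integral => v _; rewrite (thinmx0 (v *m A)).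
  transitivity (\int[gauss 0]_v F 0%R); last by apply: eq_integral => v _; rewrite (thinmx0 v).
  rewrite !integral_cst//; congr (_ * _).
  by transitivity (1 : \bar R); [exact: probability_setT|exact/esym/probability_setT].
case: n => [|n] in A oA *.
  have /matrixP/(_ ord0 ord0) := oA; rewrite mxE big_ord0 mxE eqxx => /eqP.
  by rewrite eq_sym oner_eq0.
pose A1 : 'M[R]_(1 + n, 1 + k) := A.
have [U [iO oO [rho rho0 Oa]]] := gauss_rotate_col (lsubmx A1).
have oOA : ((U *m A1)^T *m (U *m A1) = 1%:M)%R.
  by rewrite trmx_mul -mulmxA (mulmxA U^T) oO mul1mx.
have [C CE] : exists C, (U *m rsubmx A1)%R = C by exists (U *m rsubmx A1)%R.
have OAE : (U *m A1 = row_mx (rho *: delta_mx ord0 ord0) C)%R.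
  by rewrite -[A1 in LHS]hsubmxK mul_mx_row Oa CE.
move: oOA; rewrite OAE tr_row_mx mul_col_row scalar_mx_block.
case/eq_block_mx => e11 e12 _ e22.
(* Unit length leaves 1 or -1, and the sign choice in [gauss_rotate_col] excludes the latter. *)
have rho1 : rho = 1%R.
  have /matrixP/(_ ord0 ord0) := e11.
  rewrite mxE (bigD1 ord0)//= big1 => [|l lN]; last first.
    by rewrite !mxE (negbTE lN) !mulr0.
  rewrite !mxE !eqxx mulr1 addr0 mulr1n -expr2 => /eqP.
  by rewrite sqrf_eq1 => /orP[/eqP//|/eqP rN]; move: rho0; rewrite rN oppr_ge0 ler10.
(* Orthogonality to the first column, which is now the first axis, kills the top row of the other
   columns. *)
have C0 : usubmx C = 0%R.
  apply/matrixP => i j; have /matrixP/(_ i j) := e12.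
  rewrite rho1 scale1r trmx_delta mxE (bigD1 ord0)//= big1 => [|l lN]; last first.
    by rewrite mxE (negbTE lN) andbF mul0r.
  rewrite !mxE !(ord1 i) !eqxx mul1r addr0 => <-.
  by congr (C _ _); exact: val_inj.
have oC : ((dsubmx C)^T *m dsubmx C = 1%:M)%R.
  by rewrite -e22 -[in RHS](vsubmxK C) tr_col_mx mul_row_col C0 mulmx0 add0r.
have OAE' : (U *m A1 = block_mx 1%:M 0 0 (dsubmx C))%R.
  rewrite OAE -[C in LHS]vsubmxK C0 rho1 scale1r.
  rewrite block_mxEh; congr row_mx.
  apply/matrixP => i j; rewrite (ord1 j) mxE andbT; have [l ->|l ->] := split_ordP i.
    by rewrite (ord1 l) col_mxEu mxE (_ : lshift _ 0 = ord0)%R ?eqxx//; exact: val_inj.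
  by rewrite col_mxEd mxE.
have mFA : measurable_fun setT (fun v : 'rV_n.+1 => F (v *m A)%R).
  exact: (measurableT_comp mF (@measurable_mulmxr _ _ _ _)).
rewrite -(iO (fun v => F (v *m A)%R))//.
transitivity (\int[gauss n.+1]_v F (v *m (block_mx 1%:M 0 0 (dsubmx C) : 'M[R]_(1 + n, 1 + k)))%R).
  by apply: eq_integral => v _; rewrite -mulmxA; congr (F (_ *m _)); exact: OAE'.
rewrite !ge0_integral_gaussS//; last first.
  exact: (measurableT_comp mF (@measurable_mulmxr _ _ _ _)).
apply: eq_integral => x _.
rewrite -(IH _ _ oC (fun v => F (rV_cons (x, v))))//; last exact: measurable_rV_consr.
by apply: eq_integral => v _; rewrite rV_cons_block mulr1.
Qed.

End gauss3.

(** Every open set is the countable union of the boxes with rational corners that it contains. *)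
Lemma open_measurable_mx (R : realType) a b (G : set 'M[R]_(a, b)) : open G -> measurable G.
Proof.
move=> oG.
pose box (q : 'M[rat]_(a, b) * 'M[rat]_(a, b)) : set 'M[R]_(a, b) :=
  mx_box (fun i j => `]ratr (q.1 i j), ratr (q.2 i j)[%classic).
rewrite (_ : G = \bigcup_q (if `[< box q `<=` G >] then box q else set0)).
  apply: countable_bigcupT_measurable; first exact: countableP.
  by move=> q; case: ifP => // _; apply: measurable_box => i j; exact: measurable_itv.
apply/seteqP; split => [M GM|M [q _]]; last by case: ifPn => // /asboolP; exact.
have /nbhs_ballP[e /= e0 Me] : nbhs M G by exact: open_nbhs_nbhs.
have /choice[l lP] : forall p : 'I_a * 'I_b, exists q : rat,
    ratr q \in `](M p.1 p.2 - e), (M p.1 p.2)[.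
  by move=> p; apply: rat_in_itvoo; rewrite ltrBlDr ltrDl.
have /choice[u uP] : forall p : 'I_a * 'I_b, exists q : rat,
    ratr q \in `](M p.1 p.2), (M p.1 p.2 + e)[.
  by move=> p; apply: rat_in_itvoo; rewrite ltrDl.
exists (\matrix_(i, j) l (i, j), \matrix_(i, j) u (i, j)) => //.
rewrite ifT.
  move=> i j /=; rewrite !mxE in_itv /=.
  have := lP (i, j); have := uP (i, j); rewrite !in_itv /= => /andP[-> _] /andP[_ ->].
  by [].
apply/asboolP => N NB; apply: Me; split => // i j; have := NB i j.
have := lP (i, j); have := uP (i, j); rewrite /= !mxE !in_itv /= => /andP[_ u1] /andP[l1 _] /andP[l2 u2].
by rewrite /ball /= ltr_distlC; apply/andP; split; lra.
Qed.

(** * Standardization of independent normals, Gaussian projections and null hyperplanes *)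

Section gauss_law.
Context {R : realType}.
Local Open Scope ereal_scope.
Local Notation mu := (@lebesgue_measure R).

Lemma lebesgue_affine (f : measurableTypeR R -> \bar R) (m s : R) : (0 < s)%R ->
  measurable_fun setT f -> (forall x, 0 <= f x) ->
  \int[mu]_x f ((x - m) / s)%R = s%:E * \int[mu]_x f x.
Proof.
move=> s0 mf f0; pose phi (x : R) := ((x - m) / s)%R.
have mphi : measurable_fun (T:=measurableTypeR R) (U:=measurableTypeR R) setT phi.
  by apply: measurable_funM => //; exact: measurable_funB.
have s0' : (0 <= s^-1)%R by rewrite invr_ge0 ltW.
pose k := NngNum s0'.
transitivity (\int[pushforward mu (phi : _ -> measurableTypeR R)]_x f x).
  by rewrite (ge0_integral_pushforward mphi).
suff -> : \int[mu]_x f x = \int[mscale k (pushforward mu (phi : _ -> measurableTypeR R))]_x f x.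
  rewrite ge0_integral_mscale// muleA -EFinM /= divff ?gt_eqF// mul1e//.
move=> m0; apply: eq_measure_integral => //= A mA _.
apply: lebesgue_measure_unique => //= _ [[a b]] _ <-.
rewrite /mscale /= /pushforward (_ : _ @^-1` _ = `](s * a + m)%R, (s * b + m)%R]%classic).
  rewrite /= !lebesgue_measure_itv/= !lte_fin ltrD2r ltr_pM2l//.
  case: ifP => // _; rewrite ?mule0// -!EFinB -EFinM; congr EFin.
  by field; rewrite gt_eqF.
apply/seteqP; split=> x /=; rewrite !in_itv/= /phi.
  by rewrite ltr_pdivlMr// ler_pdivrMr// ltrBrDr lerBlDr ![(_ * s)%R]mulrC.
by rewrite ltr_pdivlMr// ler_pdivrMr// ltrBrDr lerBlDr ![(_ * s)%R]mulrC.
Qed.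

Lemma normal_pdf_affine (m s x : R) : (0 < s)%R ->
  (normal_pdf m s x = s^-1 * normal_pdf 0 1 ((x - m) / s))%R.
Proof.
move=> s0; have sN : s != 0%R by rewrite gt_eqF.
rewrite normal_pdf01 /normal_pdf (negbTE sN) mulrA; congr (_ * expR _)%R.
  rewrite /normal_peak -invfM; congr (_^-1)%R.
  rewrite expr1n mul1r -mulrnAr sqrtrM ?sqr_ge0// sqrtr_sqr gtr0_norm//.
by rewrite expr_div_n -mulr_natr; field.
Qed.

Lemma normal_prob_affine (m s : R) (A : set R) : (0 < s)%R -> measurable A ->
  normal_prob m s ((fun x => (x - m) / s)%R @^-1` A) = normal_prob 0 1 A.
Proof.
move=> s0 mA; rewrite /normal_prob integral_mkcond [RHS]integral_mkcond.
pose f := patch (cst 0) A (fun x : R => (normal_pdf 0 1 x)%:E).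
have f0 x : 0 <= f x by rewrite /f patchE; case: ifP => // _; rewrite lee_fin normal_pdf_ge0.
have mf : measurable_fun (T := measurableTypeR R) setT f.
  apply/(measurable_restrictT _ _).1 => //; apply: measurable_funTS.
  by apply/measurable_EFinP; exact: measurable_normal_pdf.
transitivity (\int[mu]_x ((s^-1)%:E * f ((x - m) / s)%R)).
  apply: eq_integral => x _; rewrite /f !patchE.
  rewrite (_ : (x \in (fun x => (x - m) / s)%R @^-1` A) = ((x - m) / s \in A)%R); last first.
    by apply/idP/idP; rewrite !inE.
  by case: ifP => _; rewrite ?mule0// normal_pdf_affine// EFinM.
rewrite ge0_integralZl//; last 2 first.
- apply: (measurableT_comp mf); apply: measurable_funM => //; exact: measurable_funB.
- by rewrite lee_fin invr_ge0 ltW.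
by rewrite (lebesgue_affine m s0 mf f0) muleA -EFinM mulVf ?gt_eqF// mul1e.
Qed.

Section joint.
Context d (T : measurableType d) (P : probability T R) (I : finType).
Variables (X : I -> {RV P >-> R}) (m v : I -> R).
Hypothesis v0 : forall i, (0 < v i)%R.
Hypothesis Xlaw : forall i, has_normal_law (X i) (m i) (v i).
Hypothesis Xind : mutually_independent X.

Definition standardized (w : T) : 'rV[R]_#|I| :=
  \row_k ((X (enum_val k) w - m (enum_val k)) / Num.sqrt (v (enum_val k)))%R.

Lemma measurable_standardized : measurable_fun setT standardized.
Proof.
apply: measurable_mxP => i k.
rewrite (_ : (fun _ => _) = (fun w => (X (enum_val k) w - m (enum_val k)) / Num.sqrt (v (enum_val k)))%R).
  by apply: measurable_funM => //; exact: measurable_funB.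
by apply/funext => w; rewrite mxE.
Qed.

HB.instance Definition _ := isMeasurableFun.Build _ _ _ _ standardized measurable_standardized.

(** On a box, independence turns the probability into a product of one-dimensional normal
    probabilities, and boxes determine the law. *)
Lemma standardized_law (A : set 'rV[R]_#|I|) : measurable A ->
  P (standardized @^-1` A) = gauss #|I| A.
Proof.
move=> mA; rewrite -[LHS]/(distribution P standardized A).
apply: mx_probability_unique => // {mA}A mA.
rewrite gauss_box// -[LHS]/(P (standardized @^-1` mx_box A)).
pose phi i (x : R) := ((x - m i) / Num.sqrt (v i))%R.
have mphi i B : measurable B -> measurable (phi i @^-1` B).
  move=> mB; rewrite -[X in measurable X]setTI.
  have : measurable_fun [set: R] (phi i) by apply: measurable_funM => //; exact: measurable_funB.
  exact.
have := Xind [set: I]%SET (fun i => mphi i _ (mA ord0 (enum_rank i))).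
rewrite (_ : [set w | _] = standardized @^-1` (mx_box A)) => [->|]; last first.
  apply/seteqP; split=> [w h i k|w h i _] /=.
    by rewrite (ord1 i) mxE; have := h (enum_val k) (finset.in_setT _); rewrite /= enum_valK.
  by have := h ord0 (enum_rank i); rewrite mxE enum_rankK.
rewrite (reindex _ (onW_bij _ (enum_val_bij I))) /=.
apply: eq_big => [k|k _]; first by rewrite finset.in_setT.
rewrite enum_valK -(normal_prob_affine (m (enum_val k)) (s := Num.sqrt (v (enum_val k)))) ?sqrtr_gt0//.
by rewrite -[LHS]/(distribution P (X (enum_val k)) _) Xlaw//; exact: mphi.
Qed.

(** Used twice: for the normalized levels and cell means of the sample, and for the normal vector
    [z] of the conclusion. *)
Lemma standardized_combination k (M : 'M[R]_(#|I|, k)) : (M^T *m M = 1%:M)%R ->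
  forall F : 'rV[R]_k -> \bar R, measurable_fun setT F -> (forall u, 0 <= F u) ->
  \int[P]_w F (standardized w *m M)%R = \int[gauss k]_u F u.
Proof.
move=> oM F mF F0; rewrite -(gauss_orthonormal oM mF F0).
have mG : measurable_fun setT (fun u => F (u *m M)%R).
  exact: (measurableT_comp mF (@measurable_mulmxr _ _ _ _ M)).
rewrite -[LHS](ge0_integral_distribution (P := P) standardized mG)//.
by apply: eq_measure_integral => A mA _; exact: standardized_law.
Qed.

End joint.

Lemma measurable_row_mx m n :
  measurable_fun setT (fun p : 'rV[R]_m * 'rV[R]_n => row_mx p.1 p.2).
Proof.
apply: measurable_mxP => i j; have [k ->|k ->] := split_ordP j.
  rewrite (_ : (fun _ => _) = (fun p : 'rV[R]_m * 'rV[R]_n => p.1 i k)).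
    exact: (measurableT_comp (measurable_coord _ _)).
  by apply/funext => p; rewrite row_mxEl.
rewrite (_ : (fun _ => _) = (fun p : 'rV[R]_m * 'rV[R]_n => p.2 i k)).
  exact: (measurableT_comp (measurable_coord _ _)).
by apply/funext => p; rewrite row_mxEr.
Qed.

Definition rV_pair m n (p : 'rV[R]_m * 'rV[R]_n) : 'rV[R]_(m + n) := row_mx p.1 p.2.

HB.instance Definition _ m n := isMeasurableFun.Build _ _ _ _ (@rV_pair m n) (@measurable_row_mx m n).

(** This lets the levels be held fixed while the noise is integrated. *)
Lemma gauss_split m n (F : 'rV[R]_(m + n) -> \bar R) :
  measurable_fun setT F -> (forall v, 0 <= F v) ->
  \int[gauss (m + n)]_w F w = \int[gauss m]_u \int[gauss n]_v F (row_mx u v).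
Proof.
move=> mF F0.
have mFp : measurable_fun setT (fun p : 'rV[R]_m * 'rV[R]_n => F (rV_pair p)).
  exact: (measurableT_comp mF (@measurable_row_mx m n)).
rewrite -(fubini_tonelli1 (m1 := gauss m) (m2 := gauss n) (fun p => F (rV_pair p)))//.
rewrite -[RHS](ge0_integral_distribution (P := gauss m \x gauss n) (@rV_pair m n) mF)//.
apply: eq_measure_integral => A mA _; apply: mx_probability_unique => // {mA}A mA.
rewrite gauss_box// /distribution /= /pushforward.
rewrite (_ : _ @^-1` _ = mx_box (fun i j => A i (lshift n j)) `*` mx_box (fun i j => A i (rshift m j))).
  rewrite product_measure1E; [|by apply: measurable_box => *; exact: mA..].
  by rewrite big_split_ord /=; congr (_ * _); apply/esym/gauss_box => *; exact: mA.
apply/seteqP; split => [[u v] /= h|[u v] [/= hu hv] i j].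
  split=> i j; first by have := h i (lshift n j); rewrite /rV_pair row_mxEl.
  by have := h i (rshift m j); rewrite /rV_pair row_mxEr.
by have [k ->|k ->] := split_ordP j; rewrite /rV_pair ?row_mxEl ?row_mxEr.
Qed.

Lemma trmx_mul_eq0 n (x : 'cV[R]_n) : ((x^T *m x) ord0 ord0 = 0 -> x = 0)%R.
Proof.
rewrite mxE => h; apply/matrixP => i j; rewrite (ord1 j) [RHS]mxE.
have := h; under eq_bigr do rewrite mxE -expr2.
move/eqP; rewrite psumr_eq0 => [/allP/(_ i)|k _]; last exact: sqr_ge0.
by rewrite mem_index_enum sqrf_eq0 => /(_ isT)/eqP.
Qed.

Lemma inj_unitmx n (A : 'M[R]_n) : (forall x : 'cV[R]_n, A *m x = 0 -> x = 0)%R ->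
  A \in unitmx.
Proof.
move=> inj; rewrite -unitmx_tr -row_free_unit; apply: inj_row_free => v vA.
by apply: trmx_inj; rewrite trmx0; apply: inj; apply: trmx_inj; rewrite trmx_mul trmxK vA trmx0.
Qed.

Lemma gram_unitmx n r (B : 'M[R]_(n, r)) : (forall x : 'cV[R]_r, B *m x = 0 -> x = 0)%R ->
  (B^T *m B)%R \in unitmx.
Proof.
move=> inj; apply: inj_unitmx => x h; apply: inj; apply: trmx_mul_eq0.
by rewrite trmx_mul -mulmxA (mulmxA B^T) h mulmx0 mxE.
Qed.

(** A QR factorization in which [T] need only be invertible. The first column is normalized, its
    direction is removed from the other columns, and the induction applies to these. *)
Lemma gram_schmidt n r (B : 'M[R]_(n, r)) :
  (forall x : 'cV[R]_r, B *m x = 0 -> x = 0)%R ->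
  exists A T, [/\ (A^T *m A = 1%:M)%R, T \in unitmx & (B = A *m T)%R].
Proof.
elim: r B => [|r IH] B inj.
  by exists 0%R, 1%:M; split; [apply/matrixP => -[]|exact: unitmx1|apply/matrixP => i []].
move: B inj; rewrite -[r.+1]/(1 + r)%N => B inj.
pose b := lsubmx B; pose D := rsubmx B.
have BE : B = row_mx b D by rewrite hsubmxK.
pose nb := Num.sqrt ((b^T *m b) ord0 ord0)%R.
have bb0 : (0 <= (b^T *m b) ord0 ord0)%R.
  by rewrite mxE sumr_ge0// => i _; rewrite mxE -expr2 sqr_ge0.
have nbE : (b^T *m b = (nb ^+ 2)%:M)%R.
  by rewrite [LHS]mx11_scalar sqr_sqrtr.
have nb0 : nb != 0%R.
  apply/eqP => nb0; have b0 : b = 0%R by apply: trmx_mul_eq0; rewrite nbE nb0 expr0n mxE mul0rn.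
  have := inj (col_mx 1%:M 0); rewrite BE mul_row_col b0 mul0mx mulmx0 add0r => /(_ erefl).
  move/matrixP/(_ (lshift r ord0) ord0); rewrite col_mxEu !mxE eqxx => /eqP.
  by rewrite oner_eq0.
have [a aE] : exists a, a = (b *m (nb^-1)%:M)%R by eexists.
have aa : (a^T *m a = 1%:M)%R.
  rewrite aE trmx_mul tr_scalar_mx mulmxA -(mulmxA _ b^T) nbE -!scalar_mxM; congr (_%:M).
  by field.
have ab : (a *m nb%:M = b)%R by rewrite aE -mulmxA -scalar_mxM mulVf// mulmx1.
pose D' := (D - a *m (a^T *m D))%R.
have aD' : (a^T *m D' = 0)%R by rewrite mulmxBr (mulmxA a^T a) aa mul1mx subrr.
(* A kernel vector of [D'] lifts to one of [B]: the head coordinate is chosen to account for the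
   component along [a] that was removed. *)
have [x D'x|A' [T' [oA' uT' D'E]]] := IH D'.
  suff /(congr1 dsubmx) : (col_mx (- ((nb^-1)%:M *m (a^T *m D *m x))) x = 0)%R.
    by rewrite col_mxKd linear0.
  apply: inj.
  rewrite BE mul_row_col mulmxN mulmxA -aE addrC -D'x /D' mulmxBl.
  by rewrite !mulmxA.
have aA' : (a^T *m A' = 0)%R by rewrite -[A'](mulmxK uT') -D'E mulmxA aD' mul0mx.
exists (row_mx a A'), (block_mx nb%:M (a^T *m D) 0 T')%R.
have BAT : (B = row_mx a A' *m block_mx nb%:M (a^T *m D) 0 T')%R.
  by rewrite mul_row_block mulmx0 addr0 ab -D'E addrC subrK.
split => //.
- rewrite tr_row_mx mul_col_row aa oA' aA'.
  rewrite (_ : (A'^T *m a) = 0)%R ?scalar_mx_block//.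
  by apply: trmx_inj; rewrite trmx_mul trmxK aA' trmx0.
- by apply: inj_unitmx => x Tx; apply: inj; rewrite BAT -mulmxA Tx mulmx0.
Qed.

(** With [B = A *m U] and orthonormal columns in [A], the quadratic form is the squared length of
    [g *m A], which is a standard Gaussian vector of dimension [r]. *)
Lemma gauss_projection n r (B : 'M[R]_(n, r)) :
  (forall x : 'cV[R]_r, B *m x = 0 -> x = 0)%R ->
  forall F : R -> \bar R, measurable_fun [set: R] F -> (forall x, 0 <= F x) ->
  \int[gauss n]_g F ((g *m B *m invmx (B^T *m B) *m B^T *m g^T) ord0 ord0)%R =
  \int[gauss r]_v F (\sum_(l < r) v ord0 l ^+ 2)%R.
Proof.
move=> inj F mF F0; have [A [U [oA uU BE]]] := gram_schmidt inj.
pose G (v : 'rV[R]_r) := F (\sum_(l < r) v ord0 l ^+ 2)%R.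
have mG : measurable_fun setT G.
  apply: (measurableT_comp mF); apply: measurable_sum => l.
  by apply: measurable_funX; exact: measurable_coord.
apply: etrans (gauss_orthonormal oA mG _); last by move=> v; exact: F0.
apply: eq_integral => g _; rewrite /G; congr F.
rewrite (_ : (B^T *m B = U^T *m U)%R); last first.
  by rewrite BE trmx_mul -mulmxA (mulmxA A^T) oA mul1mx.
have UW : (U *m invmx (U^T *m U) *m U^T = 1%:M)%R.
  by apply: mulmx1C; rewrite mulmxA mulmxV// unitmx_mul unitmx_tr uU.
rewrite BE trmx_mul !mulmxA -(mulmxA (g *m A)) -(mulmxA (g *m A)) UW mulmx1 -mulmxA -trmx_mul.
by rewrite mxE; apply: eq_bigr => l _; rewrite [X in (_ * X)%R]mxE expr2.
Qed.

Lemma gauss_orthonormal_prob n k (A : 'M[R]_(n, k)) : (A^T *m A = 1%:M)%R ->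
  forall S, measurable S -> gauss n ((fun v => v *m A)%R @^-1` S) = gauss k S.
Proof.
move=> oA S mS.
have mF : measurable_fun setT (fun v : 'rV[R]_k => (\1_S v)%:E : \bar R).
  by apply/measurable_EFinP; exact: measurable_indic.
have F0 v : 0 <= (\1_S v)%:E :> \bar R by rewrite lee_fin.
have mE : measurable ((fun v : 'rV[R]_n => v *m A)%R @^-1` S).
  rewrite -[X in measurable X]setTI; exact: (@measurable_mulmxr _ _ _ _ A measurableT S mS).
have ie (Q : probability 'rV[R]_k R) : \int[Q]_v (\1_S v)%:E = Q S.
  by rewrite integral_indic ?setIT.
have ie' (Q : probability 'rV[R]_n R) :
    \int[Q]_v (\1_((fun v : 'rV[R]_n => v *m A)%R @^-1` S) v)%:E =
    Q ((fun v => v *m A)%R @^-1` S).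
  by rewrite integral_indic ?setIT.
by rewrite -ie -ie' -(gauss_orthonormal oA mF F0).
Qed.

(** Along the unit vector in the direction of [c] the law is one-dimensional normal, which has no
    atoms. *)
Lemma gauss_hyperplane n (c : 'cV[R]_n) (t : R) : c != 0%R ->
  gauss n [set v | (v *m c)%R ord0 ord0 = t] = 0.
Proof.
move=> c0; pose nc := Num.sqrt ((c^T *m c) ord0 ord0)%R.
have cc0 : (0 <= (c^T *m c) ord0 ord0)%R.
  by rewrite mxE sumr_ge0// => i _; rewrite mxE -expr2 sqr_ge0.
have ncE : (c^T *m c = (nc ^+ 2)%:M)%R by rewrite [LHS]mx11_scalar sqr_sqrtr.
have nc0 : nc != 0%R.
  apply/eqP => nc0; move/eqP: c0; apply.
  by apply: trmx_mul_eq0; rewrite ncE nc0 expr0n mxE mul0rn.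
pose a := (c *m (nc^-1)%:M)%R.
have aa : (a^T *m a = 1%:M)%R.
  rewrite /a trmx_mul tr_scalar_mx mulmxA -(mulmxA _ c^T) ncE -!scalar_mxM; congr (_%:M).
  by field.
pose S : set 'rV[R]_1 := [set v | v ord0 ord0 = t / nc]%R.
have mS : measurable S.
  rewrite -[X in measurable X]setTI.
  exact: (@measurable_coord R 1 1 ord0 ord0 measurableT [set (t / nc)%R] (measurable_set1 _)).
have ga v : ((v *m a) ord0 ord0 = (v *m c) ord0 ord0 / nc)%R.
  by rewrite /a mulmxA mul_mx_scalar mxE mulrC.
have E : [set v | (v *m c)%R ord0 ord0 = t] = (fun v : 'rV[R]_n => v *m a)%R @^-1` S.
  apply/seteqP; split=> v /=; rewrite /S /= ga; first by move=> ->.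
  by move/(mulIf (invr_neq0 nc0)).
rewrite E (gauss_orthonormal_prob aa mS).
rewrite (_ : S = mx_box (fun _ _ => [set (t / nc)%R])); last first.
  by apply/seteqP; split=> [v Sv i j|v] /=; [rewrite !ord1|exact].
rewrite gauss_box ?big_ord1; last by move=> _ _; exact: measurable_set1.
apply: null_set_integral => //; last exact: lebesgue_measure_set1.
by apply/measurable_EFinP; apply: measurable_funTS; exact: measurable_normal_pdf.
Qed.

End gauss_law.

(** * The likelihood and its derivatives *)

Section likelihood_formula.
Context {R : realType} {m q : nat}.
Variables (sx2 : 'I_m -> R) (s2 : 'I_q.+1 -> 'I_m -> R) (N : 'I_q.+1 -> nat).
Hypotheses (hsx2 : forall j, 0 < sx2 j) (hs2 : forall i j, 0 < s2 i j).
Implicit Types (t u w : 'rV[R]_(m + (q + q))) (y : data R m N).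

(** For an empty cell this is 0, by the convention on division, and [obs_prec] gives it weight 0;
    the likelihood formulas below then hold for all sample sizes. *)
Definition obs_mean y i j : R := (\sum_(k < N i) y i j k) / (N i)%:R.

Definition obs_prec i j : R := (N i)%:R / s2 i j.

(** The conditional law of the level given the data is normal with precision [post_prec] and mean
    [post_mean]. *)
Definition post_prec t j : R := (sx2 j)^-1 + \sum_i obs_prec i j * beta t i ^+ 2.

Definition post_lin y t j : R :=
  level_mean t j / sx2 j + \sum_i obs_prec i j * beta t i * (obs_mean y i j - alpha t i).

Definition post_mean y t j : R := post_lin y t j / post_prec t j.

(** The minimum of [joint_error] over the level, attained at [post_mean]. *)
Definition fit_error y t j : R :=
  level_mean t j ^+ 2 / sx2 j + \sum_i obs_prec i j * (obs_mean y i j - alpha t i) ^+ 2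
  - post_lin y t j ^+ 2 / post_prec t j.

Definition joint_error y t j (x : R) : R :=
  (x - level_mean t j) ^+ 2 / sx2 j +
  \sum_i obs_prec i j * (obs_mean y i j - alpha t i - beta t i * x) ^+ 2.

Lemma obs_prec_ge0 i j : 0 <= obs_prec i j.
Proof. by rewrite divr_ge0 ?ler0n// ltW. Qed.

Lemma post_prec_gt0 t j : 0 < post_prec t j.
Proof.
rewrite ltr_wpDr ?invr_gt0//; apply: sumr_ge0 => i _.
by rewrite mulr_ge0 ?obs_prec_ge0 ?sqr_ge0.
Qed.

(* Completing the square in the latent variable. *)
Lemma joint_errorE y t j x :
  joint_error y t j x = fit_error y t j + post_prec t j * (x - post_mean y t j) ^+ 2.
Proof.
have A0 : post_prec t j != 0 by rewrite gt_eqF ?post_prec_gt0.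
have E : joint_error y t j x = level_mean t j ^+ 2 / sx2 j +
    \sum_i obs_prec i j * (obs_mean y i j - alpha t i) ^+ 2
    - 2 * x * post_lin y t j + x ^+ 2 * post_prec t j.
  rewrite /joint_error /post_lin /post_prec !mulrDr !mulr_sumr.
  rewrite (eq_bigr (fun i => obs_prec i j * (obs_mean y i j - alpha t i) ^+ 2 -
     2 * x * (obs_prec i j * beta t i * (obs_mean y i j - alpha t i)) +
     x ^+ 2 * (obs_prec i j * beta t i ^+ 2))); last by move=> i _; ring.
  by rewrite !big_split /= sumrN; ring.
rewrite E /fit_error /post_mean; field; by rewrite A0 gt_eqF.
Qed.

Lemma fit_error_le y t j x : fit_error y t j <= joint_error y t j x.
Proof. by rewrite joint_errorE lerDl mulr_ge0 ?sqr_ge0 ?ltW ?post_prec_gt0. Qed.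

Lemma fit_errorE y t j : fit_error y t j = joint_error y t j (post_mean y t j).
Proof. by rewrite joint_errorE subrr expr0n mulr0 addr0. Qed.

Definition within_error y i j : R := \sum_(k < N i) (y i j k - obs_mean y i j) ^+ 2 / s2 i j.

Lemma sum_sq_split y i j (c : R) :
  \sum_(k < N i) (y i j k - c) ^+ 2 / s2 i j =
  within_error y i j + obs_prec i j * (obs_mean y i j - c) ^+ 2.
Proof.
have s0 : s2 i j != 0 by rewrite gt_eqF.
rewrite /within_error -!mulr_suml /obs_prec mulrAC -mulrDl; congr (_ / _).
have [N0|N0] := eqVneq (N i) 0%N.
  rewrite !big1 ?N0 ?mul0r ?addr0// => k _; by have := ltn_ord k; rewrite {2}N0.
have n0 : (N i)%:R != 0 :> R by rewrite pnatr_eq0.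
have sE : \sum_(k < N i) y i j k = (N i)%:R * obs_mean y i j by rewrite /obs_mean mulrC divfK.
rewrite (eq_bigr (fun k => (y i j k - obs_mean y i j) ^+ 2 +
   (2 * (obs_mean y i j - c) * y i j k +
    (obs_mean y i j - c) * (- obs_mean y i j - c)))); last by move=> k _; ring.
rewrite !big_split /= -mulr_sumr sE sumr_const card_ord -mulr_natl; ring.
Qed.

Definition peaks j : R := normal_peak (Num.sqrt (sx2 j)) *
  \prod_i \prod_(k < N i) normal_peak (Num.sqrt (s2 i j)).

Definition level_density y t j (x : R) : R :=
  normal_pdf (level_mean t j) (Num.sqrt (sx2 j)) x *
  \prod_i \prod_(k < N i) normal_pdf (alpha t i + beta t i * x) (Num.sqrt (s2 i j)) (y i j k).

Lemma normal_pdfE' (mu v x : R) : 0 < v ->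
  normal_pdf mu (Num.sqrt v) x = normal_peak (Num.sqrt v) * expR (- 2^-1 * ((x - mu) ^+ 2 / v)).
Proof.
move=> v0; rewrite /normal_pdf gt_eqF ?sqrtr_gt0// /normal_fun sqr_sqrtr ?(ltW v0)//.
congr (_ * expR _); rewrite -mulr_natr; field; by rewrite gt_eqF.
Qed.

(** The last factor undoes the normalization of the conditional density of the level, so that this
    is the integral of [level_density] in [x]. *)
Definition level_const y t j : R := peaks j *
  expR (- 2^-1 * (fit_error y t j + \sum_i within_error y i j)) /
  normal_peak (Num.sqrt (post_prec t j)^-1).

Lemma level_densityE y t j x : level_density y t j x =
  level_const y t j * normal_pdf (post_mean y t j) (Num.sqrt (post_prec t j)^-1) x.
Proof.
have A0 := post_prec_gt0 t j.
rewrite normal_pdfE' ?invr_gt0// /level_const mulrA divfK; last first.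
  by rewrite gt_eqF// normal_peak_gt0// gt_eqF// sqrtr_gt0 invr_gt0.
rewrite -mulrA -expRD -mulrDr invrK [_ * post_prec _ _]mulrC.
rewrite addrAC -joint_errorE /level_density normal_pdfE'//.
under eq_bigr => i _ do under eq_bigr => k _ do rewrite normal_pdfE'//.
under eq_bigr => i _ do rewrite big_split /=.
rewrite big_split /= mulrACA; congr (_ * _).
under eq_bigr => i _ do rewrite -expR_sum.
rewrite -expR_sum -expRD; congr expR; rewrite /joint_error -addrA mulrDr; congr (_ + _).
rewrite -big_split /= mulr_sumr; apply: eq_bigr => i _; rewrite -mulr_sumr; congr (_ * _).
by rewrite sum_sq_split addrC opprD addrA.
Qed.

Lemma level_const_gt0 y t j : 0 < level_const y t j.
Proof.
have A0 := post_prec_gt0 t j.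
rewrite divr_gt0 ?mulr_gt0 ?expR_gt0 ?normal_peak_gt0 ?gt_eqF ?sqrtr_gt0 ?invr_gt0//.
apply: prodr_gt0 => i _; apply: prodr_gt0 => k _.
by rewrite normal_peak_gt0// gt_eqF// sqrtr_gt0.
Qed.

(** The factor [K] is kept general so that the induction can absorb into it the value of the first
    density once its coordinate is frozen. *)
Lemma integral_rV_prod n (f : 'I_n -> R -> R) (c : 'I_n -> R) (K : R) :
  (forall j, (@lebesgue_measure R).-integrable setT (EFin \o f j)) ->
  (forall j, \int[@lebesgue_measure R]_x f j x = c j) ->
  integral_rV (fun x : 'rV[R]_n => K * \prod_(j < n) f j (x ord0 j)) = K * \prod_(j < n) c j.
Proof.
elim: n f c K => [|n IH] f c K fi fc; first by rewrite /= !big_ord0.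
rewrite /= big_ord_recl mulrCA -fc -RintegralZr//; apply: eq_Rintegral => x _.
rewrite [f ord0 x * _]mulrC mulrAC -(IH (fun j => f (lift ord0 j)) (fun j => c (lift ord0 j)))//.
congr integral_rV; apply/funext => v; rewrite big_ord_recl mulrA.
congr (_ * _ * _).
  by congr (f _ _); exact: (rV_cons0 x v).
by apply: eq_bigr => j _; congr (f _ _); exact: (rV_consS x v).
Qed.

Lemma marginal_densityE y t : marginal_density sx2 s2 y t = \prod_(j < m) level_const y t j.
Proof.
rewrite /marginal_density -[RHS]mul1r.
rewrite -(integral_rV_prod (f := fun j x => level_density y t j x)).
- congr integral_rV; apply/funext => x; rewrite mul1r /complete_density /level_density.
  rewrite big_split /=; congr (_ * _); rewrite exchange_big /=.
  by [].
- move=> j; rewrite (_ : _ \o _ = fun x => ((level_const y t j)%:E * (normal_pdf (post_mean y t j) (Num.sqrt (post_prec t j)^-1) x)%:E)%E).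
    by apply: integrableZl => //; exact: integrable_normal_pdf.
  by apply/funext => x /=; rewrite level_densityE EFinM.
- move=> j; under eq_Rintegral do rewrite level_densityE.
  rewrite RintegralZl//; last exact: integrable_normal_pdf.
  by rewrite /Rintegral integral_normal_pdf mulr1.
Qed.

Definition loglik_const y : R := \sum_(j < m)
  (ln (peaks j) - 2^-1 * (\sum_i within_error y i j) + 2^-1 * ln (pi *+ 2)).

Lemma loglikE y t : loglik sx2 s2 y t =
  loglik_const y - 2^-1 * \sum_(j < m) (ln (post_prec t j) + fit_error y t j).
Proof.
rewrite /loglik marginal_densityE.
have ln_prod n (f : 'I_n -> R) : (forall i, 0 < f i) ->
    ln (\prod_(i < n) f i) = \sum_(i < n) ln (f i).
  elim: n f => [|n IH] f f0; first by rewrite !big_ord0 ln1.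
  by rewrite !big_ord_recl lnM ?posrE ?prodr_gt0// IH.
rewrite ln_prod; last exact: level_const_gt0.
rewrite /loglik_const mulr_sumr -sumrB; apply: eq_bigr => j _.
have A0 := post_prec_gt0 t j.
have p0 : 0 < peaks j.
  rewrite mulr_gt0 ?normal_peak_gt0 ?gt_eqF ?sqrtr_gt0//.
  apply: prodr_gt0 => i _; apply: prodr_gt0 => k _.
  by rewrite normal_peak_gt0// gt_eqF// sqrtr_gt0.
rewrite /level_const /normal_peak invrK sqr_sqrtr ?invr_ge0 ?ltW//.
have z0 : 0 < (post_prec t j)^-1 * pi *+ 2 by rewrite pmulrn_lgt0// mulr_gt0 ?invr_gt0 ?pi_gt0.
have -> : ln (peaks j * expR (- 2^-1 * (fit_error y t j + \sum_i within_error y i j)) *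
    Num.sqrt ((post_prec t j)^-1 * pi *+ 2)) =
  ln (peaks j) + - 2^-1 * (fit_error y t j + \sum_i within_error y i j) +
  2^-1 * (ln (pi *+ 2) - ln (post_prec t j)).
  have ln3 (a b c : R) : 0 < a -> 0 < b -> 0 < c -> ln (a * b * c) = ln a + ln b + ln c.
    by move=> a0 b0 c0; rewrite lnM ?posrE ?mulr_gt0// lnM ?posrE.
  rewrite ln3 ?expR_gt0 ?sqrtr_gt0// expRK; congr (_ + _ + _).
  rewrite -mulrnAr in z0 *.
  rewrite -[in RHS](mulKf (x := 2) _ (ln (pi *+ 2) - _)) ?pnatr_eq0//.
  have -> : ln (pi *+ 2) - ln (post_prec t j) = ln (Num.sqrt ((post_prec t j)^-1 * (pi *+ 2)) ^+ 2).
    have pi2 : 0 < pi *+ 2 :> R by rewrite pmulrn_lgt0// pi_gt0.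
    by rewrite sqr_sqrtr ?(ltW z0)// lnM ?posrE ?invr_gt0// lnV ?posrE// addrC.
  by rewrite lnXn ?sqrtr_gt0// -mulr_natl; field.
by ring.
Qed.

(* The derivative of [beta] in a direction [t]: it vanishes at the reference laboratory,
   where [beta] is the constant 1. *)
Definition dbeta t (i : 'I_q.+1) : R :=
  if unlift ord0 i is Some a then rsubmx (bias t) ord0 a else 0.

(** * Derivatives of the log-likelihood along lines *)

Lemma level_mean_line t u h j : level_mean (t + h *: u) j = level_mean t j + h * level_mean u j.
Proof. by rewrite /level_mean !mxE. Qed.

Lemma alpha_line t u h i : alpha (t + h *: u) i = alpha t i + h * alpha u i.
Proof. by rewrite /alpha; case: unliftP => [a _|_]; rewrite ?mulr0 ?addr0// !mxE. Qed.

Lemma beta_line t u h i : beta (t + h *: u) i = beta t i + h * dbeta u i.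
Proof. by rewrite /beta /dbeta; case: unliftP => [a _|_]; rewrite ?mulr0 ?addr0// !mxE. Qed.

(** For a fixed level x, minus one half of the derivative of the weighted sum of squares in the
    direction [u] is [P0 + x P1 - x^2 P2]. The weighted product of the changes of the cell means in
    the directions [u] and [w] is [Paa + x Pab + x^2 Pbb]. *)
Definition P0 y t u j : R := \sum_i obs_prec i j * (obs_mean y i j - alpha t i) * alpha u i.
Definition P1 y t u j : R := \sum_i obs_prec i j *
  ((obs_mean y i j - alpha t i) * dbeta u i - beta t i * alpha u i).
Definition P2 t u j : R := \sum_i obs_prec i j * beta t i * dbeta u i.
Definition Paa u w j : R := \sum_i obs_prec i j * alpha u i * alpha w i.
Definition Pab u w j : R := \sum_i obs_prec i j * (alpha u i * dbeta w i + dbeta u i * alpha w i).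
Definition Pbb u w j : R := \sum_i obs_prec i j * dbeta u i * dbeta w i.

(** The building blocks are polynomials of degree at most two along a line, so their derivatives at
    0 are read off from the coefficients. *)
Lemma post_prec_line t u h j :
  post_prec (t + h *: u) j = post_prec t j + h * (2 * P2 t u j) + h ^+ 2 * Pbb u u j.
Proof.
rewrite /post_prec /P2 /Pbb !mulr_sumr -!addrA -!big_split /=; congr (_ + _).
by apply: eq_bigr => i _; rewrite beta_line; ring.
Qed.

Lemma post_lin_line y t u h j : post_lin y (t + h *: u) j =
  post_lin y t j + h * (level_mean u j / sx2 j + P1 y t u j) + h ^+ 2 * (- 2^-1 * Pab u u j).
Proof.
rewrite /post_lin /P1 /Pab level_mean_line.
have -> : \sum_i obs_prec i j * beta (t + h *: u) i * (obs_mean y i j - alpha (t + h *: u) i) =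
  \sum_i obs_prec i j * beta t i * (obs_mean y i j - alpha t i) +
  h * (\sum_i obs_prec i j * ((obs_mean y i j - alpha t i) * dbeta u i - beta t i * alpha u i)) +
  h ^+ 2 * (- 2^-1 * (\sum_i obs_prec i j * (alpha u i * dbeta u i + dbeta u i * alpha u i))).
  rewrite !mulr_sumr -!big_split /=.
  by apply: eq_bigr => i _; rewrite beta_line alpha_line; field.
by ring.
Qed.

Lemma P0_line y t u h w j : P0 y (t + h *: u) w j = P0 y t w j + h * (- Paa u w j) + h ^+ 2 * 0.
Proof.
rewrite /P0 /Paa mulr0 addr0 mulrN mulr_sumr -sumrB.
by apply: eq_bigr => i _; rewrite alpha_line; ring.
Qed.

Lemma P1_line y t u h w j : P1 y (t + h *: u) w j = P1 y t w j + h * (- Pab u w j) + h ^+ 2 * 0.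
Proof.
rewrite /P1 /Pab mulr0 addr0 mulrN mulr_sumr -sumrB.
by apply: eq_bigr => i _; rewrite alpha_line beta_line; ring.
Qed.

Lemma P2_line t u h w j : P2 (t + h *: u) w j = P2 t w j + h * Pbb u w j + h ^+ 2 * 0.
Proof.
rewrite /P2 /Pbb mulr0 addr0 mulr_sumr -big_split /=.
by apply: eq_bigr => i _; rewrite beta_line; ring.
Qed.

Lemma level_mean_line2 t u h j :
  level_mean (t + h *: u) j = level_mean t j + h * level_mean u j + h ^+ 2 * 0.
Proof. by rewrite level_mean_line mulr0 addr0. Qed.

Lemma ssq_line y t u h j :
  level_mean (t + h *: u) j ^+ 2 / sx2 j +
    \sum_i obs_prec i j * (obs_mean y i j - alpha (t + h *: u) i) ^+ 2 =
  level_mean t j ^+ 2 / sx2 j + \sum_i obs_prec i j * (obs_mean y i j - alpha t i) ^+ 2 +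
  h * (2 * (level_mean t j * level_mean u j / sx2 j - P0 y t u j)) +
  h ^+ 2 * (level_mean u j ^+ 2 / sx2 j + Paa u u j).
Proof.
rewrite /P0 /Paa level_mean_line.
have -> : \sum_i obs_prec i j * (obs_mean y i j - alpha (t + h *: u) i) ^+ 2 =
  \sum_i obs_prec i j * (obs_mean y i j - alpha t i) ^+ 2 +
  h * (- 2 * \sum_i obs_prec i j * (obs_mean y i j - alpha t i) * alpha u i) +
  h ^+ 2 * (\sum_i obs_prec i j * alpha u i * alpha u i).
  rewrite !mulr_sumr -!big_split /=.
  by apply: eq_bigr => i _; rewrite alpha_line; ring.
by ring.
Qed.

(** Since [fit_error] is a minimum over the level, its derivative is that of [joint_error] with the
    level held at [post_mean]. The term [P2 / post_prec] comes from [ln (post_prec t j)]. *)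
Definition score_level y t u j : R :=
  - (P2 t u j / post_prec t j) + P0 y t u j + post_mean y t j * P1 y t u j
  - post_mean y t j ^+ 2 * P2 t u j + (post_mean y t j - level_mean t j) * level_mean u j / sx2 j.

Definition score y t u : R := \sum_(j < m) score_level y t u j.

Definition dpost_mean y t u j : R :=
  (level_mean u j / sx2 j + P1 y t u j - 2 * post_mean y t j * P2 t u j) / post_prec t j.

Definition dscore_level y t w u j : R :=
  - (Pbb w u j / post_prec t j) + 2 * P2 t u j * P2 t w j / post_prec t j ^+ 2
  - Paa w u j + dpost_mean y t w j * P1 y t u j - post_mean y t j * Pab w u j
  - 2 * post_mean y t j * dpost_mean y t w j * P2 t u j
  - post_mean y t j ^+ 2 * Pbb w u j
  + (dpost_mean y t w j - level_mean w j) * level_mean u j / sx2 j.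

Notation D0 f l := (is_derive (0 : R) (1 : R) f l).

Lemma D0_eq (f g : R -> R) a b : D0 f a -> f =1 g -> a = b -> D0 g b.
Proof. by move=> fa /funext <- <-. Qed.

Lemma D0_add (f g : R -> R) a b : D0 f a -> D0 g b -> D0 (fun h => f h + g h) (a + b).
Proof. exact: is_deriveD. Qed.

Lemma D0_opp (f : R -> R) a : D0 f a -> D0 (fun h => - f h) (- a).
Proof. exact: is_deriveN. Qed.

Lemma D0_mul (f g : R -> R) a b : D0 f a -> D0 g b ->
  D0 (fun h => f h * g h) (f 0 * b + g 0 * a).
Proof. exact: is_deriveM. Qed.

Lemma D0_poly2 (c0 c1 c2 : R) : D0 (fun h => c0 + h * c1 + h ^+ 2 * c2) c1.
Proof.
have dc (c : R) : D0 (fun=> c) (0 : R) by exact: is_derive_cst.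
have di : D0 (fun h => h) 1 by exact: is_derive_id.
apply: (D0_eq (D0_add (D0_add (dc c0) (D0_mul di (dc c1)))
  (D0_mul (D0_mul di di) (dc c2)))) => [h|]; first by rewrite expr2.
by ring.
Qed.

Lemma D0_inv (f : R -> R) a : f 0 != 0 -> D0 f a ->
  D0 (fun h => (f h)^-1) (- a / f 0 ^+ 2).
Proof. by move=> f0 fa; apply: (D0_eq (is_deriveV f0 fa)) => //; rewrite mulNr mulrC -mulNr. Qed.

Lemma D0_ln (f : R -> R) a : 0 < f 0 -> D0 f a -> D0 (fun h => ln (f h)) (a / f 0).
Proof.
move=> f0 fa; apply: (D0_eq (is_derive1_comp (is_derive1_ln f0) fa)) => //.
by rewrite mulrC.
Qed.

Lemma D0_sum n (f : 'I_n -> R -> R) (a : 'I_n -> R) : (forall i, D0 (f i) (a i)) ->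
  D0 (fun h => \sum_(i < n) f i h) (\sum_(i < n) a i).
Proof.
move=> fa; apply: (D0_eq (is_derive_sum fa)) => // h.
by rewrite fct_sumE.
Qed.

Lemma derive_line (f : 'rV[R]_(m + (q + q)) -> R) t u l :
  D0 (fun h => f (t + h *: u)) l -> 'D_u f t = l.
Proof.
move=> fl; rewrite -(@derive_val _ _ _ _ _ _ _ fl) /derive;
rewrite (_ : (fun h => _) = (fun h : R => h^-1 *:
    (((fun k : R => f (t + k *: u)) \o shift 0) (h *: (1 : R)) - f (t + 0 *: u)))) //.
apply/funext => h /=; congr (_ *: (f _ - f _)).
  by rewrite addr0 [h%:A]mulr1 addrC.
by rewrite scale0r addr0.
Qed.

Lemma post_prec_D0 t u j : D0 (fun h => post_prec (t + h *: u) j) (2 * P2 t u j).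
Proof. by apply: (D0_eq (D0_poly2 _ _ _)) => // h; rewrite post_prec_line. Qed.

Lemma post_lin_D0 y t u j : D0 (fun h => post_lin y (t + h *: u) j)
  (level_mean u j / sx2 j + P1 y t u j).
Proof. by apply: (D0_eq (D0_poly2 _ _ _)) => // h; rewrite post_lin_line. Qed.

Lemma P0_D0 y t u w j : D0 (fun h => P0 y (t + h *: u) w j) (- Paa u w j).
Proof. by apply: (D0_eq (D0_poly2 _ _ _)) => // h; rewrite P0_line. Qed.

Lemma P1_D0 y t u w j : D0 (fun h => P1 y (t + h *: u) w j) (- Pab u w j).
Proof. by apply: (D0_eq (D0_poly2 _ _ _)) => // h; rewrite P1_line. Qed.

Lemma P2_D0 t u w j : D0 (fun h => P2 (t + h *: u) w j) (Pbb u w j).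
Proof. by apply: (D0_eq (D0_poly2 _ _ _)) => // h; rewrite P2_line. Qed.

Lemma level_mean_D0 t u j : D0 (fun h => level_mean (t + h *: u) j) (level_mean u j).
Proof. by apply: (D0_eq (D0_poly2 _ _ _)) => // h; rewrite level_mean_line2. Qed.

Lemma post_prec_neq0 t j : post_prec t j != 0.
Proof. by rewrite gt_eqF ?post_prec_gt0. Qed.

Lemma post_mean_D0 y t u j : D0 (fun h => post_mean y (t + h *: u) j) (dpost_mean y t u j).
Proof.
have A0 := post_prec_neq0 t j.
have A0' : post_prec (t + 0 *: u) j != 0 by rewrite scale0r addr0.
apply: (D0_eq (D0_mul (post_lin_D0 y t u j) (D0_inv A0' (post_prec_D0 t u j)))) => //.
rewrite scale0r addr0 /dpost_mean /post_mean; field.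
by rewrite A0 gt_eqF.
Qed.

Lemma fit_error_D0 y t u j : D0 (fun h => fit_error y (t + h *: u) j)
  (2 * (level_mean t j * level_mean u j / sx2 j - P0 y t u j)
   - 2 * post_mean y t j * (level_mean u j / sx2 j + P1 y t u j)
   + 2 * post_mean y t j ^+ 2 * P2 t u j).
Proof.
have A0 := post_prec_neq0 t j.
have A0' : post_prec (t + 0 *: u) j != 0 by rewrite scale0r addr0.
have dB := post_lin_D0 y t u j.
apply: (D0_eq (D0_add (D0_poly2 _ _ _)
  (D0_opp (D0_mul (D0_mul dB dB) (D0_inv A0' (post_prec_D0 t u j)))))).
  by move=> h; rewrite /fit_error ssq_line expr2.
rewrite scale0r addr0 /post_mean; field.
by rewrite A0 gt_eqF.
Qed.

Lemma loglik_D0 y t u : D0 (fun h => loglik sx2 s2 y (t + h *: u)) (score y t u).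
Proof.
have A0 j : post_prec t j != 0 by exact: post_prec_neq0.
have A0' j : 0 < post_prec (t + 0 *: u) j by exact: post_prec_gt0.
apply: (D0_eq (D0_add (D0_poly2 (loglik_const y) 0 0) (D0_mul (D0_poly2 (- 2^-1) 0 0)
  (D0_sum (fun j => D0_add (D0_ln (A0' j) (post_prec_D0 t u j)) (fit_error_D0 y t u j)))))).
  by move=> h; rewrite loglikE; ring.
rewrite !(mulr0, addr0, add0r) /score mulr_sumr.
apply: eq_bigr => j _; rewrite scale0r addr0 /score_level; field.
by rewrite A0 gt_eqF.
Qed.

Lemma score_D0 y t w u : D0 (fun h => score y (t + h *: w) u)
  (\sum_(j < m) dscore_level y t w u j).
Proof.
apply: D0_sum => j.
have A0 : post_prec t j != 0 by exact: post_prec_neq0.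
have A0' : post_prec (t + 0 *: w) j != 0 by rewrite scale0r addr0.
have dA := D0_inv A0' (post_prec_D0 t w j).
have dX := post_mean_D0 y t w j.
have dK := D0_poly2 (level_mean u j / sx2 j) 0 0.
apply: (D0_eq (D0_add (D0_add (D0_add (D0_add (D0_opp (D0_mul (P2_D0 t w u j) dA))
  (P0_D0 y t w u j)) (D0_mul dX (P1_D0 y t w u j)))
  (D0_opp (D0_mul (D0_mul dX dX) (P2_D0 t w u j))))
  (D0_mul (D0_add dX (D0_opp (level_mean_D0 t w j))) dK))).
  by move=> h; rewrite /score_level; ring.
rewrite scale0r addr0 /dscore_level; field.
by rewrite A0 gt_eqF.
Qed.

Lemma partial_loglik y t b : partial b (loglik sx2 s2 y) t = score y t (delta_mx ord0 b).
Proof. exact/derive_line/loglik_D0. Qed.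

Lemma infoE y t a b : info sx2 s2 y t a b =
  - \sum_(j < m) dscore_level y t (delta_mx ord0 a) (delta_mx ord0 b) j.
Proof.
rewrite mxE; congr (- _).
rewrite (_ : partial b (loglik sx2 s2 y) = fun t => score y t (delta_mx ord0 b)).
  exact/derive_line/score_D0.
by apply/funext => t'; exact: partial_loglik.
Qed.

(** Fermat's rule on each line through the maximizer. *)
Lemma mle_score y t u : is_mle sx2 s2 y t -> score y t u = 0.
Proof.
move=> tmax; have dl := loglik_D0 y t u.
have cab : (0 : R) \in `](-1), 1[%R by rewrite in_itv /= ltrN10 ltr01.
have h1 : is_derive (0 : R) 1 (fun h => loglik sx2 s2 y (t + h *: u)) 0.
  apply: (@derive1_at_max R (fun h => loglik sx2 s2 y (t + h *: u)) (-1) 1 0 _ _ cab).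
  - by lra.
  (* Derivability away from 0 follows by moving the base point of the line. *)
  - move=> h _; have dl' := loglik_D0 y (t + h *: u) u.
    have dg : is_derive h (1 : R) (fun z : R => z - h) 1.
      by apply: is_derive_eq; rewrite subr0.
    rewrite -(subrr h) in dl'.
    have dF := @is_derive1_comp R (fun k => loglik sx2 s2 y (t + h *: u + k *: u)) (fun z => z - h) h _ _ dl' dg.
    rewrite (_ : (fun z => _) = (fun k => loglik sx2 s2 y (t + h *: u + k *: u)) \o (fun z : R => z - h)).
      exact: ex_derive.
    apply/funext => z /=; rewrite -addrA -scalerDl.
    by rewrite (_ : h + (z - h) = z)//; ring.
  - by move=> h _; rewrite scale0r addr0; exact: tmax.
by rewrite -(@derive_val _ _ _ _ _ _ _ dl) (@derive_val _ _ _ _ _ _ _ h1).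
Qed.

(** * Bias directions, and the equations satisfied at the maximum *)

Definition bias_dir (c : 'I_(q + q)) : 'rV[R]_(m + (q + q)) := delta_mx ord0 (rshift m c).

Lemma level_mean_bias_dir c j : level_mean (bias_dir c) j = 0.
Proof. by rewrite /level_mean /bias_dir !mxE /= eq_lrshift. Qed.

(** This is [post_prec] times the derivative of [post_mean] in the bias direction [c]. *)
Definition Edir y t c j : R := P1 y t (bias_dir c) j - 2 * post_mean y t j * P2 t (bias_dir c) j.

(** The derivative of the mean [alpha + beta * x] in the bias coordinate [c]: the regressor of
    laboratory [i] at level [x]. *)
Definition ell (x : R) c i : R := alpha (bias_dir c) i + x * dbeta (bias_dir c) i.

(** The first two terms are the leading ones: the information with known levels, less what is spent
    on predicting them. The other two come from [ln (post_prec t j)] and are of lower order. *)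
Lemma bias_infoE y t a b : bias_info sx2 s2 y t a b =
  \sum_(j < m) (\sum_i obs_prec i j * ell (post_mean y t j) a i * ell (post_mean y t j) b i
   - Edir y t a j * Edir y t b j / post_prec t j
   + Pbb (bias_dir a) (bias_dir b) j / post_prec t j
   - 2 * P2 t (bias_dir a) j * P2 t (bias_dir b) j / post_prec t j ^+ 2).
Proof.
transitivity (info sx2 s2 y t (rshift m a) (rshift m b)).
  by rewrite -[info sx2 s2 y t in RHS]submxK block_mxEdr.
rewrite infoE -sumrN; apply: eq_bigr => j _.
have -> : \sum_i obs_prec i j * ell (post_mean y t j) a i * ell (post_mean y t j) b i =
    Paa (bias_dir a) (bias_dir b) j + post_mean y t j * Pab (bias_dir a) (bias_dir b) j +
    post_mean y t j ^+ 2 * Pbb (bias_dir a) (bias_dir b) j.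
  by rewrite /Paa /Pab /Pbb !mulr_sumr -!big_split /=; apply: eq_bigr => i _; rewrite /ell; ring.
rewrite /dscore_level /dpost_mean -/(bias_dir a) -/(bias_dir b) !level_mean_bias_dir /Edir.
by ring.
Qed.

Lemma score_bias_dir y t c : score y t (bias_dir c) =
  \sum_(j < m) (\sum_i obs_prec i j *
      (obs_mean y i j - alpha t i - beta t i * post_mean y t j) * ell (post_mean y t j) c i
    - P2 t (bias_dir c) j / post_prec t j).
Proof.
apply: eq_bigr => j _; rewrite /score_level level_mean_bias_dir mulr0 mul0r addr0.
rewrite -!addrA addrC; congr (_ - _).
rewrite /P0 /P1 /P2 !mulr_sumr -sumrN -!big_split /=; apply: eq_bigr => i _; rewrite /ell; ring.
Qed.

(** In the direction of a level mean only the prior term of the score survives, and it is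
    proportional to [post_mean - level_mean]. *)
Lemma post_mean_mle y t j : is_mle sx2 s2 y t -> post_mean y t j = level_mean t j.
Proof.
move=> /(mle_score (delta_mx ord0 (lshift (q + q) j))).
have bias0 : bias (delta_mx ord0 (lshift (q + q) j)) = 0 :> 'rV[R]_(q + q).
  by apply/matrixP => i k; rewrite !mxE eq_rlshift andbF.
have al0 i : alpha (delta_mx ord0 (lshift (q + q) j) : 'rV[R]_(m + (q + q))) i = 0.
  by rewrite /alpha bias0; case: unliftP => // a _; rewrite !mxE.
have be0 i : dbeta (delta_mx ord0 (lshift (q + q) j)) i = 0.
  by rewrite /dbeta bias0; case: unliftP => // a _; rewrite !mxE.
rewrite /score (bigD1 j)//= big1 ?addr0 => [|k kj].
  rewrite /score_level /P0 /P1 /P2 !big1 => [|i _|i _|i _]; rewrite ?al0 ?be0 ?mulr0 ?subrr ?mulr0//.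
  rewrite !(mul0r, oppr0, add0r, addr0) {2}/level_mean !mxE !eqxx mulr1 => /eqP.
  by rewrite mulf_eq0 invr_eq0 [sx2 j == 0]gt_eqF// orbF subr_eq0 => /eqP.
rewrite /score_level /P0 /P1 /P2 !big1 => [|i _|i _|i _]; rewrite ?al0 ?be0 ?mulr0 ?subrr ?mulr0//.
rewrite !(mul0r, oppr0, add0r, addr0) {2}/level_mean !mxE eq_lshift (negbTE kj) andbF.
by rewrite mulr0 mul0r.
Qed.

(** Since the fitted level mean equals [post_mean], the prior terms cancel in
    [post_mean * post_prec = post_lin], leaving the least squares equation for the level. *)
Lemma sum_resid_mle y t j : is_mle sx2 s2 y t ->
  \sum_i obs_prec i j * beta t i *
    (obs_mean y i j - alpha t i - beta t i * post_mean y t j) = 0.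
Proof.
move=> /(post_mean_mle j) XE.
have : post_mean y t j * post_prec t j = post_lin y t j by rewrite divfK ?post_prec_neq0.
rewrite /post_prec /post_lin mulrDr {1}XE => /addrI E.
transitivity (\sum_i obs_prec i j * beta t i * (obs_mean y i j - alpha t i) -
  post_mean y t j * \sum_i obs_prec i j * beta t i ^+ 2); last by rewrite E subrr.
by rewrite mulr_sumr -sumrB; apply: eq_bigr => i _; ring.
Qed.

Lemma mle_fit y t t' : is_mle sx2 s2 y t ->
  \sum_(j < m) (ln (post_prec t j) + fit_error y t j) <=
  \sum_(j < m) (ln (post_prec t' j) + fit_error y t' j).
Proof. by move=> /(_ t'); rewrite !loglikE lerD2l lerN2 ler_pM2l// invr_gt0. Qed.

Lemma fit_error_sum y t j : fit_error y t j =
  (post_mean y t j - level_mean t j) ^+ 2 / sx2 j +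
  \sum_i obs_prec i j * (obs_mean y i j - alpha t i - beta t i * post_mean y t j) ^+ 2.
Proof. exact: fit_errorE. Qed.

End likelihood_formula.

(** * Convergent sequences of matrices *)

Section real_sequences.
Context {R : realType}.
Implicit Types (u v : nat -> R) (a b : R).

(* An inductive copy of the convergence statement, so that unification never unfolds it. *)
Variant tends u a : Prop := Tends of u k @[k --> \oo] --> a.

Lemma tendsP u a : tends u a <-> u k @[k --> \oo] --> a.
Proof. by split=> [[]|]. Qed.

Lemma tends_cst a : tends (fun=> a) a.
Proof. by split; exact: cvg_cst. Qed.

Lemma tendsD u v a b : tends u a -> tends v b -> tends (fun k => u k + v k) (a + b).
Proof. by move=> [ua] [vb]; split; exact: cvgD. Qed.

Lemma tendsB u v a b : tends u a -> tends v b -> tends (fun k => u k - v k) (a - b).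
Proof. by move=> [ua] [vb]; split; exact: cvgB. Qed.

Lemma tendsM u v a b : tends u a -> tends v b -> tends (fun k => u k * v k) (a * b).
Proof. by move=> [ua] [vb]; split; exact: cvgM. Qed.

Lemma tendsX2 u a : tends u a -> tends (fun k => u k ^+ 2) (a ^+ 2).
Proof.
move=> ua; rewrite expr2 (_ : (fun k => _) = (fun k => u k * u k)); first exact: tendsM.
by apply/funext => k; rewrite expr2.
Qed.

Lemma tendsV u a : a != 0 -> tends u a -> tends (fun k => (u k)^-1) a^-1.
Proof. by move=> a0 [ua]; split; exact: cvgV. Qed.

Lemma tends_sum (I : Type) (r : seq I) (P : pred I) (u : I -> nat -> R) (a : I -> R) :
  (forall i, P i -> tends (u i) (a i)) ->
  tends (fun k => \sum_(i <- r | P i) u i k) (\sum_(i <- r | P i) a i).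
Proof. by move=> ua; split; apply: cvg_big => [|i /ua[]//]; exact: add_continuous. Qed.

Lemma tends_prod (I : Type) (r : seq I) (P : pred I) (u : I -> nat -> R) (a : I -> R) :
  (forall i, P i -> tends (u i) (a i)) ->
  tends (fun k => \prod_(i <- r | P i) u i k) (\prod_(i <- r | P i) a i).
Proof. by move=> ua; split; apply: cvg_big => [|i /ua[]//]; exact: mul_continuous. Qed.

Lemma tends_eq u v a b : tends u a -> u =1 v -> a = b -> tends v b.
Proof. by move=> ua /funext <- <-. Qed.

Lemma tends_near u v a : (\forall k \near \oo, u k = v k) -> tends u a -> tends v a.
Proof. by move=> uv [ua]; split; exact: cvg_trans (near_eq_cvg uv) ua. Qed.

Lemma tends_cont u a (f : R -> R) : {for a, continuous f} -> tends u a ->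
  tends (fun k => f (u k)) (f a).
Proof. by move=> fc [ua]; split; apply: (cvg_comp _ _ ua). Qed.

Lemma tends_bounded u a : tends u a -> exists M : R, forall k, `|u k| <= M.
Proof.
move=> [ua]; have [M [_ uM]] : bounded_fun u by apply: cvg_seq_bounded; apply/cvg_ex; exists a.
by exists (M + 1) => k; apply: (uM (M + 1)) => //; rewrite ltrDl.
Qed.

Lemma tends_squeeze0 u v : (forall k, `|u k| <= v k) -> tends v 0 -> tends u 0.
Proof.
move=> uv [v0]; split; apply: (@squeeze_cvgr _ _ _ _ (fun k => - v k) v) => //.
  by near=> k; have := uv k; rewrite ler_norml.
by rewrite -oppr0; exact: cvgN.
Unshelve. all: by end_near. Qed.

Lemma tends0_bounded u v M : (forall k, `|u k| <= M) -> tends v 0 -> tends (fun k => u k * v k) 0.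
Proof.
move=> uM v0; apply: (@tends_squeeze0 _ (fun k => M * `|v k|)) => [k|].
  by rewrite normrM ler_wpM2r.
rewrite -(mulr0 M); apply: tendsM; first exact: tends_cst.
by split; rewrite -(normr0 R); case: v0 => v0; exact: (cvg_norm v0).
Qed.

Lemma tends0_sqr u : tends (fun k => u k ^+ 2) 0 -> tends u 0.
Proof.
move=> u0; apply: (@tends_squeeze0 _ (fun k => Num.sqrt (u k ^+ 2))) => [k|].
  by rewrite sqrtr_sqr.
by rewrite -(sqrtr0 R); apply: tends_cont u0; exact: sqrt_continuous.
Qed.

Lemma tends_near_neq0 u a : a != 0 -> tends u a -> \forall k \near \oo, u k != 0.
Proof. by move=> a0 [ua]; exact: (cvgr_neq0 a). Qed.

End real_sequences.

Section matrix_sequences.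
Context {R : realType}.

Definition mtends a b (M : nat -> 'M[R]_(a, b)) (L : 'M[R]_(a, b)) :=
  forall i j, tends (fun k => M k i j) (L i j).

Lemma mtends_cst a b (L : 'M[R]_(a, b)) : mtends (fun=> L) L.
Proof. by move=> i j; exact: tends_cst. Qed.

Lemma mtends_mul a b c (M : nat -> 'M[R]_(a, b)) (M' : nat -> 'M[R]_(b, c)) L L' :
  mtends M L -> mtends M' L' -> mtends (fun k => M k *m M' k) (L *m L').
Proof.
move=> ML ML' i j; apply: (tends_eq (u := fun k => \sum_l M k i l * M' k l j)).
- by apply: tends_sum => l _; exact: tendsM.
- by move=> k; rewrite mxE.
- by rewrite mxE.
Qed.

Lemma mtends_tr a b (M : nat -> 'M[R]_(a, b)) L : mtends M L -> mtends (fun k => (M k)^T) L^T.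
Proof.
by move=> ML i j; apply: (tends_eq (ML j i)) => [k|]; rewrite mxE.
Qed.

Lemma tends_det n (M : nat -> 'M[R]_n) L : mtends M L -> tends (fun k => \det (M k)) (\det L).
Proof.
move=> ML; apply: tends_sum => s _; apply: tendsM; first exact: tends_cst.
by apply: tends_prod => i _; exact: ML.
Qed.

Lemma mtends_adj n (M : nat -> 'M[R]_n) L : mtends M L -> mtends (fun k => \adj (M k)) (\adj L).
Proof.
move=> ML i j; apply: (@tends_eq _ (fun k => cofactor (M k) j i) _ (cofactor L j i)).
- rewrite /cofactor; apply: tendsM; first exact: tends_cst.
  apply: tends_det => i' j'.
  by apply: (tends_eq (ML (lift j i') (lift i j'))) => [k|]; rewrite !mxE.
- by move=> k; rewrite mxE.
- by rewrite mxE.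
Qed.

Lemma mtends_unit n (M : nat -> 'M[R]_n) L : L \in unitmx -> mtends M L ->
  \forall k \near \oo, M k \in unitmx.
Proof.
rewrite unitmxE unitfE => L0 ML.
have := tends_near_neq0 L0 (tends_det ML).
by apply: filterS => k; rewrite unitmxE unitfE.
Qed.

(** Cramer's formula; invertibility of the limit persists along the sequence. *)
Lemma mtends_inv n (M : nat -> 'M[R]_n) L : L \in unitmx -> mtends M L ->
  mtends (fun k => invmx (M k)) (invmx L).
Proof.
move=> uL ML i j; apply: (tends_near (u := fun k => (\det (M k))^-1 * (\adj (M k)) i j)).
  have := mtends_unit uL ML; apply: filterS => k uk.
  by rewrite /invmx uk [RHS]mxE.
rewrite /invmx uL mxE; apply: tendsM; last exact: mtends_adj.
by apply: tendsV; [rewrite -unitfE -unitmxE|exact: tends_det].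
Qed.

Lemma mtendsP a b (M : nat -> 'M[R]_(a, b)) (L : 'M[R]_(a, b)) :
  M k @[k --> \oo] --> L <-> mtends M L.
Proof.
split=> [ML i j|ML].
  split; exact: (cvg_comp _ _ ML (@coord_continuous _ _ _ i j L)).
move=> A [B LB BA].
have : \forall k \near \oo, forall i j, B i j (M k i j).
  by apply: filter_forall => i; apply: filter_forall => j; by have [h] := ML i j; exact: h.
by apply: filterS => k Bk; exact: BA.
Qed.

(* The quadratic form of [wald], with its junk value 0. *)
Definition wald_form q r (H : 'M[R]_(q, r)) (J : 'M[R]_q) (u : 'rV[R]_r) : R :=
  let V := H^T *m invmx J *m H in
  if (J \in unitmx) && (V \in unitmx) then (u *m invmx V *m u^T) ord0 ord0 else 0.

(** Homogeneity trades the raw information and error for their normalized versions, both of which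
    converge. *)
Lemma wald_form_scale q r (H : 'M[R]_(q, r)) (J : 'M[R]_q) (u : 'rV[R]_r) (c : R) : 0 < c ->
  wald_form H (c *: J) u = wald_form H J (Num.sqrt c *: u).
Proof.
move=> c0; have cN : c != 0 by rewrite gt_eqF.
have cU : c \is a GRing.unit by rewrite unitfE.
have uJ : (c *: J \in unitmx) = (J \in unitmx) by rewrite unitmxZ.
rewrite /wald_form uJ; have [uJ'|] := boolP (J \in unitmx); last by [].
rewrite invmxZ ?uJ//= -scalemxAr -scalemxAl.
rewrite unitmxZ ?unitrV//; set V := H^T *m _ *m _; have [uV|] := boolP (V \in unitmx); last by [].
rewrite invmxZ ?unitmxZ ?unitrV// invrK.
rewrite -scalemxAr -!scalemxAl [in RHS]linearZ /= -scalemxAr scalerA.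
by rewrite -expr2 sqr_sqrtr// ltW.
Qed.

(** Invertible limits keep the sequence eventually off the default value. *)
Lemma wald_form_tends q r (H : nat -> 'M[R]_(q, r)) J u H' J' u' :
  mtends H H' -> mtends J J' -> mtends u u' ->
  J' \in unitmx -> H'^T *m invmx J' *m H' \in unitmx ->
  tends (fun k => wald_form (H k) (J k) (u k)) (wald_form H' J' u').
Proof.
move=> tH tJ tu uJ uV.
have tV : mtends (fun k => (H k)^T *m invmx (J k) *m H k) (H'^T *m invmx J' *m H').
  by apply: mtends_mul => //; apply: mtends_mul; [exact: mtends_tr|exact: mtends_inv].
apply: (tends_near (u := fun k => (u k *m invmx ((H k)^T *m invmx (J k) *m H k) *m (u k)^T) ord0 ord0)).
  have := mtends_unit uV tV; have := mtends_unit uJ tJ; apply: filterS2 => k uJk uVk.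
  by rewrite /wald_form uJk uVk.
rewrite /wald_form uJ uV.
by apply: mtends_mul; [apply: mtends_mul => //; exact: mtends_inv|exact: mtends_tr].
Qed.

(** The delta method around a moving base point [w k]. The mean value theorem is applied to each
    component of [h] separately, so the intermediate point depends on the component. *)
Lemma mtends_C1 n r (h : 'rV[R]_n -> 'rV[R]_r) (v w : nat -> 'rV[R]_n) (b tau : 'rV[R]_n)
    (c : nat -> R) :
  (forall x, differentiable h x) -> continuous (jacobian h) ->
  mtends v b -> mtends w b -> mtends (fun k => c k *: (v k - w k)) tau ->
  mtends (fun k => c k *: (h (v k) - h (w k))) (tau *m jacobian h b).
Proof.
move=> dh ch tv tw tc i l.
have mvt k : exists2 s : R, 0 <= s <= 1 &
    (h (v k) - h (w k)) i l = ((v k - w k) *m jacobian h (w k + s *: (v k - w k))) i l.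
  pose f (s : R) := h (w k + s *: (v k - w k)) i l.
  pose df (s : R) := ((v k - w k) *m jacobian h (w k + s *: (v k - w k))) i l.
  have fd s : is_derive (s : R) (1 : R) f (df s).
    set x := w k + s *: (v k - w k); set e := v k - w k.
    have cv : (fun t : R => t^-1 *: ((f \o shift s) (t *: (1 : R)) - f s)) @ 0^' --> df s.
      have /cvg_ex[l' hl] := diff_derivable (v := e) (dh x).
      have lE : l' = e *m jacobian h x.
        by rewrite -deriveEjacobian// /derive; apply/esym/cvg_lim.
      have := cvg_comp _ _ hl (@coord_continuous _ _ _ i l l').
      rewrite /df -/x -/e -lE; apply: cvg_trans; apply: near_eq_cvg; near=> t.
      rewrite /= /f !mxE; congr (_ * (_ - _)).
      congr (h _ i l); rewrite /x -/e [t%:A]mulr1 scalerDl [RHS]addrCA.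
      by rewrite addrC -addrA.
    have dv : derivable f s 1 by apply/cvg_ex; exists (df s).
    by apply: DeriveDef => //; apply/cvg_lim.
  have fc : {within `[0, 1], continuous f}.
    apply: continuous_subspaceT => s; apply: differentiable_continuous.
    by apply/derivable1_diffP; exact: ex_derive.
  have [s s01 E] := @MVT_segment R f df 0 1 ler01 (fun s _ => fd s) fc.
  exists s; first by move: s01; rewrite in_itv.
  have e1 : w k + 1 *: (v k - w k) = v k by rewrite scale1r addrC subrK.
  move: E; rewrite /f /df e1 scale0r addr0 subr0 mulr1 => <-.
  by rewrite !mxE.
have [s sP] := choice (fun k => let: ex_intro2 s a b := mvt k in ex_intro (fun s => _ /\ _) s (conj a b)).
have tx : mtends (fun k => w k + s k *: (v k - w k)) b.
  move=> i' p; apply: (tends_eq (u := fun k => w k i' p + s k * (v k i' p - w k i' p)) (a := b i' p + 0)).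
  - apply: tendsD; first exact: tw.
    apply: (tends0_bounded (M := 1)).
      by move=> k; have [/andP[s0 s1] _] := sP k; rewrite ger0_norm.
    by rewrite -(subrr (b i' p)); apply: tendsB; [exact: tv|exact: tw].
  - by move=> k; rewrite !mxE.
  - by rewrite addr0.
have tj : mtends (fun k => jacobian h (w k + s k *: (v k - w k))) (jacobian h b).
  by apply/mtendsP; apply: (cvg_comp _ _ ((mtendsP _ _).2 tx)); exact: ch.
have tE : mtends (fun k => c k *: (v k - w k) *m jacobian h (w k + s k *: (v k - w k)))
  (tau *m jacobian h b) by exact: mtends_mul.
apply: (tends_eq (tE i l)) => // k.
by have [_ E] := sP k; rewrite -scalemxAl [RHS]mxE E mxE.
Unshelve. all: by end_near. Qed.

End matrix_sequences.

(** * Asymptotics along a convergent sequence of outcomes *)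

Section weighted_form.
Context {R : realType} {I : finType}.
Implicit Types (om b f e : I -> R).

(* The semi-inner product of f and e after removing their component along b. *)
Definition bform om b f e : R := \sum_i om i * f i * e i -
  (\sum_i om i * b i * f i) * (\sum_i om i * b i * e i) / \sum_i om i * b i ^+ 2.

(** The residual of the weighted least squares regression of [f] on [b]. *)
Definition residual om b f i : R :=
  f i - b i * ((\sum_l om l * b l * f l) / \sum_l om l * b l ^+ 2).

Lemma sum_residual om b f e : \sum_i om i * residual om b f i * e i = bform om b f e.
Proof.
rewrite /bform /residual; set c := (\sum_l om l * b l * f l).
rewrite [RHS](_ : _ = \sum_i om i * f i * e i -
  (c / \sum_l om l * b l ^+ 2) * \sum_i om i * b i * e i); last by ring.
by rewrite mulr_sumr -sumrB; apply: eq_bigr => i _; ring.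
Qed.

Lemma bformC om b f e : bform om b f e = bform om b e f.
Proof.
rewrite /bform; congr (_ - _ / _); last by rewrite mulrC.
by apply: eq_bigr => i _; ring.
Qed.

Lemma residual_orth om b f : \sum_i om i * b i ^+ 2 != 0 ->
  \sum_i om i * residual om b f i * b i = 0.
Proof.
move=> W0; rewrite sum_residual /bform.
have -> : \sum_i om i * b i * b i = \sum_i om i * b i ^+ 2 by apply: eq_bigr => i _; ring.
have -> : \sum_i om i * f i * b i = \sum_i om i * b i * f i by apply: eq_bigr => i _; ring.
by rewrite mulfK// subrr.
Qed.

(** Residuals are orthogonal to [b], so projecting both arguments or only one gives the same
    form. *)
Lemma sum_residual2 om b f e : \sum_i om i * b i ^+ 2 != 0 ->
  \sum_i om i * residual om b f i * residual om b e i = bform om b f e.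
Proof.
move=> W0; rewrite -sum_residual {2}/residual.
set c := (_ / _).
rewrite (eq_bigr (fun i => om i * residual om b f i * e i - c * (om i * residual om b f i * b i))).
  by rewrite sumrB -mulr_sumr residual_orth// mulr0 subr0.
by move=> i _; ring.
Qed.

Lemma residual_sum om b (J : finType) (a : J -> R) (f : J -> I -> R) i :
  residual om b (fun i => \sum_j a j * f j i) i = \sum_j a j * residual om b (f j) i.
Proof.
rewrite /residual.
have -> : \sum_l om l * b l * (\sum_j a j * f j l) = \sum_j a j * \sum_l om l * b l * f j l.
  under eq_bigr do rewrite mulr_sumr.
  rewrite exchange_big /=; apply: eq_bigr => j _; rewrite mulr_sumr.
  by apply: eq_bigr => l _; ring.
rewrite mulr_suml mulr_sumr -sumrB; apply: eq_bigr => j _; ring.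
Qed.

Lemma bform_tends (om b f e : nat -> I -> R) om' b' f' e' :
  \sum_i om' i * b' i ^+ 2 != 0 ->
  (forall i, tends (om ^~ i) (om' i)) -> (forall i, tends (b ^~ i) (b' i)) ->
  (forall i, tends (f ^~ i) (f' i)) -> (forall i, tends (e ^~ i) (e' i)) ->
  tends (fun k => bform (om k) (b k) (f k) (e k)) (bform om' b' f' e').
Proof.
move=> W0 tom tb tf te; apply: tendsB.
  by apply: tends_sum => i _; apply: tendsM => //; exact: tendsM.
apply: tendsM.
  by apply: tendsM; apply: tends_sum => i _; apply: tendsM => //; exact: tendsM.
apply: tendsV => //; apply: tends_sum => i _; apply: tendsM => //; exact: tendsX2.
Qed.

End weighted_form.

(** * Intercepts and slopes as coordinates of the bias part *)

Section directions.
Context {R : realType} {m q : nat}.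
Implicit Types t : 'rV[R]_(m + (q + q)).

Lemma alpha_ord0 t : alpha t ord0 = 0.
Proof. by rewrite /alpha unlift_none. Qed.

Lemma beta_ord0 t : beta t ord0 = 1.
Proof. by rewrite /beta unlift_none. Qed.

Lemma dbeta_ord0 t : dbeta t ord0 = 0.
Proof. by rewrite /dbeta unlift_none. Qed.

Lemma bias_bias_dir c : bias (bias_dir c : 'rV[R]_(m + (q + q))) = delta_mx ord0 c.
Proof. by apply/matrixP => i j; rewrite !mxE eq_rshift. Qed.

Lemma sum_delta (F : 'I_(q + q) -> R) c : \sum_c' F c' * (c == c')%:R = F c.
Proof.
by rewrite (bigD1 c)//= eqxx mulr1 big1 ?addr0// => i /negbTE; rewrite eq_sym => ->; rewrite mulr0.
Qed.

Lemma sum_alpha_dir (w : 'I_(q + q) -> R) a :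
  \sum_c w c * alpha (bias_dir c : 'rV[R]_(m + (q + q))) (lift ord0 a) = w (lshift q a).
Proof.
rewrite -[RHS]sum_delta; apply: eq_bigr => c _; congr (_ * _).
by rewrite /alpha liftK bias_bias_dir !mxE.
Qed.

Lemma sum_dbeta_dir (w : 'I_(q + q) -> R) a :
  \sum_c w c * dbeta (bias_dir c : 'rV[R]_(m + (q + q))) (lift ord0 a) = w (rshift q a).
Proof.
rewrite -[RHS]sum_delta; apply: eq_bigr => c _; congr (_ * _).
by rewrite /dbeta liftK bias_bias_dir !mxE.
Qed.

Lemma alphaB t t' i :
  alpha t i - alpha t' i = \sum_c (bias t - bias t') ord0 c * alpha (bias_dir c : 'rV[R]_(m + (q + q))) i.
Proof.
have [a ->|->] := unliftP ord0 i.
  by rewrite sum_alpha_dir /alpha liftK !mxE.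
by rewrite !alpha_ord0 subrr big1// => c _; rewrite alpha_ord0 mulr0.
Qed.

Lemma betaB t t' i :
  beta t i - beta t' i = \sum_c (bias t - bias t') ord0 c * dbeta (bias_dir c : 'rV[R]_(m + (q + q))) i.
Proof.
have [a ->|->] := unliftP ord0 i.
  by rewrite sum_dbeta_dir /beta liftK !mxE.
by rewrite !beta_ord0 subrr big1// => c _; rewrite dbeta_ord0 mulr0.
Qed.

Lemma bias_tends (t : nat -> 'rV[R]_(m + (q + q))) (t' : 'rV[R]_(m + (q + q))) :
  (forall i, tends (fun k => alpha (t k) i) (alpha t' i)) ->
  (forall i, tends (fun k => beta (t k) i) (beta t' i)) ->
  mtends (fun k => bias (t k)) (bias t').
Proof.
move=> ta tb i c; rewrite (ord1 i); have [a ->|a ->] := split_ordP c.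
  by apply: (tends_eq (ta (lift ord0 a))) => [k|]; rewrite /alpha liftK mxE.
by apply: (tends_eq (tb (lift ord0 a))) => [k|]; rewrite /beta liftK mxE.
Qed.

End directions.

Lemma sum_mxvec (R : realType) a b (F : 'I_(a * b) -> R) :
  \sum_k F k = \sum_(i < a) \sum_(j < b) F (mxvec_index i j).
Proof.
rewrite pair_bigA /= (reindex _ (curry_mxvec_bij a b)) /=.
by apply: eq_big => -[i j].
Qed.

(** * The limiting weighted regression *)

Section limit_experiment.
Context {R : realType} {m q : nat}.
Variables (s2 : 'I_q.+1 -> 'I_m -> R) (wt : 'I_q.+1 -> R).
Hypotheses (hs2 : forall i j, 0 < s2 i j) (hwt : forall i, 0 < wt i).
Variables (theta : 'rV[R]_(m + (q + q))).

Definition lim_prec i j : R := wt i / s2 i j.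

Notation elm x c i := (@ell R m q x c i).

(* The design matrix of the limiting weighted regression on the biases, with the latent
   levels profiled out. *)
Definition design (x : 'I_m -> R) : 'M[R]_(q.+1 * m, q + q) :=
  \matrix_(k, c) mxvec (\matrix_(i < q.+1, j < m) (Num.sqrt (lim_prec i j) *
    residual (lim_prec ^~ j) (beta theta) (fun i => elm (x j) c i) i)) ord0 k.

Lemma lim_prec_gt0 i j : 0 < lim_prec i j.
Proof. by rewrite divr_gt0. Qed.

Lemma lim_weight_gt0 j : 0 < \sum_i lim_prec i j * beta theta i ^+ 2.
Proof.
rewrite (bigD1 ord0)//= beta_ord0 expr1n mulr1 ltr_wpDr ?lim_prec_gt0//.
by apply: sumr_ge0 => i _; rewrite mulr_ge0 ?sqr_ge0// ltW ?lim_prec_gt0.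
Qed.

Lemma lim_weight_neq0 j : \sum_i lim_prec i j * beta theta i ^+ 2 != 0.
Proof. by rewrite gt_eqF ?lim_weight_gt0. Qed.

Definition lim_info (x : 'I_m -> R) : 'M[R]_(q + q) := \matrix_(a, b)
  \sum_(j < m) bform (lim_prec ^~ j) (beta theta) (fun i => elm (x j) a i) (fun i => elm (x j) b i).

Lemma design_gram x : (design x)^T *m design x = lim_info x.
Proof.
apply/matrixP => a b; rewrite !mxE sum_mxvec exchange_big /=; apply: eq_bigr => j _.
rewrite -sum_residual2 ?lim_weight_neq0//; apply: eq_bigr => i _.
rewrite !mxE !mxvecE !mxE.
by rewrite -[in RHS](sqr_sqrtr (ltW (lim_prec_gt0 i j))); ring.
Qed.

(** Dividing by the root of the precision gives the standard variable [g] the scale of the noise of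
    its cell. *)
Lemma design_score x (g : 'rV[R]_(q.+1 * m)) c :
  (g *m design x) ord0 c = \sum_(j < m) bform (lim_prec ^~ j) (beta theta)
    (fun i => vec_mx g i j / Num.sqrt (lim_prec i j)) (fun i => elm (x j) c i).
Proof.
rewrite mxE sum_mxvec exchange_big /=; apply: eq_bigr => j _.
rewrite bformC -sum_residual; apply: eq_bigr => i _.
have p0 : Num.sqrt (lim_prec i j) != 0 by rewrite gt_eqF ?sqrtr_gt0 ?lim_prec_gt0.
rewrite !mxE !mxvecE !mxE.
rewrite -[X in _ = X * _ * _](sqr_sqrtr (ltW (lim_prec_gt0 i j))).
by field.
Qed.

(** A kernel vector yields, at every level, a combination of regressors proportional to the slopes.
    It vanishes at the reference laboratory, where the slope is 1, hence everywhere; two distinct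
    levels then separate its intercept part from its slope part. *)
Lemma design_inj x j0 j1 : x j0 != x j1 ->
  forall w : 'cV[R]_(q + q), design x *m w = 0 -> w = 0.
Proof.
move=> x01 w Sw.
pose L j i := \sum_c w c ord0 * elm (x j) c i.
have res0 i j : residual (lim_prec ^~ j) (beta theta) (L j) i = 0.
  have /matrixP/(_ (mxvec_index i j) ord0) := Sw; rewrite !mxE => E.
  have p0 : Num.sqrt (lim_prec i j) != 0 by rewrite gt_eqF ?sqrtr_gt0 ?lim_prec_gt0.
  apply: (mulfI p0); rewrite mulr0 -E residual_sum mulr_sumr; apply: eq_bigr => c _.
  by rewrite !mxE mxvecE mxE; ring.
have LE j i : L j i = (\sum_c w c ord0 * alpha (bias_dir c : 'rV[R]_(m + (q + q))) i) +
    x j * \sum_c w c ord0 * dbeta (bias_dir c : 'rV[R]_(m + (q + q))) i.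
  by rewrite mulr_sumr -big_split /=; apply: eq_bigr => c _; rewrite /ell; ring.
have L0 j i : L j i = 0.
  have L00 : L j ord0 = 0.
    by rewrite LE !big1 ?mulr0 ?addr0// => c _; rewrite ?alpha_ord0 ?dbeta_ord0 mulr0.
  have := res0 ord0 j; rewrite /residual L00 beta_ord0 mul1r sub0r => /eqP.
  rewrite oppr_eq0 => /eqP r0.
  by have := res0 i j; rewrite /residual r0 mulr0 subr0.
apply/matrixP => c z; rewrite (ord1 z) [RHS]mxE.
have solve a : w (lshift q a) ord0 = 0 /\ w (rshift q a) ord0 = 0.
  have := L0 j0 (lift ord0 a); have := L0 j1 (lift ord0 a).
  rewrite !LE (sum_alpha_dir (fun c => w c ord0)) (sum_dbeta_dir (fun c => w c ord0)) => e1 e0.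
  have b0 : w (rshift q a) ord0 = 0.
    have : (x j0 - x j1) * w (rshift q a) ord0 = 0.
      by transitivity (0 - 0 : R); [rewrite -{1}e0 -e1; ring|rewrite subrr].
    by move/eqP; rewrite mulf_eq0 subr_eq0 (negbTE x01) => /eqP.
  by split => //; move: e0; rewrite b0 mulr0 addr0.
by have [a ->|a ->] := split_ordP c; have [] := solve a.
Qed.

Lemma lim_info_unit x j0 j1 : x j0 != x j1 -> lim_info x \in unitmx.
Proof. by move=> x01; rewrite -design_gram; apply: gram_unitmx; exact: design_inj x01. Qed.

End limit_experiment.

Lemma full_rank_inj (R : fieldType) k r (H : 'M[R]_(k, r)) : \rank H = r ->
  forall x : 'cV[R]_r, H *m x = 0 -> x = 0.
Proof.
move=> rH x Hx; have fH : row_free H^T by rewrite /row_free mxrank_tr rH.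
apply: trmx_inj; apply: (row_free_inj fH).
by rewrite -trmx_mul Hx !trmx0 mul0mx.
Qed.

(** The limiting statistic lives on the range of [S *m invmx J *m H], whose Gram matrix is the one
    that [wald_form] inverts. *)
Lemma profiled_gram (R : realType) n k r (S : 'M[R]_(n, k)) (J : 'M[R]_k) (H : 'M[R]_(k, r)) :
  S^T *m S = J -> (forall w : 'cV[R]_k, S *m w = 0 -> w = 0) -> \rank H = r ->
  (S *m invmx J *m H)^T *m (S *m invmx J *m H) = H^T *m invmx J *m H /\
  forall w : 'cV[R]_r, S *m invmx J *m H *m w = 0 -> w = 0.
Proof.
move=> SJ Si rH; have uJ : J \in unitmx by rewrite -SJ; exact: gram_unitmx.
split=> [|w].
  rewrite !trmx_mul trmx_inv.
  have -> : J^T = J by rewrite -SJ trmx_mul trmxK.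
  by rewrite -!mulmxA [S^T *m (S *m _)]mulmxA SJ [J *m (_ *m _)]mulmxA mulmxV// mul1mx.
rewrite -!mulmxA => /Si h; apply: (full_rank_inj rH).
by rewrite -[LHS](mulKVmx uJ) h mulmx0.
Qed.

(** * The maximum likelihood estimator along a convergent sequence of outcomes *)

Section asymptotics.
Context {R : realType} {m q : nat}.
Variables (sx2 : 'I_m -> R) (s2 : 'I_q.+1 -> 'I_m -> R).
Hypotheses (hsx2 : forall j, 0 < sx2 j) (hs2 : forall i j, 0 < s2 i j).
Variables (N : nat -> 'I_q.+1 -> nat) (wt : 'I_q.+1 -> R).
Hypotheses (N0 : forall k i, (0 < N k i)%N) (hwt : forall i, 0 < wt i).
Let n k : R := (\sum_l N k l)%:R.
Hypothesis hN : forall i, tends (fun k => (N k i)%:R^-1) (0 : R).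
Hypothesis hNwt : forall i, tends (fun k => (N k i)%:R / n k) (wt i).
Variables (theta : 'rV[R]_(m + (q + q))) (th : nat -> 'rV[R]_(m + (q + q))).
Hypothesis hth : mtends th theta.
Variables (x : nat -> 'I_m -> R) (x' : 'I_m -> R) (g : nat -> 'I_q.+1 -> 'I_m -> R)
  (g' : 'I_q.+1 -> 'I_m -> R).
Hypotheses (hx : forall j, tends (x ^~ j) (x' j)) (hg : forall i j, tends (fun k => g k i j) (g' i j)).
Variables (j0 j1 : 'I_m).
Hypothesis x01 : x' j0 != x' j1.
Variable y : forall k, data R m (N k).
Hypothesis hy : forall k i j, obs_mean (@y k) i j =
  alpha (th k) i + beta (th k) i * x k j + Num.sqrt (s2 i j) * g k i j / Num.sqrt (N k i)%:R.
Variable t : nat -> 'rV[R]_(m + (q + q)).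
Hypothesis ht : forall k, is_mle sx2 s2 (@y k) (t k).

(** Precisions are divided by [n], so that [lam] has the positive limit [om]; [al] and [be] are the
    true intercepts and slopes, [ah] and [bh] the estimated ones. *)
Let om := lim_prec s2 wt.
Let bt := beta theta.
Let lam k i j := obs_prec s2 (N k) i j / n k.
Let al k := alpha (th k).
Let be k := beta (th k).
Let ah k := alpha (t k).
Let bh k := beta (t k).
Let X k j := post_mean sx2 s2 (@y k) (t k) j.
Let A k j := post_prec sx2 s2 (N k) (t k) j.
Let fit k j := fit_error sx2 s2 (@y k) (t k) j.
Let res k i j := obs_mean (@y k) i j - ah k i - bh k i * X k j.

Lemma n_gt0 k : 0 < n k.
Proof. by rewrite ltr0n (bigD1 ord0)//= addn_gt0 N0. Qed.

Lemma n_neq0 k : n k != 0. Proof. by rewrite gt_eqF ?n_gt0. Qed.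

Lemma n_inv_tends : tends (fun k => (n k)^-1) 0.
Proof.
rewrite -(mulr0 (wt ord0)).
apply: (tends_eq (tendsM (hNwt ord0) (hN ord0))) => // k.
have := N0 k ord0; have := n_neq0 k; rewrite -(@ltr0n R) => nk /lt0r_neq0 Nk.
by field; rewrite nk.
Qed.

Lemma sqrt_n_inv_tends : tends (fun k => (Num.sqrt (n k))^-1) 0.
Proof.
apply: tends0_sqr; apply: (tends_eq n_inv_tends) => // k.
by rewrite exprVn sqr_sqrtr// ltW ?n_gt0.
Qed.

Lemma lam_tends i j : tends (fun k => lam k i j) (om i j).
Proof.
apply: (tends_eq (tendsM (hNwt i) (tends_cst (s2 i j)^-1))) => // k.
by rewrite /lam /obs_prec mulrAC.
Qed.

Lemma obs_prec_gt0 k i j : 0 < obs_prec s2 (N k) i j.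
Proof. by rewrite divr_gt0// ltr0n. Qed.

Lemma lam_gt0 k i j : 0 < lam k i j.
Proof. by rewrite divr_gt0 ?obs_prec_gt0 ?n_gt0. Qed.

Lemma om_gt0 i j : 0 < om i j.
Proof. exact: lim_prec_gt0. Qed.

Lemma obs_precE k i j : obs_prec s2 (N k) i j = n k * lam k i j.
Proof. by rewrite /lam mulrC divfK ?n_neq0. Qed.

Lemma obs_prec_inv_tends i j : tends (fun k => (obs_prec s2 (N k) i j)^-1) 0.
Proof.
rewrite -(mul0r (s2 i j)).
apply: (tends_eq (tendsM (hN i) (tends_cst (s2 i j)))) => // k.
by rewrite /obs_prec invf_div mulrC.
Qed.

Lemma al_tends i : tends (al ^~ i) (alpha theta i).
Proof.
rewrite /al /alpha; case: unliftP => [a _|_]; last exact: tends_cst.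
by apply: (tends_eq (hth ord0 (rshift m (lshift q a)))) => [k|]; rewrite !mxE.
Qed.

Lemma be_tends i : tends (be ^~ i) (bt i).
Proof.
rewrite /be /bt /beta; case: unliftP => [a _|_]; last exact: tends_cst.
by apply: (tends_eq (hth ord0 (rshift m (rshift q a)))) => [k|]; rewrite !mxE.
Qed.

Lemma A_gt0 k j : 0 < A k j.
Proof. exact: post_prec_gt0. Qed.

Lemma A_nE k j : A k j / n k = (sx2 j)^-1 * (n k)^-1 + \sum_i lam k i j * bh k i ^+ 2.
Proof.
rewrite /A /post_prec mulrDl mulr_suml; congr (_ + _); apply: eq_bigr => i _.
by rewrite /lam /bh mulrAC.
Qed.

(** At the reference laboratory, where the slope is 1, this bounds [ln (A k j / n k)] from below
    whatever the estimate. *)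
Lemma lam_le_A k i j : lam k i j * bh k i ^+ 2 <= A k j / n k.
Proof.
rewrite A_nE (bigD1 i)//= addrCA lerDl addr_ge0//.
  by rewrite mulr_ge0 ?invr_ge0 ?(ltW (hsx2 j)) ?(ltW (n_gt0 k)).
by apply: sumr_ge0 => l _; rewrite mulr_ge0 ?sqr_ge0// ltW ?lam_gt0.
Qed.

Lemma fit_ge k i j : obs_prec s2 (N k) i j * res k i j ^+ 2 <= fit k j.
Proof.
rewrite /fit fit_error_sum// (bigD1 i)//= addrCA lerDl addr_ge0//.
  by rewrite mulr_ge0 ?sqr_ge0// invr_ge0 ltW.
by apply: sumr_ge0 => l _; rewrite mulr_ge0 ?sqr_ge0// ltW ?obs_prec_gt0.
Qed.

(* The maximum is compared with the likelihood at the true biases and the realized levels. *)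
Lemma mle_bounds : exists C : R, forall k j,
  fit k j <= C /\ A k j / n k <= lam k ord0 j * expR C.
Proof.
pose th' k : 'rV[R]_(m + (q + q)) := row_mx (\row_j x k j) (bias (th k)).
have bth k : bias (th' k) = bias (th k) by rewrite /bias row_mxKr.
have lth k j : level_mean (th' k) j = x k j by rewrite /level_mean row_mxKl mxE.
have ath k i : alpha (th' k) i = al k i by rewrite /al /alpha bth.
have beth k i : beta (th' k) i = be k i by rewrite /be /beta bth.
pose A' k j := post_prec sx2 s2 (N k) (th' k) j.
have A'E k j : A' k j / n k = (sx2 j)^-1 * (n k)^-1 + \sum_i lam k i j * be k i ^+ 2.
  rewrite /A' /post_prec mulrDl mulr_suml; congr (_ + _); apply: eq_bigr => i _.
  by rewrite beth /lam; ring.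
have A't j : tends (fun k => A' k j / n k) (\sum_i om i j * bt i ^+ 2).
  have := tendsD (tendsM (tends_cst (sx2 j)^-1) n_inv_tends)
    (tends_sum (index_enum 'I_q.+1) (P := xpredT) (fun i _ => tendsM (lam_tends i j) (tendsX2 (be_tends i)))).
  rewrite mulr0 add0r => tA.
  by apply: (tends_eq tA) => // k; rewrite A'E.
(* With the level mean set to the realized level the prior term vanishes and the residuals are pure
   noise. *)
have fit' k j : fit_error sx2 s2 (@y k) (th' k) j <= \sum_i g k i j ^+ 2.
  apply: (le_trans (fit_error_le hsx2 hs2 _ _ _ (x k j))).
  rewrite /joint_error lth subrr expr0n mul0r add0r le_eqVlt; apply/orP; left; apply/eqP.
  apply: eq_bigr => i _; rewrite ath beth hy.
  rewrite (_ : _ - _ - _ = Num.sqrt (s2 i j) * g k i j / Num.sqrt (N k i)%:R); last by rewrite /al /be; ring.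
  rewrite expr_div_n exprMn !sqr_sqrtr ?ler0n ?(ltW (hs2 i j))// /obs_prec.
  have Nk : (N k i)%:R != 0 :> R by rewrite pnatr_eq0 -lt0n.
  by field; rewrite Nk gt_eqF.
(* Subtracting [ln (lam k ord0 j)] makes every summand nonnegative on the side of the estimator, so
   that a bound on the sum bounds each one. *)
pose B k := \sum_(j < m) (ln (A' k j / n k) + \sum_i g k i j ^+ 2 - ln (lam k ord0 j)).
have [C BC] : exists C : R, forall k, `|B k| <= C.
  apply: (@tends_bounded _ _ (\sum_(j < m) (ln (\sum_i om i j * bt i ^+ 2) +
    \sum_i g' i j ^+ 2 - ln (om ord0 j)))).
  apply: tends_sum => j _; apply: tendsB; last first.
    by apply: tends_cont (lam_tends ord0 j); apply: continuous_ln; exact: om_gt0.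
  apply: tendsD.
    by apply: tends_cont (A't j); apply: continuous_ln; exact: lim_weight_gt0.
  by apply: tends_sum => i _; exact: tendsX2.
have lnn k z : 0 < z -> ln (z / n k) = ln z - ln (n k).
  by move=> z0; rewrite lnM ?posrE ?invr_gt0 ?n_gt0// lnV// posrE n_gt0.
(* The terms [ln (n k)] are the same on both sides of the comparison and cancel. *)
have sumB k : \sum_(j < m) (ln (A k j / n k) + fit k j - ln (lam k ord0 j)) <= B k.
  rewrite /B !sumrB lerD2r.
  have E (f h : 'I_m -> R) : (forall j, 0 < f j) ->
      \sum_(j < m) (ln (f j / n k) + h j) = \sum_(j < m) (ln (f j) + h j) - \sum_(j < m) ln (n k).
    by move=> f0; rewrite -sumrB; apply: eq_bigr => j _; rewrite lnn//; ring.
  rewrite !E; [|by move=> j; exact: post_prec_gt0|by move=> j; exact: A_gt0].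
  rewrite lerD2r; apply: (le_trans (mle_fit hsx2 hs2 (th' k) (ht k))).
  by apply: ler_sum => j _; rewrite lerD2l.
have lamA k j : ln (lam k ord0 j) <= ln (A k j / n k).
  rewrite ler_ln ?posrE ?lam_gt0 ?divr_gt0 ?A_gt0 ?n_gt0//.
  by have := lam_le_A k ord0 j; rewrite /bh beta_ord0 expr1n mulr1.
have fit0 k j : 0 <= fit k j.
  by apply: le_trans (fit_ge k ord0 j); rewrite mulr_ge0 ?sqr_ge0// ltW ?obs_prec_gt0.
exists C => k j.
have vC : ln (A k j / n k) + fit k j - ln (lam k ord0 j) <= C.
  apply: (le_trans _ (BC k)); apply: (le_trans _ (ler_norm _)); apply: (le_trans _ (sumB k)).
  rewrite [leRHS](bigD1 j)//= lerDl; apply: sumr_ge0 => l _.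
  by have := lamA k l; have := fit0 k l; lra.
split; first by have := lamA k j; lra.
have Apos : 0 < A k j / n k by rewrite divr_gt0 ?A_gt0 ?n_gt0.
rewrite -(lnK Apos) -(lnK (lam_gt0 k ord0 j)) -expRD ler_expR.
by have := fit0 k j; lra.
Qed.

(** The bounded quantity [A k j / n k] contains the squared slopes: [ln (post_prec)] acts as a
    penalty on them. *)
Lemma bh_bounded i : exists M : R, forall k, `|bh k i| <= M.
Proof.
have [C hC] := mle_bounds.
have [M hM] : exists M : R, forall k, `|lam k ord0 j0 / lam k i j0| <= M.
  apply: (@tends_bounded _ _ (om ord0 j0 / om i j0)).
  apply: tendsM; first exact: lam_tends.
  by apply: tendsV; [rewrite gt_eqF ?om_gt0|exact: lam_tends].
(* From [u ^+ 2 <= v] follows [u <= 1 + v], which avoids a square root. *)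
exists (1 + M * expR C) => k.
have b2 : bh k i ^+ 2 <= M * expR C.
  have [_ h2] := hC k j0; have h1 := le_trans (lam_le_A k i j0) h2.
  apply: (@le_trans _ _ (lam k ord0 j0 / lam k i j0 * expR C)); last first.
    by rewrite ler_wpM2r ?expR_ge0// (le_trans (ler_norm _) (hM k)).
  by rewrite mulrAC ler_pdivlMr ?lam_gt0// mulrC.
have e := real_normK (num_real (bh k i)).
have := sqr_ge0 (`|bh k i| - 1); have := normr_ge0 (bh k i); move: e b2.
by move: (`|bh k i|) (bh k i ^+ 2) (M * expR C) => u v w <-; nra.
Qed.

(** The squared residual times a precision that tends to infinity is bounded by the fit error. *)
Lemma res_tends i j : tends (fun k => res k i j) 0.
Proof.
have [C hC] := mle_bounds.
apply: tends0_sqr; apply: (@tends_squeeze0 _ _ (fun k => C * (obs_prec s2 (N k) i j)^-1)).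
  move=> k; rewrite ger0_norm ?sqr_ge0// ler_pdivlMr ?obs_prec_gt0// mulrC.
  by have [h1 _] := hC k j; exact: le_trans (fit_ge k i j) h1.
by rewrite -(mulr0 C); apply: tendsM; [exact: tends_cst|exact: obs_prec_inv_tends].
Qed.

Let eps k i j := Num.sqrt (s2 i j) * g k i j / Num.sqrt (N k i)%:R.

Lemma eps_tends i j : tends (fun k => eps k i j) 0.
Proof.
have sN : tends (fun k => (Num.sqrt (N k i)%:R)^-1 : R) 0.
  apply: tends0_sqr; apply: (tends_eq (hN i)) => // k.
  by rewrite exprVn sqr_sqrtr.
have := tendsM (tendsM (tends_cst (Num.sqrt (s2 i j))) (hg i j)) sN.
by rewrite mulr0.
Qed.

(** At the reference laboratory the residual is the realized level plus noise minus the fitted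
    level. *)
Lemma X_diff_tends j : tends (fun k => X k j - x k j) 0.
Proof.
have := tendsB (eps_tends ord0 j) (res_tends ord0 j).
rewrite subrr => tE; apply: (tends_eq tE) => // k.
rewrite /res hy /ah /bh !alpha_ord0 !beta_ord0 /eps; ring.
Qed.

Lemma X_tends j : tends (fun k => X k j) (x' j).
Proof.
rewrite -[x' j]add0r; apply: (tends_eq (tendsD (X_diff_tends j) (hx j))) => // k.
by rewrite subrK.
Qed.

(** This is noise minus residual minus [bh * (X - x)], and the product vanishes because the slopes
    are bounded. *)
Lemma mean_diff_tends i j :
  tends (fun k => (ah k i - al k i) + (bh k i - be k i) * x k j) 0.
Proof.
have [M hM] := bh_bounded i.
have := tendsB (tendsB (eps_tends i j) (res_tends i j)) (tends0_bounded hM (X_diff_tends j)).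
rewrite !subrr => tE; apply: (tends_eq tE) => // k.
rewrite /res hy /eps /al /be; ring.
Qed.

(** Subtracting the previous limits at [j0] and [j1] cancels the intercept and leaves the slope
    error times [x k j0 - x k j1]. *)
Lemma bh_diff_tends i : tends (fun k => bh k i - be k i) 0.
Proof.
have tx : tends (fun k => (x k j0 - x k j1)^-1) (x' j0 - x' j1)^-1.
  by apply: tendsV; [rewrite subr_eq0|exact: tendsB].
have := tendsM (tendsB (mean_diff_tends i j0) (mean_diff_tends i j1)) tx.
rewrite subrr mul0r; apply: tends_near.
have d0 : x' j0 - x' j1 != 0 by rewrite subr_eq0.
have := tends_near_neq0 d0 (tendsB (hx j0) (hx j1)); apply: filterS => k dk.
by field.
Qed.

Lemma bh_tends i : tends (fun k => bh k i) (bt i).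
Proof.
rewrite -[bt i]add0r; apply: (tends_eq (tendsD (bh_diff_tends i) (be_tends i))) => // k.
by rewrite subrK.
Qed.

Lemma ah_tends i : tends (fun k => ah k i) (alpha theta i).
Proof.
have := tendsD (tendsB (mean_diff_tends i j0) (tendsM (bh_diff_tends i) (hx j0))) (al_tends i).
rewrite mul0r subrr add0r => tE; apply: (tends_eq tE) => // k; ring.
Qed.

Lemma bias_mle_tends : mtends (fun k => bias (t k)) (bias theta).
Proof. by apply: bias_tends; [exact: ah_tends|exact: bh_tends]. Qed.

Lemma bias_th_tends : mtends (fun k => bias (th k)) (bias theta).
Proof. by apply: bias_tends; [exact: al_tends|exact: be_tends]. Qed.

Lemma A_n_tends j : tends (fun k => A k j / n k) (\sum_i om i j * bt i ^+ 2).
Proof.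
have := tendsD (tendsM (tends_cst (sx2 j)^-1) n_inv_tends)
  (tends_sum (index_enum 'I_q.+1) (P := xpredT) (fun i _ => tendsM (lam_tends i j) (tendsX2 (bh_tends i)))).
rewrite mulr0 add0r => tA.
by apply: (tends_eq tA) => // k; rewrite A_nE.
Qed.

Lemma A_n_inv_tends j : tends (fun k => (A k j / n k)^-1) (\sum_i om i j * bt i ^+ 2)^-1.
Proof. by apply: tendsV; [exact: lim_weight_neq0|exact: A_n_tends]. Qed.

(** * The linearized score equations for the biases *)

Let sn k := Num.sqrt (n k).

Lemma sn_gt0 k : 0 < sn k. Proof. by rewrite sqrtr_gt0 n_gt0. Qed.

Lemma sn_neq0 k : sn k != 0. Proof. by rewrite gt_eqF ?sn_gt0. Qed.

Let tau k : 'rV[R]_(q + q) := sn k *: (bias (t k) - bias (th k)).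
Let el c k i j := @ell R m q (x k j) c i.
Let elX c k i j := @ell R m q (X k j) c i.
Let G k i j := sn k * eps k i j.
Let zeta k j := sn k * (X k j - x k j).

(** An exact identity: pairing the bias error with the realized level, and the level error with the
    estimated slope, leaves no quadratic remainder. *)
Lemma scaled_res k i j :
  sn k * res k i j = G k i j - \sum_c tau k ord0 c * el c k i j - bh k i * zeta k j.
Proof.
have -> : \sum_c tau k ord0 c * el c k i j =
    sn k * ((ah k i - al k i) + x k j * (bh k i - be k i)).
  rewrite /ah /al /bh /be alphaB betaB mulr_sumr -big_split mulr_sumr /=.
  by apply: eq_bigr => c _; rewrite /tau /el /ell [X in X * _]mxE; ring.
by rewrite /G /zeta /res hy /eps /al /be; ring.
Qed.

Let om_k k j i := lam k i j.

(* The first-order condition in the level means eliminates the level estimates. *)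
Lemma scaled_resE k i j : sn k * res k i j =
  residual (om_k k j) (bh k) (fun i => G k i j) i -
  \sum_c tau k ord0 c * residual (om_k k j) (bh k) (fun i => el c k i j) i.
Proof.
pose F i := G k i j - \sum_c tau k ord0 c * el c k i j.
have FE i' : sn k * res k i' j = F i' - bh k i' * zeta k j by exact: scaled_res.
have W0 : \sum_l om_k k j l * bh k l ^+ 2 != 0.
  rewrite gt_eqF// (bigD1 ord0)//= {1}/bh beta_ord0 expr1n mulr1 ltr_wpDr ?lam_gt0//.
  by apply: sumr_ge0 => l _; rewrite mulr_ge0 ?sqr_ge0// ltW ?lam_gt0.
have foc : \sum_l om_k k j l * bh k l * (sn k * res k l j) = 0.
  transitivity (sn k / n k * \sum_i obs_prec s2 (N k) i j * bh k i * res k i j).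
    rewrite mulr_sumr; apply: eq_bigr => l _; rewrite /om_k /lam; ring.
  by rewrite (sum_resid_mle hsx2 hs2 j (ht k)) mulr0.
(* Hence the scaled level error is the regression coefficient, on the slopes, of what the bias error
   leaves unexplained. *)
have zE : (\sum_l om_k k j l * bh k l * F l) / \sum_l om_k k j l * bh k l ^+ 2 = zeta k j.
  apply: (canLR (mulfK W0)); apply/eqP; rewrite -subr_eq0; apply/eqP.
  transitivity (\sum_l om_k k j l * bh k l * (sn k * res k l j)); last exact: foc.
  by rewrite mulr_sumr -sumrB; apply: eq_bigr => l _; rewrite FE; ring.
rewrite FE -zE; transitivity (residual (om_k k j) (bh k) F i); first by [].
rewrite -residual_sum /residual /F.
pose S i := \sum_c tau k ord0 c * el c k i j.
have -> : \sum_l om_k k j l * bh k l * (G k l j - \sum_c tau k ord0 c * el c k l j) =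
    \sum_l om_k k j l * bh k l * G k l j - \sum_l om_k k j l * bh k l * S l.
  by rewrite -sumrB; apply: eq_bigr => l _; rewrite mulrBr.
rewrite -/(S i); move: (\sum_l om_k k j l * bh k l * S l) (S i) => a b.
by rewrite /S; ring.
Qed.

(** Not symmetric: one argument has the regressors at the realized level, the other those at the
    fitted level, as the score produces them. In [kap] stands the contribution of [ln (post_prec)]
    to the score, of order [1 / sqrt n]. *)
Let Jk k : 'M[R]_(q + q) := \matrix_(c', c) \sum_(j < m)
  bform (om_k k j) (bh k) (fun i => el c' k i j) (fun i => elX c k i j).
Let dk k : 'rV[R]_(q + q) := \row_c \sum_(j < m)
  bform (om_k k j) (bh k) (fun i => G k i j) (fun i => elX c k i j).
Let kap k : 'rV[R]_(q + q) := \row_c ((sn k)^-1 *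
  \sum_(j < m) (\sum_i lam k i j * bh k i * dbeta (bias_dir c : 'rV[R]_(m + (q + q))) i) / (A k j / n k)).

(** The vanishing score in a bias direction becomes linear in [tau] once [scaled_resE] is
    substituted for the residuals. *)
Lemma normal_equation k : tau k *m Jk k = dk k - kap k.
Proof.
apply/matrixP => z c; rewrite (ord1 z) !mxE {z}.
have sc := mle_score hsx2 hs2 (bias_dir c) (ht k); rewrite score_bias_dir in sc.
move: sc; rewrite sumrB => /eqP; rewrite subr_eq0 => /eqP sc.
have kE : (sn k)^-1 *
    \sum_(j < m) (\sum_i lam k i j * bh k i * dbeta (bias_dir c : 'rV[R]_(m + (q + q))) i) / (A k j / n k) =
   \sum_(j < m) \sum_i lam k i j * (sn k * res k i j) * elX c k i j.
  transitivity ((sn k)^-1 * \sum_(j < m) (\sum_i obs_prec s2 (N k) i j * res k i j * elX c k i j)).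
    congr (_ * _); rewrite {}sc; apply: eq_bigr => j _.
    have -> : P2 s2 (N k) (t k) (bias_dir c) j =
       n k * \sum_i lam k i j * bh k i * dbeta (bias_dir c : 'rV[R]_(m + (q + q))) i.
      by rewrite mulr_sumr; apply: eq_bigr => i _; rewrite obs_precE /bh; ring.
    have Aj : A k j != 0 by rewrite gt_eqF ?A_gt0.
    have := n_neq0 k; rewrite -/(A k j); move: Aj.
    by move: (A k j) (n k) (\sum_i _) => a b s a0 b0; field; rewrite a0 b0.
  rewrite mulr_sumr; apply: eq_bigr => j _; rewrite mulr_sumr; apply: eq_bigr => i _.
  rewrite obs_precE.
  have nE : n k = sn k ^+ 2 by rewrite sqr_sqrtr// ltW ?n_gt0.
  rewrite {1}nE; have := sn_neq0 k; move: (sn k) (lam k i j) => s l s0; field.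
  by [].
rewrite kE.
have E j : \sum_i lam k i j * (sn k * res k i j) * elX c k i j =
    bform (om_k k j) (bh k) (fun i => G k i j) (fun i => elX c k i j) -
    \sum_c' tau k ord0 c' * bform (om_k k j) (bh k) (fun i => el c' k i j) (fun i => elX c k i j).
  rewrite -sum_residual.
  under [X in _ = _ - X]eq_bigr do rewrite -sum_residual mulr_sumr.
  rewrite exchange_big /= -sumrB; apply: eq_bigr => i _.
  by rewrite scaled_resE mulrBr mulrBl mulr_sumr mulr_suml; congr (_ - _); apply: eq_bigr => c' _; rewrite /om_k; ring.
rewrite (eq_bigr _ (fun j _ => E j)).
rewrite -sumrB (eq_bigr _ (fun j _ => subKr _ _)) exchange_big /=; apply: eq_bigr => c' _.
by rewrite [Jk k c' c]mxE mulr_sumr.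
Qed.

Lemma elX_tends c i j : tends (fun k => elX c k i j) (@ell R m q (x' j) c i).
Proof.
by apply: tendsD; [exact: tends_cst|apply: tendsM; [exact: X_tends|exact: tends_cst]].
Qed.

Lemma el_tends c i j : tends (fun k => el c k i j) (@ell R m q (x' j) c i).
Proof.
by apply: tendsD; [exact: tends_cst|apply: tendsM; [exact: hx|exact: tends_cst]].
Qed.

(** The noise is scaled by the root of the total sample size, not of the cell size; the resulting
    factor [1 / sqrt (wt i)] joins the standard deviation to form the inverse root of the limiting
    precision. *)
Lemma G_tends i j : tends (fun k => G k i j) (g' i j / Num.sqrt (om i j)).
Proof.
have sw : tends (fun k => (Num.sqrt ((N k i)%:R / n k))^-1) (Num.sqrt (wt i))^-1.
  apply: tendsV; first by rewrite gt_eqF ?sqrtr_gt0.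
  by apply: tends_cont (hNwt i); exact: sqrt_continuous.
apply: (tends_eq (tendsM (tendsM (tends_cst (Num.sqrt (s2 i j))) (hg i j)) sw)) => [k|].
  rewrite /G /eps /sn sqrtrM ?ler0n// sqrtrV ?(ltW (n_gt0 k))//.
  have : Num.sqrt (N k i)%:R != 0 :> R by rewrite gt_eqF ?sqrtr_gt0 ?ltr0n.
  have := sn_neq0 k; rewrite /sn; move: (Num.sqrt (n k)) (Num.sqrt (N k i)%:R) => a b a0 b0.
  by field; rewrite a0 b0.
rewrite /om /lim_prec sqrtrM ?(ltW (hwt i))// sqrtrV ?(ltW (hs2 i j))//.
have : Num.sqrt (wt i) != 0 by rewrite gt_eqF ?sqrtr_gt0.
have : Num.sqrt (s2 i j) != 0 by rewrite gt_eqF ?sqrtr_gt0.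
move: (Num.sqrt (s2 i j)) (Num.sqrt (wt i)) => a b a0 b0.
by field; rewrite a0 b0.
Qed.

Lemma Jk_tends : mtends Jk (lim_info s2 wt theta x').
Proof.
move=> c' c; rewrite mxE; apply: (tends_eq (u := fun k => \sum_(j < m)
  bform (om_k k j) (bh k) (fun i => el c' k i j) (fun i => elX c k i j)) _ _ erefl); last first.
  by move=> k; rewrite mxE.
apply: tends_sum => j _; apply: bform_tends.
- exact: lim_weight_neq0.
- by move=> i; exact: lam_tends.
- exact: bh_tends.
- by move=> i; exact: el_tends.
- by move=> i; exact: elX_tends.
Qed.

Let gv : 'rV[R]_(q.+1 * m) := mxvec (\matrix_(i < q.+1, j < m) g' i j).

Lemma dk_tends : mtends dk (gv *m design s2 wt theta x').
Proof.
move=> z c; rewrite (ord1 z) design_score//.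
apply: (tends_eq (u := fun k => \sum_(j < m)
  bform (om_k k j) (bh k) (fun i => G k i j) (fun i => elX c k i j)) _ _ erefl); last first.
  by move=> k; rewrite mxE.
apply: tends_sum => j _; apply: bform_tends.
- exact: lim_weight_neq0.
- by move=> i; exact: lam_tends.
- exact: bh_tends.
- by move=> i; rewrite mxvecK mxE; exact: G_tends.
- by move=> i; exact: elX_tends.
Qed.

Lemma kap_tends : mtends kap 0.
Proof.
move=> z c; rewrite mxE (ord1 z).
pose L := \sum_(j < m) (\sum_i om i j * bt i * dbeta (bias_dir c : 'rV[R]_(m + (q + q))) i) / (\sum_i om i j * bt i ^+ 2).
rewrite -(mul0r L).
apply: (tends_eq (u := fun k => (sn k)^-1 * \sum_(j < m)
  (\sum_i lam k i j * bh k i * dbeta (bias_dir c : 'rV[R]_(m + (q + q))) i) / (A k j / n k)) _ _ erefl); last first.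
  by move=> k; rewrite mxE.
apply: tendsM; first exact: sqrt_n_inv_tends.
apply: tends_sum => j _; apply: tendsM; last exact: A_n_inv_tends.
apply: tends_sum => i _; apply: tendsM; last exact: tends_cst.
by apply: tendsM; [exact: lam_tends|exact: bh_tends].
Qed.

Let tau' := gv *m design s2 wt theta x' *m invmx (lim_info s2 wt theta x').

Lemma tau_tends : mtends tau tau'.
Proof.
have uJ : lim_info s2 wt theta x' \in unitmx by exact: lim_info_unit x01.
have td : mtends (fun k => dk k - kap k) (gv *m design s2 wt theta x').
  move=> z c; apply: (tends_eq (tendsB (dk_tends z c) (kap_tends z c))) => [k|].
    by rewrite !mxE.
  by rewrite [(0 : 'rV[R]_(q + q)) z c]mxE subr0.
have tm := mtends_mul td (mtends_inv uJ Jk_tends).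
move=> z c; apply: (tends_near _ (tm z c)).
have := mtends_unit uJ Jk_tends; apply: filterS => k uk.
by rewrite -normal_equation mulmxK.
Qed.

(** The residuals disappear from [E] in the limit, which is minus the weighted product of slopes and
    regressors; the two leading terms then form [bform], while the bracket multiplied by [1 / n]
    vanishes. *)
Lemma bias_info_tends : mtends (fun k => (n k)^-1 *: bias_info sx2 s2 (@y k) (t k))
  (lim_info s2 wt theta x').
Proof.
move=> a b; rewrite mxE.
pose P c k j := \sum_i lam k i j * bh k i * dbeta (bias_dir c : 'rV[R]_(m + (q + q))) i.
pose P' c j := \sum_i om i j * bt i * dbeta (bias_dir c : 'rV[R]_(m + (q + q))) i.
pose Q k j := \sum_i lam k i j * dbeta (bias_dir a : 'rV[R]_(m + (q + q))) i * dbeta (bias_dir b : 'rV[R]_(m + (q + q))) i.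
pose Q' j := \sum_i om i j * dbeta (bias_dir a : 'rV[R]_(m + (q + q))) i * dbeta (bias_dir b : 'rV[R]_(m + (q + q))) i.
pose E c k j := \sum_i lam k i j * (res k i j * dbeta (bias_dir c : 'rV[R]_(m + (q + q))) i - bh k i * elX c k i j).
have PE c k j : P2 s2 (N k) (t k) (bias_dir c) j = n k * P c k j.
  by rewrite /P mulr_sumr; apply: eq_bigr => i _; rewrite obs_precE /bh; ring.
have QE k j : Pbb s2 (N k) (bias_dir a) (bias_dir b) j = n k * Q k j.
  by rewrite /Q mulr_sumr; apply: eq_bigr => i _; rewrite obs_precE; ring.
have EE c k j : Edir sx2 s2 (@y k) (t k) c j = n k * E c k j.
  rewrite /Edir /E /P1 /P2 !mulr_sumr -sumrB; apply: eq_bigr => i _.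
  by rewrite obs_precE /res /bh /ah /elX /ell /X; ring.
apply: (tends_eq (u := fun k => \sum_(j < m) (\sum_i lam k i j * elX a k i j * elX b k i j
   - E a k j * E b k j * (A k j / n k)^-1
   + (n k)^-1 * (Q k j * (A k j / n k)^-1 - 2 * P a k j * P b k j * (A k j / n k)^-1 ^+ 2))) _ _ erefl); last first.
  move=> k; rewrite mxE bias_infoE// mulr_sumr; apply: eq_bigr => j _.
  rewrite !EE QE !PE -/(A k j).
  have -> : \sum_i obs_prec s2 (N k) i j * @ell R m q (post_mean sx2 s2 (@y k) (t k) j) a i *
      @ell R m q (post_mean sx2 s2 (@y k) (t k) j) b i = n k * \sum_i lam k i j * elX a k i j * elX b k i j.
    by rewrite mulr_sumr; apply: eq_bigr => i _; rewrite obs_precE /elX /X; ring.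
  have Aj : A k j != 0 by rewrite gt_eqF ?A_gt0.
  have := n_neq0 k; move: Aj (\sum_i _) (E a k j) (E b k j) (P a k j) (P b k j) (Q k j).
  move: (A k j) (n k) => u v u0 s e1 e2 p1 p2 q1 v0; field.
  by rewrite u0 v0.
apply: tends_sum => j _; rewrite /bform.
have tP c : tends (fun k => P c k j) (P' c j).
  apply: tends_sum => i _; apply: tendsM; last exact: tends_cst.
  by apply: tendsM; [exact: lam_tends|exact: bh_tends].
have tE c : tends (fun k => E c k j) (- \sum_i om i j * bt i * @ell R m q (x' j) c i).
  rewrite -sumrN; apply: tends_sum => i _.
  apply: (tends_eq (tendsM (lam_tends i j) (tendsB (tendsM (res_tends i j)
    (tends_cst (dbeta (bias_dir c : 'rV[R]_(m + (q + q))) i))) (tendsM (bh_tends i) (elX_tends c i j))))) => //.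
  by rewrite mul0r sub0r; ring.
have tQ : tends (fun k => Q k j) (Q' j).
  apply: tends_sum => i _; apply: tendsM; last exact: tends_cst.
  by apply: tendsM; [exact: lam_tends|exact: tends_cst].
have tA := A_n_inv_tends j.
apply: (tends_eq (tendsD (tendsB (tends_sum (index_enum 'I_q.+1) (P := xpredT)
     (fun i _ => tendsM (tendsM (lam_tends i j) (elX_tends a i j)) (elX_tends b i j)))
   (tendsM (tendsM (tE a) (tE b)) tA))
   (tendsM n_inv_tends (tendsB (tendsM tQ tA) (tendsM (tendsM (tendsM (tends_cst 2) (tP a)) (tP b)) (tendsX2 tA)))))) => //.
by rewrite mul0r addr0 mulrNN.
Qed.

Theorem wald_tends r (h : 'rV[R]_(q + q) -> 'rV[R]_r) :
  (forall v, differentiable h v) -> continuous (jacobian h) ->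
  (forall v, \rank (jacobian h v) = r) ->
  tends (fun k => wald sx2 s2 h (@y k) (t k) (bias (th k)))
    (wald_form (jacobian h (bias theta)) (lim_info s2 wt theta x') (tau' *m jacobian h (bias theta))).
Proof.
move=> dh ch rh.
have uJ : lim_info s2 wt theta x' \in unitmx by exact: lim_info_unit x01.
set H := jacobian h (bias theta).
have tH : mtends (fun k => jacobian h (bias (t k))) H.
  apply/mtendsP; apply: (cvg_comp _ _ ((mtendsP _ _).2 bias_mle_tends)); exact: ch.
have uV : H^T *m invmx (lim_info s2 wt theta x') *m H \in unitmx.
  have [<- Binj] := profiled_gram (design_gram hs2 hwt theta x')
    (design_inj hs2 hwt (theta := theta) x01) (rh (bias theta)).
  exact: gram_unitmx.
have td := mtends_C1 dh ch bias_mle_tends bias_th_tends tau_tends.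
apply: (tends_near _ (wald_form_tends tH bias_info_tends td uJ uV)).
apply: nearW => k; rewrite -wald_form_scale ?n_gt0//.
by rewrite scalerA mulfV ?n_neq0// scale1r.
Qed.

End asymptotics.

(** * Measurability of the Wald statistic *)

Section measurable_functions.
Context {R : realType} d (T : measurableType d).
Local Notation meas f := (measurable_fun [set: T] f).

(** Inversion is continuous off 0, so the line is split at this one point. *)
Lemma measurable_funV (f : T -> R) : meas f -> meas (fun w => (f w)^-1).
Proof.
move=> mf; apply: (measurableT_comp (f := (@GRing.inv R))) => //.
rewrite -(setUv [set (0 : R)]) setUC => /=.
apply/(measurable_funU _ (measurableC (measurable_set1 0)) (measurable_set1 0)).
split; last exact: measurable_fun_set1.
apply: open_continuous_measurable_fun => [|x].
  by apply: closed_openC; exact: closed_eq.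
by rewrite inE => /eqP x0; exact: inv_continuous.
Qed.

Lemma measurable_det n (M : T -> 'M[R]_n) : meas M -> meas (fun w => \det (M w)).
Proof.
move=> mM; apply: measurable_sum => s; apply: measurable_funM => //.
by apply: measurable_prod => i _; exact: measurable_coordP.
Qed.

Lemma measurable_unitmx n (M : T -> 'M[R]_n) : meas M -> meas (fun w => M w \in unitmx).
Proof.
move=> mM; rewrite (_ : (fun w => _) = (fun w => ~~ (\det (M w) == 0))).
  apply: measurable_neg; apply: measurable_fun_eqr => //; exact: measurable_det.
by apply/funext => w; rewrite unitmxE unitfE.
Qed.

Lemma measurable_invmx n (M : T -> 'M[R]_n) : meas M -> meas (fun w => invmx (M w)).
Proof.
move=> mM; apply: measurable_mxP => i j.
rewrite (_ : (fun w => _) = (fun w => if M w \in unitmx then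
   (\det (M w))^-1 * ((-1) ^+ (j + i) * \det (row' j (col' i (M w)))) else M w i j)).
  apply: measurable_fun_ifT; first exact: measurable_unitmx.
  - apply: measurable_funM; first exact/measurable_funV/measurable_det.
    apply: measurable_funM => //; apply: measurable_det; apply: measurable_mxP => a b.
    rewrite (_ : (fun w => _) = (fun w => M w (lift j a) (lift i b))).
      exact: measurable_coordP.
    by apply/funext => w; rewrite !mxE.
  - exact: measurable_coordP.
by apply/funext => w; rewrite /invmx; case: ifP => // _; rewrite !mxE.
Qed.

Lemma measurable_wald_form q r (H : T -> 'M[R]_(q, r)) (J : T -> 'M[R]_q) (u : T -> 'rV[R]_r) :
  meas H -> meas J -> meas u -> meas (fun w => wald_form (H w) (J w) (u w)).
Proof.
move=> mH mJ mu.
have mV : meas (fun w => (H w)^T *m invmx (J w) *m H w).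
  apply: measurable_mulmx => //; apply: measurable_mulmx; first exact: measurable_trmx.
  exact: measurable_invmx.
apply: measurable_fun_ifT => //.
  by apply: measurable_and; exact: measurable_unitmx.
apply: measurable_coordP; apply: measurable_mulmx; last exact: measurable_trmx.
by apply: measurable_mulmx => //; exact: measurable_invmx.
Qed.

End measurable_functions.

Lemma continuous_measurable_mx (R : realType) a b c e (f : 'M[R]_(a, b) -> 'M[R]_(c, e)) :
  continuous f -> measurable_fun setT f.
Proof.
move=> cf; apply: measurable_mxP => i j.
apply: (measurability _ (RGenOInfty.measurableE R)) => // _ [_ [x ->] <-].
rewrite setTI; apply: open_measurable_mx; apply: open_comp; last exact: interval_open.
move=> M _; apply: (continuous_comp (f := f) (g := fun M => M i j)); first exact: cf.
exact: coord_continuous.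
Qed.

Section measurable_wald.
Context {R : realType} {m q : nat} d (T : measurableType d).
Variables (sx2 : 'I_m -> R) (s2 : 'I_q.+1 -> 'I_m -> R) (N : 'I_q.+1 -> nat).
Hypotheses (hsx2 : forall j, 0 < sx2 j) (hs2 : forall i j, 0 < s2 i j).
Local Notation meas f := (measurable_fun [set: T] f).
Variables (y : T -> data R m N) (t : T -> 'rV[R]_(m + (q + q))).
Hypothesis my : forall i j (k : 'I_(N i)), meas (fun w => @y w i j k).
Hypothesis mt : meas t.

Lemma measurable_bias : meas (fun w => bias (t w)).
Proof.
apply: measurable_mxP => i c.
rewrite (_ : (fun w => _) = (fun w => t w i (rshift m c))); first exact: measurable_coordP.
by apply/funext => w; rewrite mxE.
Qed.

Lemma measurable_level_mean j : meas (fun w => level_mean (t w) j).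
Proof.
rewrite (_ : (fun w => _) = (fun w => t w ord0 (lshift (q + q) j))); first exact: measurable_coordP.
by apply/funext => w; rewrite /level_mean mxE.
Qed.

Lemma measurable_alpha i : meas (fun w => alpha (t w) i).
Proof.
rewrite /alpha; case: unliftP => [a _|_]; last exact: measurable_cst.
rewrite (_ : (fun w => _) = (fun w => bias (t w) ord0 (lshift q a))).
  by apply: measurable_coordP; exact: measurable_bias.
by apply/funext => w; rewrite mxE.
Qed.

Lemma measurable_beta i : meas (fun w => beta (t w) i).
Proof.
rewrite /beta; case: unliftP => [a _|_]; last exact: measurable_cst.
rewrite (_ : (fun w => _) = (fun w => bias (t w) ord0 (rshift q a))).
  by apply: measurable_coordP; exact: measurable_bias.
by apply/funext => w; rewrite mxE.
Qed.

Lemma measurable_obs_mean i j : meas (fun w => obs_mean (y w) i j).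
Proof. by apply: measurable_funM => //; apply: measurable_sum => k; exact: my. Qed.

Lemma measurable_post_prec j : meas (fun w => post_prec sx2 s2 N (t w) j).
Proof.
apply: measurable_funD => //; apply: measurable_sum => i; apply: measurable_funM => //.
by apply: measurable_funX; exact: measurable_beta.
Qed.

Lemma measurable_post_mean j : meas (fun w => post_mean sx2 s2 (y w) (t w) j).
Proof.
apply: measurable_funM; last by apply: measurable_funV; exact: measurable_post_prec.
apply: measurable_funD; first by apply: measurable_funM => //; exact: measurable_level_mean.
apply: measurable_sum => i; apply: measurable_funM.
  by apply: measurable_funM => //; exact: measurable_beta.
by apply: measurable_funB; [exact: measurable_obs_mean|exact: measurable_alpha].
Qed.

Lemma measurable_P2 u j : meas (fun w => P2 s2 N (t w) u j).
Proof.
apply: measurable_sum => i; apply: measurable_funM => //.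
by apply: measurable_funM => //; exact: measurable_beta.
Qed.

Lemma measurable_Edir c j : meas (fun w => Edir sx2 s2 (y w) (t w) c j).
Proof.
apply: measurable_funB.
  apply: measurable_sum => i; apply: measurable_funM => //; apply: measurable_funB.
    apply: measurable_funM => //.
    by apply: measurable_funB; [exact: measurable_obs_mean|exact: measurable_alpha].
  by apply: measurable_funM => //; exact: measurable_beta.
apply: measurable_funM; last exact: measurable_P2.
by apply: measurable_funM => //; exact: measurable_post_mean.
Qed.

(** The closed form [bias_infoE] replaces the second derivatives by rational expressions in the data
    and the estimate. *)
Lemma measurable_bias_info : meas (fun w => bias_info sx2 s2 (y w) (t w)).
Proof.
apply: measurable_mxP => a b; under eq_fun do rewrite bias_infoE//.
have mV j : meas (fun w => (post_prec sx2 s2 N (t w) j)^-1).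
  by apply: measurable_funV; exact: measurable_post_prec.
have mell c i j : meas (fun w => @ell R m q (post_mean sx2 s2 (y w) (t w) j) c i).
  by apply: measurable_funD => //; apply: measurable_funM => //; exact: measurable_post_mean.
apply: measurable_sum => j; apply: measurable_funB; last first.
  apply: measurable_funM.
    by apply: measurable_funM; [apply: measurable_funM => //|]; exact: measurable_P2.
  apply: measurable_funV; apply: measurable_funX; exact: measurable_post_prec.
apply: measurable_funD; last exact: measurable_funM.
apply: measurable_funB.
  by apply: measurable_sum => i; apply: measurable_funM => //; apply: measurable_funM.
by apply: measurable_funM => //; apply: measurable_funM; exact: measurable_Edir.
Qed.

Lemma measurable_wald r (h : 'rV[R]_(q + q) -> 'rV[R]_r) (b0 : 'rV[R]_(q + q)) :
  (forall v, differentiable h v) -> continuous (jacobian h) ->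
  meas (fun w => wald sx2 s2 h (y w) (t w) b0).
Proof.
move=> dh ch.
apply: (measurable_wald_form (H := fun w => jacobian h (bias (t w)))
  (J := fun w => bias_info sx2 s2 (y w) (t w)) (u := fun w => h (bias (t w)) - h b0)).
- exact: (measurableT_comp (continuous_measurable_mx ch) measurable_bias).
- exact: measurable_bias_info.
- apply: measurable_mxP => i j.
  rewrite (_ : (fun w => _) = (fun w => h (bias (t w)) i j - h b0 i j)).
    apply: measurable_funB => //; apply: measurable_coordP.
    apply: measurableT_comp; last exact: measurable_bias.
    by apply: continuous_measurable_mx => v; exact: differentiable_continuous.
  by apply/funext => w; rewrite !mxE.
Qed.

End measurable_wald.

(** * Convergence in distribution *)

Section bounded_integrals.
Context {R : realType}.

Lemma eq_law_Rintegral d (T : measurableType d) (P : probability T R)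
    d' (T' : measurableType d') (P' : probability T' R) (X : T -> R) (Y : T' -> R) (f : R -> R) :
  measurable_fun setT f ->
  (forall F : R -> \bar R, measurable_fun setT F -> (forall s, 0 <= F s)%E ->
    (\int[P]_w F (X w) = \int[P']_w F (Y w))%E) ->
  \int[P]_w f (X w) = \int[P']_w f (Y w).
Proof.
move=> mf XY; rewrite /Rintegral; congr fine; rewrite integralE [RHS]integralE.
have mF : measurable_fun setT (EFin \o f) by exact/measurable_EFinP.
congr (_ - _)%E.
  rewrite (funepos_comp (EFin \o f) X) (funepos_comp (EFin \o f) Y).
  exact: (XY _ (measurable_funepos mF) (fun s => funepos_ge0 _ s)).
rewrite (funeneg_comp (EFin \o f) X) (funeneg_comp (EFin \o f) Y).
exact: (XY _ (measurable_funeneg mF) (fun s => funeneg_ge0 _ s)).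
Qed.

Lemma bounded_integrable d (T : measurableType d) (P : probability T R) (f : T -> R) (M : R) :
  measurable_fun setT f -> (forall w, `|f w| <= M) -> P.-integrable setT (EFin \o f).
Proof.
move=> mf fM; apply: measurable_bounded_integrable => //.
  by apply: le_lt_trans (ltry 1); rewrite probability_le1.
by exists M; split=> [|K MK w _]; [exact: num_real|exact: le_trans (fM w) (ltW MK)].
Qed.

(** Off [B] the integrands are within [e], and on [B] they differ by at most [M + M]. *)
Lemma Rintegral_close d (T : measurableType d) (P : probability T R) (f g : T -> R)
    (B : set T) (M e : R) : measurable_fun setT f -> measurable_fun setT g -> measurable B ->
  (forall w, `|f w| <= M) -> (forall w, `|g w| <= M) -> 0 <= e ->
  (forall w, ~ B w -> `|f w - g w| <= e) ->
  `|\int[P]_w f w - \int[P]_w g w| <= e + (M + M) * fine (P B).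
Proof.
move=> mf mg mB fM gM e0 fg.
have iF : P.-integrable setT (EFin \o f) by exact: bounded_integrable fM.
have iG : P.-integrable setT (EFin \o g) by exact: bounded_integrable gM.
have mI : measurable_fun setT (\1_B : T -> R) by exact: measurable_indic.
have iI : P.-integrable setT (EFin \o (\1_B : T -> R)).
  by apply: (@bounded_integrable _ _ _ _ 1) => // w; rewrite indicE; case: (_ \in _); rewrite ?normr1 ?normr0.
have M0 : 0 <= M + M by have := le_trans (normr_ge0 _) (fM point); move=> ?; exact: addr_ge0.
rewrite -RintegralB//.
apply: le_trans (le_normr_Rintegral _ _) _ => //.
  by apply: (@bounded_integrable _ _ _ _ (M + M)) => [|w]; [exact: measurable_funB|exact: le_trans (ler_normB _ _) (lerD (fM w) (gM w))].
pose k (w : T) : R := e + (M + M) * \1_B w.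
have mk : measurable_fun setT k by apply: measurable_funD => //; exact: measurable_funM.
have kE : \int[P]_w k w = e + (M + M) * fine (P B).
  rewrite RintegralD//; last 2 first.
  - by apply: (@bounded_integrable _ _ _ _ e) => // w; rewrite ger0_norm.
  - apply: (@bounded_integrable _ _ _ _ (M + M)) => [|w]; first exact: measurable_funM.
    by rewrite indicE; case: (_ \in _); rewrite ?mulr1 ?mulr0 ?normr0 ?ger0_norm.
  rewrite Rintegral_cst//; move: (probability_setT P) => /= ->; rewrite mulr1 RintegralZl//; congr (_ + _ * _).
  by rewrite /Rintegral integral_indic// setIT.
rewrite -kE; apply: le_Rintegral => //.
- apply: (@bounded_integrable _ _ _ _ (M + M)) => [|w].
    by apply: measurableT_comp => //; exact: measurable_funB.
  by rewrite normr_id; exact: le_trans (ler_normB _ _) (lerD (fM w) (gM w)).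
- apply: (@bounded_integrable _ _ _ _ (e + (M + M))) => // w.
  rewrite /k indicE ger0_norm; last by rewrite addr_ge0// mulr_ge0// ler0n.
  by rewrite lerD2l; case: (_ \in _); rewrite ?mulr1 ?mulr0.
move=> w _; rewrite /k indicE; have [Bw|Bw] := boolP (w \in B).
  rewrite mulr1; apply: le_trans (ler_normB _ _) _.
  by apply: le_trans (lerD (fM w) (gM w)) _; rewrite lerDr.
by rewrite mulr0 addr0; apply: fg; move: Bw; rewrite notin_setE.
Qed.

End bounded_integrals.

(* An extended continuous mapping theorem: [W nu] is, up to nuisance coordinates of [T nu],
   a function of a variable [U nu] with a fixed law [G], and converges along every
   sequence of outcomes for which [U] converges to a point of [S]. *)
Section continuous_mapping.
Context {R : realType} {n : nat}.
Variables (G : probability 'rV[R]_n R) (Q : 'rV[R]_n -> R) (S : set 'rV[R]_n).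
Hypotheses (mQ : measurable_fun setT Q) (mS : measurable S) (GS : G (~` S) = 0).
Hypothesis cQ : forall u v, S v -> mtends u v -> tends (Q \o u) (Q v).
Variables (d : nat -> measure_display) (T : forall nu, measurableType (d nu))
  (P : forall nu, probability (T nu) R) (U : forall nu, T nu -> 'rV[R]_n)
  (W : forall nu, T nu -> R).
Arguments U : clear implicits.
Arguments W : clear implicits.
Hypotheses (mU : forall nu, measurable_fun setT (U nu)) (mW : forall nu, measurable_fun setT (W nu)).
Hypothesis UG : forall nu (F : 'rV[R]_n -> \bar R), measurable_fun setT F ->
  (forall v, 0 <= F v)%E -> (\int[P nu]_w F (U nu w) = \int[G]_v F v)%E.
Hypothesis UW : forall (p : nat -> nat) (w : forall k, T (p k)) v, (forall k, (k <= p k)%N) ->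
  S v -> mtends (fun k => U (p k) (w k)) v -> tends (fun k => W (p k) (w k)) (Q v).

Lemma continuous_mapping (f : R -> R) : continuous f -> (exists M, forall s, `|f s| <= M) ->
  \int[P nu]_w f (W nu w) @[nu --> \oo] --> \int[G]_v f (Q v).
Proof.
move=> cf [M fM].
have mf : measurable_fun setT f by exact: continuous_measurable_fun.
have M0 : 0 <= M by exact: le_trans (normr_ge0 _) (fM 0).
have intU nu : \int[G]_v f (Q v) = \int[P nu]_w f (Q (U nu w)).
  apply/esym/eq_law_Rintegral => // F mF F0.
  have mFQ := measurableT_comp mF mQ.
  by have := UG nu mFQ; apply => v; exact: F0.
apply/cvgrPdist_le => e e0.
(* These are the values [v] of [U] at which all statistics from index [k] on are within [e / 2] of
   the limit after applying [f]; taking interiors makes the sets open, hence measurable. *)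
pose A k := [set v | forall nu, (k <= nu)%N -> forall w, U nu w = v ->
  `|f (W nu w) - f (Q v)| <= e / 2].
pose C k : set 'rV[R]_n := (A k)°.
have oC k : open (C k) by exact: open_interior.
have mC k : measurable (C k) by exact: open_measurable_mx.
have ndC : nondecreasing_seq C.
  move=> k l kl; apply/subsetPset; apply: interiorS => v Av nu lnu w Uw.
  by apply: Av => //; exact: leq_trans lnu.
have SC : S `<=` \bigcup_k C k.
  move=> v Sv; apply: contrapT => nC.
  (* Otherwise outcomes as close to [v] as desired violate the bound. Their indices are only known
     to satisfy [k <= p k], which is why [UW] does not ask for increasing sequences. *)
  have H k : exists p : {nu & T nu}, (k <= projT1 p)%N /\
      (forall i j, `|U (projT1 p) (projT2 p) i j - v i j| < k.+1%:R^-1) /\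
      e / 2 < `|f (W (projT1 p) (projT2 p)) - f (Q (U (projT1 p) (projT2 p)))|.
    apply: contrapT => nH; apply: nC; exists k => //.
    rewrite /C /interior /=; exists (fun i j => ball (v i j) k.+1%:R^-1).
      by move=> i j; apply: nbhsx_ballx; rewrite invr_gt0.
    move=> u uv nu knu w Uw; rewrite leNgt; apply/negP => elt.
    apply: nH; exists (existT _ nu w) => /=; split=> //; split; last by rewrite Uw.
    by move=> i j; have := uv i j; rewrite /ball /= Uw distrC.
  have [p pP] := choice H.
  have tU : mtends (fun k => U (projT1 (p k)) (projT2 (p k))) v.
    move=> i j; apply: (tends_eq (u := fun k => (U (projT1 (p k)) (projT2 (p k)) i j - v i j) + v i j)
       (a := 0 + v i j)) => [|k|]; [|by rewrite subrK|by rewrite add0r].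
    apply: tendsD; last exact: tends_cst.
    apply: (@tends_squeeze0 _ _ (fun k => k.+1%:R^-1)).
      by move=> k; apply: ltW; exact: (pP k).2.1.
    by split; exact: cvg_harmonic.
  have tW := UW (fun k => (pP k).1) Sv tU.
  have tQ := cQ Sv tU.
  have [tf] := tendsB (tends_cont (cf (Q v)) tW) (tends_cont (cf (Q v)) tQ).
  rewrite subrr in tf.
  have /cvgrPdist_lt/(_ (e / 2)) := tf; rewrite divr_gt0// => /(_ isT) [k _ /(_ k (leqnn k))] /=.
  by rewrite sub0r normrN; apply/negP; rewrite -leNgt; apply: ltW; exact: (pP k).2.2.
(* The open sets increase to a set containing [S], which has full measure. *)
have GC : fine (G (~` C k)) @[k --> \oo] --> (0 : R).
  have GC1 : G (\bigcup_k C k) = 1%E.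
    apply/eqP; rewrite eq_le probability_le1; last by exact: bigcupT_measurable.
    rewrite -(probability_setT G) -(setvU S) /=.
    apply: le_trans (measureU2 _ _ _) _ => //; first exact: measurableC.
    rewrite [X in (X + _)%E](_ : _ = 0%E); last exact: GS.
    rewrite add0e; apply: le_measure SC; rewrite inE//; exact: bigcupT_measurable.
  have := @nondecreasing_cvg_mu _ _ _ G C mC (bigcupT_measurable C mC) ndC.
  rewrite [X in _ --> X -> _](_ : _ = 1%E); last exact: GC1.
  move=> /fine_cvgP[_ c1].
  rewrite (_ : (fun k => _) = (fun k => 1 - fine (G (C k)))).
    by rewrite -(subrr 1); apply: cvgB => //; exact: cvg_cst.
  apply/funext => k; rewrite probability_setC// fineB ?fin_num_measure//.
have [k0 _ k0P] : \forall k \near \oo, (M + M) * fine (G (~` C k)) <= e / 2.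
  have : (M + M) * fine (G (~` C k)) @[k --> \oo] --> (0 : R).
    by rewrite -(mulr0 (M + M)); apply: cvgM => //; exact: cvg_cst.
  move=> /cvgrPdist_le/(_ (e / 2)); rewrite divr_gt0// => /(_ isT).
  by apply: filterS => k; rewrite sub0r normrN; apply: le_trans; exact: ler_norm.
exists k0 => // nu /= knu; rewrite (intU nu) distrC.
(* The exceptional event depends on [U nu] only, so its probability is that of a fixed set under
   [G], whatever [nu] is. *)
have PE : P nu (U nu @^-1` (~` C k0)) = G (~` C k0).
  have mD : measurable (~` C k0) by exact: measurableC.
  have mF : measurable_fun setT (fun v => (\1_(~` C k0) v)%:E : \bar R).
    by apply/measurable_EFinP; exact: measurable_indic.
  have := UG nu mF (fun v => ltac:(by rewrite lee_fin)).
  have mUD : measurable (U nu @^-1` (~` C k0)).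
    by rewrite -[X in measurable X]setTI; exact: mU.
  have indE d1 (T1 : measurableType d1) (P1 : probability T1 R) (B : set T1) : measurable B ->
      (\int[P1]_w (\1_B w)%:E = P1 B)%E by move=> mB; rewrite integral_indic// setIT.
  by move=> E; rewrite -(indE _ _ _ _ mUD) -(indE _ _ _ _ mD); exact: E.
have mUD : measurable (U nu @^-1` (~` C k0)).
  by rewrite -[X in measurable X]setTI; apply: mU => //; exact: measurableC.
have mfW : measurable_fun setT (fun w => f (W nu w)) by exact: measurableT_comp.
have mfQ : measurable_fun setT (fun w => f (Q (U nu w))).
  by apply: (measurableT_comp mf); exact: measurableT_comp.
have e20 : 0 <= e / 2 by rewrite divr_ge0// ltW.
have close w : ~ (U nu @^-1` (~` C k0)) w -> `|f (W nu w) - f (Q (U nu w))| <= e / 2.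
  by move=> /contrapT/interior_subset Aw; exact: Aw.
have := Rintegral_close (P nu) mfW mfQ mUD (fun w => fM (W nu w)) (fun w => fM (Q (U nu w))) e20 close.
move=> /le_trans; apply.
by rewrite [X in fine X](_ : _ = G (~` C k0))// [leRHS](splitr e) lerD2l; exact: k0P (leqnn k0).
Qed.

End continuous_mapping.

(** * The limiting statistic and its law *)

Section limit_law.
Context {R : realType} {m q r : nat}.
Variables (sx2 : 'I_m -> R) (s2 : 'I_q.+1 -> 'I_m -> R) (wt : 'I_q.+1 -> R).
Hypotheses (hsx2 : forall j, 0 < sx2 j) (hs2 : forall i j, 0 < s2 i j) (hwt : forall i, 0 < wt i).
Variables (theta : 'rV[R]_(m + (q + q))) (H : 'M[R]_(q + q, r)).
Hypothesis rH : \rank H = r.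

Definition lim_level (u : 'rV[R]_m) j : R := level_mean theta j + Num.sqrt (sx2 j) * u ord0 j.

Definition lim_wald (v : 'rV[R]_(m + q.+1 * m)) : R :=
  let x := lim_level (lsubmx v) in
  wald_form H (lim_info s2 wt theta x)
    (rsubmx v *m design s2 wt theta x *m invmx (lim_info s2 wt theta x) *m H).

(** The regressors are affine in the level and taking residuals is linear; continuity and
    measurability of the design follow. *)
Lemma design_affine : exists C D : 'I_q.+1 -> 'I_m -> 'I_(q + q) -> R, forall x i j c,
  design s2 wt theta x (mxvec_index i j) c = C i j c + x j * D i j c.
Proof.
pose res j f i := residual (fun i => lim_prec s2 wt i j) (beta theta) f i.
exists (fun i j c => Num.sqrt (lim_prec s2 wt i j) * res j (alpha (bias_dir c : 'rV[R]_(m + (q + q)))) i).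
exists (fun i j c => Num.sqrt (lim_prec s2 wt i j) * res j (dbeta (bias_dir c : 'rV[R]_(m + (q + q)))) i).
move=> x i j c; rewrite mxE mxvecE mxE /res /residual /ell.
have -> : \sum_l lim_prec s2 wt l j * beta theta l * (alpha (bias_dir c : 'rV[R]_(m + (q + q))) l +
      x j * dbeta (bias_dir c : 'rV[R]_(m + (q + q))) l) =
    \sum_l lim_prec s2 wt l j * beta theta l * alpha (bias_dir c : 'rV[R]_(m + (q + q))) l +
    x j * \sum_l lim_prec s2 wt l j * beta theta l * dbeta (bias_dir c : 'rV[R]_(m + (q + q))) l.
  by rewrite mulr_sumr -big_split; apply: eq_bigr => l _ /=; ring.
by ring.
Qed.

Lemma design_tends (x : nat -> 'I_m -> R) x' : (forall j, tends (x ^~ j) (x' j)) ->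
  mtends (fun k => design s2 wt theta (x k)) (design s2 wt theta x').
Proof.
have [C [D CD]] := design_affine => tx k c; case/mxvec_indexP: k => i j; rewrite CD.
apply: (tends_eq (u := fun k => C i j c + x k j * D i j c) _ _ erefl) => [|k]; last by rewrite CD.
by apply: tendsD; [exact: tends_cst|apply: tendsM => //; exact: tends_cst].
Qed.

Lemma measurable_design d (T : measurableType d) (x : T -> 'I_m -> R) :
  (forall j, measurable_fun setT (x ^~ j)) ->
  measurable_fun setT (fun w => design s2 wt theta (x w)).
Proof.
have [C [D CD]] := design_affine => mx; apply: measurable_mxP => k c.
case/mxvec_indexP: k => i j; under eq_fun do rewrite CD.
by apply: measurable_funD => //; apply: measurable_funM.
Qed.

Lemma lim_info_tends (x : nat -> 'I_m -> R) x' : (forall j, tends (x ^~ j) (x' j)) ->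
  mtends (fun k => lim_info s2 wt theta (x k)) (lim_info s2 wt theta x').
Proof.
move=> tx; rewrite -design_gram//; under eq_fun do rewrite -design_gram//.
by apply: mtends_mul; [apply: mtends_tr|]; exact: design_tends.
Qed.

Lemma measurable_lim_level j : measurable_fun setT (fun v : 'rV[R]_(m + q.+1 * m) => lim_level (lsubmx v) j).
Proof.
apply: measurable_funD => //; apply: measurable_funM => //; under eq_fun do rewrite mxE.
exact: measurable_coord.
Qed.

Lemma measurable_lim_wald : measurable_fun setT lim_wald.
Proof.
have mS := measurable_design measurable_lim_level.
have mI : measurable_fun setT (fun v : 'rV[R]_(m + q.+1 * m) => lim_info s2 wt theta (lim_level (lsubmx v))).
  under eq_fun do rewrite -design_gram//.
  by apply: measurable_mulmx => //; exact: measurable_trmx.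
apply: measurable_wald_form => //.
apply: measurable_mulmx => //; apply: measurable_mulmx; last exact: measurable_invmx.
apply: measurable_mulmx => //; apply: measurable_mxP => i j; under eq_fun do rewrite mxE.
exact: measurable_coord.
Qed.

Variables (j0 j1 : 'I_m).
Hypothesis j01 : j0 != j1.

Definition distinct_levels : set 'rV[R]_(m + q.+1 * m) :=
  [set v | lim_level (lsubmx v) j0 != lim_level (lsubmx v) j1].

Lemma measurable_distinct_levels : measurable distinct_levels.
Proof.
have mE : measurable_fun setT (fun v : 'rV[R]_(m + q.+1 * m) =>
    ~~ (lim_level (lsubmx v) j0 == lim_level (lsubmx v) j1)).
  by apply: measurable_neg; apply: measurable_fun_eqr; exact: measurable_lim_level.
rewrite -[X in measurable X]setTI.
by apply: (mE measurableT [set true]).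
Qed.

Lemma lim_wald_tends u v : distinct_levels v -> mtends u v -> tends (lim_wald \o u) (lim_wald v).
Proof.
move=> x01 tu.
have tx j : tends (fun k => lim_level (lsubmx (u k)) j) (lim_level (lsubmx v) j).
  apply: tendsD; first exact: tends_cst.
  apply: tendsM; first exact: tends_cst.
  by apply: (tends_eq (tu ord0 (lshift _ j))) => [k|]; rewrite mxE.
have uJ := lim_info_unit hs2 hwt theta x01.
have [VE Vi] := profiled_gram (design_gram hs2 hwt theta (lim_level (lsubmx v)))
  (design_inj hs2 hwt (theta := theta) x01) rH.
apply: wald_form_tends => //.
- exact: mtends_cst.
- exact: lim_info_tends.
- apply: mtends_mul; last exact: mtends_cst.
  apply: mtends_mul; last by apply: mtends_inv => //; exact: lim_info_tends.
  apply: mtends_mul; last exact: design_tends.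
  by move=> i j; apply: (tends_eq (tu i (rshift _ j))) => [k|]; rewrite mxE.
- by rewrite -VE; exact: gram_unitmx.
Qed.

(** The two limiting levels agree exactly on an affine hyperplane orthogonal to this vector. *)
Let contrast : 'cV[R]_m :=
  Num.sqrt (sx2 j0) *: delta_mx j0 ord0 - Num.sqrt (sx2 j1) *: delta_mx j1 ord0.

Let contrast_neq0 : contrast != 0.
Proof.
apply/eqP => /matrixP/(_ j0 ord0); rewrite !mxE !eqxx (negbTE j01) mulr0 subr0 mulr1.
by apply/eqP; rewrite gt_eqF// sqrtr_gt0.
Qed.

Let equal_levelsE u : (lim_level u j0 = lim_level u j1) =
  ((u *m contrast) ord0 ord0 = level_mean theta j1 - level_mean theta j0).
Proof.
rewrite mulmxBr -!scalemxAr -!colE !mxE /lim_level.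
by apply/propext; split; lra.
Qed.

Lemma gauss_equal_levels : gauss m [set u | lim_level u j0 = lim_level u j1] = 0%E.
Proof. by under eq_set do rewrite equal_levelsE; exact: gauss_hyperplane. Qed.

Lemma gauss_distinct_levels : gauss (m + q.+1 * m) (~` distinct_levels) = 0%E.
Proof.
have c0 : col_mx contrast (0 : 'cV[R]_(q.+1 * m)) != 0.
  by rewrite col_mx_eq0 negb_and contrast_neq0.
rewrite -(gauss_hyperplane (level_mean theta j1 - level_mean theta j0) c0); congr (gauss _ _).
apply/seteqP; split=> v; rewrite /distinct_levels /= -[in (v *m _)](hsubmxK v) mul_row_col mulmx0 addr0 -equal_levelsE.
  by move=> /negP; rewrite negbK => /eqP.
by move=> ->; rewrite eqxx.
Qed.

Lemma lim_wald_law (F : R -> \bar R) : measurable_fun setT F -> (forall s, 0 <= F s)%E ->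
  (\int[gauss (m + q.+1 * m)]_v F (lim_wald v) =
   \int[gauss r]_v F (\sum_(l < r) v ord0 l ^+ 2)%R)%E.
Proof.
move=> mF F0.
have mG : measurable_fun setT (fun v => F (lim_wald v)) by exact: measurableT_comp mF measurable_lim_wald.
rewrite gauss_split//.
set K := (X in _ = X).
transitivity (\int[gauss m]_u cst K u)%E; last first.
  rewrite integral_cst//; move: (probability_setT (gauss (R := R) m)) => /= ->; rewrite mule1//.
apply: ge0_ae_eq_integral => //.
- apply: (measurable_fun_fubini_tonelli_F (m2 := gauss (q.+1 * m))
    (fun p : 'rV[R]_m * 'rV[R]_(q.+1 * m) => F (lim_wald (rV_pair p)))) => //.
  exact: (measurableT_comp mG (@measurable_row_mx R _ _)).
- by move=> u _; exact: integral_ge0.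
- by move=> u _; exact: integral_ge0.
exists [set u : 'rV[R]_m | lim_level u j0 = lim_level u j1]; split.
- rewrite [X in measurable X](_ : _ = [set u : 'rV[R]_m | lim_level u j0 == lim_level u j1]).
    have mE : measurable_fun setT (fun u : 'rV[R]_m => lim_level u j0 == lim_level u j1).
      apply: measurable_fun_eqr; apply: measurable_funD => //; apply: measurable_funM => //;
      exact: measurable_coord.
    rewrite -[X in measurable X]setTI.
    by apply: (mE measurableT [set true]).
  by apply/seteqP; split=> u /eqP.
- exact: gauss_equal_levels.
move=> u /= nE; apply: contrapT => /eqP x01; apply: nE => _.
have uJ := lim_info_unit hs2 hwt theta x01.
have [VE Vi] := profiled_gram (design_gram hs2 hwt theta (lim_level u))
  (design_inj hs2 hwt (theta := theta) x01) rH.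
rewrite /K -(gauss_projection Vi mF)//.
apply: eq_integral => g _; congr F; rewrite /lim_wald row_mxKl row_mxKr.
rewrite /wald_form uJ -VE gram_unitmx//=.
by rewrite !trmx_mul !mulmxA.
Qed.

End limit_law.

(** By injectivity of [mxvec_index], only the errors of the cell [(i, j)] contribute. *)
Lemma sum_mxvec_fibre (V : nmodType) a b (N : 'I_a -> nat) i j
    (f : {i : 'I_a & ('I_b * 'I_(N i))%type} -> V) :
  \sum_s (if mxvec_index i j == mxvec_index (tag s) (tagged s).1 then f s else 0) =
  \sum_(k < N i) f (Tagged (fun i => ('I_b * 'I_(N i))%type) (j, k)).
Proof.
pose F i' (p : 'I_b * 'I_(N i')) := if mxvec_index i j == mxvec_index i' p.1 then
  f (Tagged (fun i => ('I_b * 'I_(N i))%type) p) else 0.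
transitivity (\sum_i' \sum_(p : 'I_b * 'I_(N i')) F i' p).
  rewrite (sig_big_dep xpredT (fun _ => xpredT) F) /=.
  by apply: eq_bigr => -[i' p] _.
have idx i' j' : (mxvec_index i j == mxvec_index i' j') = (i == i') && (j == j').
  apply/eqP/andP => [E|[/eqP-> /eqP->]//].
  by have [-> ->] := enum_rank_inj (cast_ord_inj E).
rewrite (bigD1 i)//= [X in _ + X]big1 ?addr0; last first.
  by move=> i' i'i; rewrite big1// => p _; rewrite /F idx eq_sym (negbTE i'i).
transitivity (\sum_j' \sum_k F i (j', k)).
  by rewrite pair_bigA; apply: eq_bigr => -[].
rewrite (bigD1 j)//= [X in _ + X]big1 ?addr0; last first.
  by move=> j' j'j; rewrite big1// => k _; rewrite /F idx eqxx /= eq_sym (negbTE j'j).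
by apply: eq_bigr => k _; rewrite /F eqxx.
Qed.

(** * From the sample to a standard Gaussian vector *)

Section sampling.
Context {R : realType} {m q : nat}.
Variables (sx2 : 'I_m -> R) (s2 : 'I_q.+1 -> 'I_m -> R) (N : 'I_q.+1 -> nat).
Hypotheses (hsx2 : forall j, 0 < sx2 j) (hs2 : forall i j, 0 < s2 i j).
Hypothesis N0 : forall i, (0 < N i)%N.
Context d (T : measurableType d) (P : probability T R).
Variables (x : 'I_m -> {RV P >-> R})
          (e : forall i : 'I_q.+1, 'I_m -> 'I_(N i) -> {RV P >-> R}).
Variable t : 'rV[R]_(m + (q + q)).
Hypothesis model : latent_model sx2 s2 x e t.

Local Notation I := ('I_m + {i : 'I_q.+1 & ('I_m * 'I_(N i))%type})%type.

Definition noise_mean w i j : R :=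
  (\sum_(k < N i) @e i j k w / Num.sqrt (s2 i j)) / Num.sqrt (N i)%:R.

Definition std_sample (w : T) : 'rV[R]_(m + q.+1 * m) :=
  row_mx (\row_j ((x j w - level_mean t j) / Num.sqrt (sx2 j)))
    (mxvec (\matrix_(i, j) noise_mean w i j)).

Let lmean (u : I) : R := if u is inl j then level_mean t j else 0.
Let lvar (u : I) : R := match u with inl j => sx2 j | inr s => s2 (tag s) (tagged s).1 end.

(** Coefficients that turn the standardized latent variables into [std_sample]: a level is copied,
    and each error of a cell with [N i] replicates has weight [1 / sqrt (N i)], which makes the
    columns orthonormal. *)
Let weight (u : I) (c : 'I_(m + q.+1 * m)) : R :=
  match fintype.split c, u with
  | inl j, inl j' => (j == j')%:R
  | inr k, inr s => if k == mxvec_index (tag s) (tagged s).1 then (Num.sqrt (N (tag s))%:R)^-1 else 0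
  | _, _ => 0
  end.

Let average : 'M[R]_(#|{: I}|, m + q.+1 * m) := \matrix_(a, c) weight (enum_val a) c.

Let sum_enum (f : I -> R) : \sum_(a < #|{: I}|) f (enum_val a) = \sum_u f u.
Proof. by rewrite [RHS](big_enum_val (A := {: I})). Qed.

Let weight_l u j : weight u (lshift _ j) = if u is inl j' then (j == j')%:R else 0.
Proof. by rewrite /weight -[lshift _ j]/(unsplit (inl j)) unsplitK; case: u. Qed.

Let weight_r u k : weight u (rshift _ k) = if u is inr s then
  if k == mxvec_index (tag s) (tagged s).1 then (Num.sqrt (N (tag s))%:R)^-1 else 0 else 0.
Proof. by rewrite /weight -[rshift _ k]/(unsplit (inr k)) unsplitK; case: u. Qed.

Lemma average_orthonormal : average^T *m average = 1%:M.
Proof.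
apply/matrixP => c c'; rewrite !mxE.
under eq_bigr do rewrite !mxE.
rewrite (sum_enum (fun u => weight u c * weight u c')) big_sumType /=.
have [j ->|k ->] := split_ordP c; have [j' ->|k' ->] := split_ordP c'.
- rewrite [X in _ + X]big1 ?addr0; last by move=> s _; rewrite !weight_l mul0r.
  under eq_bigr do rewrite !weight_l.
  rewrite (bigD1 j)//= big1 ?addr0 ?eqxx ?mul1r ?eq_lshift 1?eq_sym//.
  by move=> l lj; rewrite eq_sym (negbTE lj) mul0r.
- rewrite !big1 ?addr0 ?eq_lrshift// => u _; rewrite weight_l weight_r ?mul0r ?mulr0//.
- rewrite !big1 ?addr0 ?eq_rlshift// => u _; rewrite weight_l weight_r ?mul0r ?mulr0//.
rewrite [X in X + _]big1 ?add0r; last by move=> s _; rewrite !weight_r mul0r.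
rewrite eq_rshift; case/mxvec_indexP: k => i j.
rewrite (eq_bigr (fun s : {i : 'I_q.+1 & ('I_m * 'I_(N i))%type} =>
   if mxvec_index i j == mxvec_index (tag s) (tagged s).1 then
   (mxvec_index i j == k')%:R / (N (tag s))%:R else 0)); last first.
  move=> s _; rewrite !weight_r; case: eqP => [->|_]; last by rewrite mul0r.
  rewrite eq_sym; case: eqP => _; last by rewrite mulr0 mul0r.
  by rewrite mul1r -invfM -expr2 sqr_sqrtr ?ler0n.
rewrite sum_mxvec_fibre /= sumr_const card_ord -[(_ / _) *+ _]mulr_natr divfK//.
by rewrite pnatr_eq0 -lt0n.
Qed.

Lemma std_sampleE w : std_sample w = standardized (latent x e) lmean lvar w *m average.
Proof.
apply/rowP => c; rewrite [RHS]mxE.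
under eq_bigr do rewrite !mxE.
rewrite (sum_enum (fun u => (latent x e u w - lmean u) / Num.sqrt (lvar u) * weight u c)) big_sumType /=.
have [j ->|k ->] := split_ordP c.
  rewrite [LHS]row_mxEl [LHS]mxE [X in _ = _ + X]big1 ?addr0; last by move=> s _; rewrite weight_l mulr0.
  under eq_bigr do rewrite weight_l.
  rewrite (bigD1 j)//= big1 ?addr0 ?eqxx ?mulr1// => l lj.
  by rewrite eq_sym (negbTE lj) mulr0.
rewrite [LHS]row_mxEr [X in _ = X + _]big1 ?add0r; last by move=> s _; rewrite weight_r mulr0.
case/mxvec_indexP: k => i j; rewrite mxvecE mxE /noise_mean.
rewrite (eq_bigr (fun s : {i : 'I_q.+1 & ('I_m * 'I_(N i))%type} =>
   if mxvec_index i j == mxvec_index (tag s) (tagged s).1 then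
   e (tagged s).1 (tagged s).2 w / Num.sqrt (s2 (tag s) (tagged s).1) / Num.sqrt (N (tag s))%:R else 0)); last first.
  by move=> s _; rewrite weight_r subr0; case: eqP => [_|_]; rewrite ?mulr0.
by rewrite sum_mxvec_fibre /= mulr_suml.
Qed.

Lemma measurable_std_sample : measurable_fun setT std_sample.
Proof.
rewrite (_ : std_sample = fun w => standardized (latent x e) lmean lvar w *m average).
  by apply: measurable_mulmx => //; exact: measurable_standardized.
by apply/funext => w; exact: std_sampleE.
Qed.

Lemma std_sample_law (F : 'rV[R]_(m + q.+1 * m) -> \bar R) :
  measurable_fun setT F -> (forall v, 0 <= F v)%E ->
  (\int[P]_w F (std_sample w) = \int[gauss (m + q.+1 * m)]_v F v)%E.
Proof.
move=> mF F0; have [xl el ind] := model.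
have v0 u : 0 < lvar u by case: u => [j|s]; [exact: hsx2|exact: hs2].
have law u : has_normal_law (latent x e u) (lmean u) (lvar u).
  by case: u => [j|s]; [exact: xl|exact: el].
rewrite -(standardized_combination v0 law ind average_orthonormal mF F0).
by apply: eq_integral => w _; rewrite std_sampleE.
Qed.

Lemma obs_mean_observation w i j : obs_mean (observation x e t w) i j =
  alpha t i + beta t i * x j w + Num.sqrt (s2 i j) * noise_mean w i j / Num.sqrt (N i)%:R.
Proof.
have n0 : (N i)%:R != 0 :> R by rewrite pnatr_eq0 -lt0n.
rewrite /obs_mean /observation big_split /= sumr_const card_ord -[(_ + _) *+ _]mulr_natr mulrDl mulfK//.
congr (_ + _); rewrite /noise_mean -mulr_suml.
have a0 : Num.sqrt (s2 i j) != 0 by rewrite gt_eqF ?sqrtr_gt0.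
have b0 : Num.sqrt (N i)%:R != 0 :> R by rewrite gt_eqF ?sqrtr_gt0 ?ltr0n.
rewrite -[in LHS](sqr_sqrtr (ler0n R (N i))); move: (Num.sqrt (s2 i j)) (Num.sqrt _) (\sum_k _) a0 b0 => a b s a0 b0.
by field; rewrite a0 b0.
Qed.

Lemma level_std_sample w j : x j w = level_mean t j + Num.sqrt (sx2 j) * std_sample w ord0 (lshift _ j).
Proof.
have a0 : Num.sqrt (sx2 j) != 0 by rewrite gt_eqF ?sqrtr_gt0.
by rewrite row_mxEl mxE; field.
Qed.

Lemma noise_std_sample w i j : noise_mean w i j = std_sample w ord0 (rshift _ (mxvec_index i j)).
Proof. by rewrite row_mxEr mxvecE mxE. Qed.

End sampling.

Section subsequences.
Context {R : realType}.

Lemma leq_cvg_infty (p : nat -> nat) : (forall k, (k <= p k)%N) -> p k @[k --> \oo] --> \oo.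
Proof.
move=> kp A [k _ kA]; exists k => // l /= kl.
by apply: kA; exact: leq_trans kl (kp l).
Qed.

Lemma tends_sub (u : nat -> R) a (p : nat -> nat) : (forall k, (k <= p k)%N) ->
  tends u a -> tends (u \o p) a.
Proof. by move=> kp [ua]; split; exact: cvg_comp (leq_cvg_infty kp) ua. Qed.

Lemma tends_nat_inv (u : nat -> nat) : u k @[k --> \oo] --> \oo ->
  tends (fun k => (u k)%:R^-1) (0 : R).
Proof.
move=> uoo; split; have h : (n%:R^-1 : R) @[n --> \oo] --> (0 : R).
  by rewrite -cvg_shiftS; exact: cvg_harmonic.
exact: cvg_comp uoo h.
Qed.

End subsequences.

(** * Convergence when every cell is observed *)

Section positive_samples.
Variables (R : realType) (m q r : nat) (hm : (2 <= m)%N)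
  (sx2 : 'I_m -> R) (s2 : 'I_q.+1 -> 'I_m -> R)
  (hsx2 : forall j, 0 < sx2 j) (hs2 : forall i j, 0 < s2 i j)
  (h : 'rV[R]_(q + q) -> 'rV[R]_r)
  (hdiff : forall v, differentiable h v)
  (hcont : continuous (jacobian h))
  (hrank : forall v, \rank (jacobian h v) = r)
  (N : nat -> 'I_q.+1 -> nat) (wt : 'I_q.+1 -> R)
  (hwt : forall i, 0 < wt i) (N0 : forall nu i, (0 < N nu i)%N)
  (hN : forall i, tends (fun nu => (N nu i)%:R^-1) (0 : R))
  (hNwt : forall i, tends (fun nu => (N nu i)%:R / (\sum_l N nu l)%:R) (wt i))
  (that : forall nu, data R m (N nu) -> 'rV[R]_(m + (q + q)))
  (hmle : forall nu (y : data R m (N nu)), is_mle sx2 s2 y (that y))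
  (theta : 'rV[R]_(m + (q + q))) (thetan : nat -> 'rV[R]_(m + (q + q)))
  (hthetan : mtends thetan theta)
  (d : nat -> measure_display) (T : forall nu, measurableType (d nu))
  (P : forall nu, probability (T nu) R)
  (x : forall nu, 'I_m -> {RV (P nu) >-> R})
  (e : forall nu (i : 'I_q.+1), 'I_m -> 'I_(N nu i) -> {RV (P nu) >-> R})
  (hmodel : forall nu, latent_model sx2 s2 (@x nu) (@e nu) (thetan nu))
  (mW : forall nu, measurable_fun [set: T nu] (fun w =>
      let y := observation (@x nu) (@e nu) (thetan nu) w in
      wald sx2 s2 h y (that y) (bias (thetan nu))))
  (d' : measure_display) (T' : measurableType d') (P' : probability T' R)
  (z : 'I_r -> {RV P' >-> R}) (hz : standard_normal_vector z).

(** The matrix [M] only matches the enumeration of ['I_r] by [enum_val] with the index itself. *)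
Lemma sum_sqr_law (F : R -> \bar R) : measurable_fun setT F -> (forall s, 0 <= F s)%E ->
  (\int[gauss r]_v F (\sum_(l < r) v ord0 l ^+ 2)%R = \int[P']_w F (\sum_(l < r) z l w ^+ 2)%R)%E.
Proof.
move=> mF F0; have [zl zi] := hz.
pose M : 'M[R]_(#|'I_r|, r) := \matrix_(a, l) (enum_val a == l)%:R.
have enumE (f : 'I_r -> R) : \sum_(a < #|'I_r|) f (enum_val a) = \sum_l f l.
  by rewrite [RHS](big_enum_val (A := 'I_r)).
have oM : M^T *m M = 1%:M.
  apply/matrixP => a b; rewrite !mxE; under eq_bigr do rewrite !mxE.
  rewrite (enumE (fun l => (l == a)%:R * (l == b)%:R)) (bigD1 a)//= eqxx mul1r big1 ?addr0//.
  by move=> l /negbTE ->; rewrite mul0r.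
have mG : measurable_fun setT (fun v : 'rV[R]_r => F (\sum_(l < r) v ord0 l ^+ 2)).
  apply: measurableT_comp => //; apply: measurable_sum => l; apply: measurable_funX.
  exact: measurable_coord.
rewrite -(standardized_combination (v := fun=> 1) (fun=> ltr01) zl zi oM mG (fun v => F0 _)).
apply: eq_integral => w _; congr F; apply: eq_bigr => l _; congr (_ ^+ 2).
rewrite mxE; under eq_bigr do rewrite !mxE.
rewrite (enumE (fun l' => (z l' w - 0) / Num.sqrt 1 * (l' == l)%:R)) (bigD1 l)//= eqxx.
rewrite big1 => [|l' /negbTE ->]; last by rewrite mulr0.
by rewrite addr0 mulr1 sqrtr1 divr1 subr0.
Qed.

Lemma wald_cvg (f : R -> R) : continuous f -> (exists M, forall s, `|f s| <= M) ->
  \int[P nu]_w f (let y := observation (@x nu) (@e nu) (thetan nu) w in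
      wald sx2 s2 h y (that y) (bias (thetan nu))) @[nu --> \oo] -->
  \int[P']_w f (\sum_(l < r) z l w ^+ 2).
Proof.
move=> cf bf.
have mf : measurable_fun setT f by exact: continuous_measurable_fun.
set H := jacobian h (bias theta).
have rH : \rank H = r by exact: hrank.
(* The assumption on [m] provides the two levels that separate intercepts from slopes. *)
have j01 : Ordinal (leq_trans (ltnW (ltnSn 1)) hm) != Ordinal hm by [].
rewrite -(eq_law_Rintegral mf (P := gauss (m + q.+1 * m)) (X := lim_wald sx2 s2 wt theta H)); last first.
  by move=> F mF F0; rewrite (lim_wald_law hsx2 hs2 hwt theta rH j01 mF F0); exact: sum_sqr_law.
apply: (@continuous_mapping R (m + q.+1 * m) (gauss _) (lim_wald sx2 s2 wt theta H)
  (distinct_levels sx2 theta (Ordinal (leq_trans (ltnW (ltnSn 1)) hm)) (Ordinal hm)) _ _ _ _ d T P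
  (fun nu => std_sample sx2 s2 (@x nu) (@e nu) (thetan nu))
  (fun nu w => let y := observation (@x nu) (@e nu) (thetan nu) w in
      wald sx2 s2 h y (that y) (bias (thetan nu)))) => //.
- exact: measurable_lim_wald.
- exact: measurable_distinct_levels.
- exact: gauss_distinct_levels.
- by move=> u v; exact: lim_wald_tends.
- by move=> nu; exact: measurable_std_sample.
- by move=> nu F; exact: std_sample_law.
move=> p w v kp x01 tU.
pose lx k j := @x (p k) j (w k).
pose g k i j := noise_mean s2 (@e (p k)) (w k) i j.
have tx j : tends (fun k => lx k j) (lim_level sx2 theta (lsubmx v) j).
  have tl : tends (fun k => level_mean (thetan (p k)) j) (level_mean theta j).
    apply: (tends_eq (tends_sub kp (hthetan ord0 (lshift (q + q) j)))) => [k|].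
      by rewrite /level_mean mxE.
    by rewrite /level_mean mxE.
  apply: (tends_eq (tendsD tl (tendsM (tends_cst (Num.sqrt (sx2 j))) (tU ord0 (lshift _ j))))) => [k|].
    by apply/esym; exact: level_std_sample.
  by rewrite /lim_level mxE.
have tg i j : tends (fun k => g k i j) (vec_mx (rsubmx v) i j).
  apply: (tends_eq (tU ord0 (rshift _ (mxvec_index i j)))) => [k|].
    by rewrite /g; apply/esym; exact: noise_std_sample.
  by rewrite !mxE.
have := wald_tends hsx2 hs2 (N := N \o p) (fun k => N0 (p k)) hwt (fun i => tends_sub kp (hN i))
  (fun i => tends_sub kp (hNwt i)) (theta := theta) (th := thetan \o p) (fun i j => tends_sub kp (hthetan i j))
  tx tg x01 (y := fun k => observation (@x (p k)) (@e (p k)) (thetan (p k)) (w k)) _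
  (fun k => @hmle (p k) _) hdiff hcont hrank.
rewrite /lim_wald -/H [X in mxvec X](_ : _ = vec_mx (rsubmx v)); last by apply/matrixP => i j; rewrite mxE.
rewrite vec_mxK; apply => k i j.
exact: (obs_mean_observation hs2 (N0 (p k)) (@x (p k)) (@e (p k)) (thetan (p k)) (w k) i j).
Qed.

End positive_samples.

Theorem theorem4p1
  (R : realType) (m q r : nat) (hm : (2 <= m)%N) (hp : (2 <= q.+1)%N)
  (sx2 : 'I_m -> R) (s2 : 'I_q.+1 -> 'I_m -> R)
  (hsx2 : forall j, 0 < sx2 j) (hs2 : forall i j, 0 < s2 i j)
  (h : 'rV[R]_(q + q) -> 'rV[R]_r)
  (hdiff : forall v, differentiable h v)
  (hcont : continuous (jacobian h))
  (hrank : forall v, \rank (jacobian h v) = r)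
  (* sample sizes n_i and their limiting proportions w_i *)
  (N : nat -> 'I_q.+1 -> nat) (wt : 'I_q.+1 -> R)
  (hN : forall i, N nu i @[nu --> \oo] --> \oo)
  (hwt : forall i, 0 < wt i)
  (hNwt : forall i,
     (N nu i)%:R / (\sum_(l < q.+1) N nu l)%:R @[nu --> \oo] --> wt i)
  (* the maximum likelihood estimator, a function of the data *)
  (that : forall nu, data R m (N nu) -> 'rV[R]_(m + (q + q)))
  (hmle : forall nu (y : data R m (N nu)), is_mle sx2 s2 y (that nu y))
  (theta : 'rV[R]_(m + (q + q))) (thetan : nat -> 'rV[R]_(m + (q + q)))
  (hthetan : thetan nu @[nu --> \oo] --> theta)
  (* the data, distributed according to theta^n *)
  (d : nat -> measure_display) (T : forall nu, measurableType (d nu))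
  (P : forall nu, probability (T nu) R)
  (x : forall nu, 'I_m -> {RV (P nu) >-> R})
  (e : forall nu (i : 'I_q.+1), 'I_m -> 'I_(N nu i) -> {RV (P nu) >-> R})
  (hmodel : forall nu, latent_model sx2 s2 (x nu) (e nu) (thetan nu))
  (hmeas : forall nu a, measurable_fun [set: T nu]
     (fun w => that nu (observation (x nu) (e nu) (thetan nu) w) ord0 a))
  (d' : measure_display) (T' : measurableType d') (P' : probability T' R)
  (z : 'I_r -> {RV P' >-> R}) (hz : standard_normal_vector z) :
  cvg_in_distribution P
    (fun nu w =>
       let y := observation (x nu) (e nu) (thetan nu) w in
       wald sx2 s2 h y (that nu y) (bias (thetan nu)))
    P' (fun w => \sum_(l < r) z l w ^+ 2).
Proof.
have mWald nu : measurable_fun [set: T nu] (fun w =>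
    let y := observation (x nu) (e nu) (thetan nu) w in
    wald sx2 s2 h y (that nu y) (bias (thetan nu))).
  apply: measurable_wald => //.
    move=> i j k; apply: measurable_funD => //; apply: measurable_funD => //.
    exact: measurable_funM.
  by apply: measurable_mxP => i a; rewrite (ord1 i); exact: hmeas.
split=> //.
  by apply: measurable_sum => l; exact: measurable_funX.
move=> f cf bf.
(* Cells may be empty for small indices, whereas the asymptotic argument divides by the cell sizes;
   the whole sequence is shifted by [n0]. *)
have [n0 _ n0P] : \forall nu \near \oo, forall i, (0 < N nu i)%N.
  by apply: filter_forall => i; apply: (hN i [set k | (0 < k)%N]); exists 1%N.
rewrite -(cvg_shiftn n0).
have tN i := tends_nat_inv (R := R) (hN i).
have sub k : (k <= k + n0)%N by exact: leq_addr.
have tth := (mtendsP _ _).1 hthetan.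
apply: (wald_cvg hm hsx2 hs2 hdiff hcont hrank hwt
  (fun nu => n0P _ (leq_addl nu n0)) (fun i => tends_sub sub (tN i))
  (fun i => tends_sub sub ((tendsP _ _).2 (hNwt i)))
  (that := fun nu => that (nu + n0)%N) (fun nu => hmle (nu + n0)%N)
  (fun i j => tends_sub sub (tth i j)) (fun nu => hmodel (nu + n0)%N) (fun nu => mWald (nu + n0)%N) hz cf bf).
Qed.
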